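(* Let $H$, $h$, $g$ be as in the context and suppose that (h-regularity), (g-structure), (g-compactness), (H-growth), (H-smoothness), (monotonicity), (degenerate structure with drift growth) and (Lagrangian lower semicontinuity), all formulated in the context, hold. Let $q=\frac{(\alpha+1)\gamma}{(\alpha+1)\gamma-\alpha}$. Let $(m^\epsilon,u^\epsilon)\in D(A^\epsilon)$ be solutions of the regularized system (given in the context), let $(m,u)\in L^1(\mathbb{T}^d)\times W^{1,\gamma}(\mathbb{T}^d)$, with $m\ge0$ and $\int_{\mathbb{T}^d}m\,dx=1$, be a weak solution of the mean-field game system (given in the context) obtained as the weak limit of $(m^\epsilon,u^\epsilon)$ in $L^1(\mathbb{T}^d)\times W^{1,\gamma}(\mathbb{T}^d)$ along a sequence of parameters $\epsilon\to(0,0)$, and let $J\in L^q(\mathbb{T}^d;\mathbb{R}^d)$ be the weak limit in $L^q(\mathbb{T}^d;\mathbb{R}^d)$, along a subsequence of that sequence, of $J^\epsilon=m^\epsilon D_pH(x,Du^\epsilon,m^\epsilon,h(m^\epsilon))$. Then, for all $\varphi\in C^\infty(\mathbb{T}^d)$, $$\int_{\mathbb{T}^d}\Big[J\cdot D\varphi-H_0(x,D\varphi,m,h(m))\,m-u\Big]dx\le0.$$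
   Context: Setting. $\mathbb{T}^d=\mathbb{R}^d/\mathbb{Z}^d$, $d\ge1$; $\mathbb{E}$ is a fixed set, either $(0,\infty)$ or $[0,\infty)$. $\mathcal{M}_{ac}(\mathbb{T}^d)$ is the space of positive measures on $\mathbb{T}^d$ absolutely continuous with respect to Lebesgue measure; such a measure is identified with its density $m\in L^1(\mathbb{T}^d)$, $m\ge0$ a.e. Given are $H:\mathbb{T}^d\times\mathbb{R}^d\times\mathbb{R}^{d\times d}\times\mathbb{E}\times\mathbb{R}\to\mathbb{R}$, $(x,p,M,m,\theta)\mapsto H(x,p,M,m,\theta)$, a (possibly nonlinear) operator $h:\mathcal{M}_{ac}(\mathbb{T}^d)\to C(\mathbb{T}^d)$ ($h(m)$ is its value at the measure with density $m$), and a continuous function $g:\mathbb{T}^d\times\mathbb{E}\times\mathbb{R}\to\mathbb{R}$. $H(x,Du,D^2u,m,h(m))$ denotes $x\mapsto H(x,Du(x),D^2u(x),m(x),h(m)(x))$, and similarly for derivatives of $H$, for $H_0$, $L_0$ and for $g,g_1,g_2$. Repeated indices $i,j\in\{1,\dots,d\}$ are summed; $M_1:M_2=\operatorname{tr}(M_1M_2)$ for symmetric matrices. Conditions over $m\in\mathcal{M}_{ac}(\mathbb{T}^d)$ involving $g$ or $H$ are understood for densities with values in $\mathbb{E}$ a.e. Mean-field game system: $-u-H(x,Du,D^2u,m,h(m))=0$ and $m-\operatorname{div}(mD_pH(x,Du,D^2u,m,h(m)))+(mD_{M_{ij}}H(x,Du,D^2u,m,h(m)))_{x_ix_j}=1$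 on $\mathbb{T}^d$. Operator $A$ and weak solutions. For $(\eta,v)\in C^\infty(\mathbb{T}^d;\mathbb{E})\times C^\infty(\mathbb{T}^d)$, $A(\eta,v)$ is the pair with components $-v-H(x,Dv,D^2v,\eta,h(\eta))$ and $\eta-\operatorname{div}(\eta D_pH(x,Dv,D^2v,\eta,h(\eta)))+(\eta D_{M_{ij}}H(x,Dv,D^2v,\eta,h(\eta)))_{x_ix_j}-1$. A pair $(m,u)\in\mathcal{D}'(\mathbb{T}^d)\times\mathcal{D}'(\mathbb{T}^d)$ with $m\ge0$ is a weak solution of the mean-field game system if $\langle(\eta,v)-(m,u),A(\eta,v)\rangle\ge0$ for all $(\eta,v)\in C^\infty(\mathbb{T}^d;\mathbb{E})\times C^\infty(\mathbb{T}^d)$ (distributional duality). Regularized system. Fix $N\in\mathbb{N}$ with $2N-4>\frac d2+1$ and $q_0>d$; for each $\epsilon_1\in(0,1)$, $\beta_{\epsilon_1}:(0,\infty)\to(-\infty,0]$ is a fixed non-decreasing $C^\infty$ function with $\beta_{\epsilon_1}(s)=0$ for $s\ge\epsilon_1$ and $\beta_{\epsilon_1}(s)=-s^{-q_0}$ for $0<s\le\epsilon_1/2$. For $\epsilon=(\epsilon_1,\epsilon_2)\in(0,1)^2$, $D(A^\epsilon)=\{(m,u)\in W^{4N,2}(\mathbb{T}^d)\times W^{4N,2}(\mathbb{T}^d):\inf_{\mathbb{T}^d}m>0\}$ and the regularized system is $$\begin{cases}-u-H+\epsilon_1(m+\Delta^{2N}m)+\epsilon_2(m-\Delta m)+\beta_{\epsilon_1}(m)=0,\\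 m-\operatorname{div}(mD_pH)+(mD_{M_{ij}}H)_{x_ix_j}-1+\epsilon_1(u+\Delta^{2N}u)+\epsilon_2(u-\Delta u)=0,\end{cases}$$ with $H$ and derivatives evaluated at $(x,Du,D^2u,m,h(m))$. (h-regularity) For all $\kappa>\frac d2+1$: $h(m)\in W^{\kappa,2}(\mathbb{T}^d)$ for every $m\in W^{\kappa,2}(\mathbb{T}^d)$ ($m\geq 0$), and $m\mapsto h(m)$ is a Fréchet differentiable map from (nonnegative elements of) $W^{\kappa,2}(\mathbb{T}^d)$ to $W^{\kappa,2}(\mathbb{T}^d)$. (g-structure) (1) There are functions $g_1,g_2$ with $g=g_1+g_2$ on $\mathbb{T}^d\times\mathbb{E}\times\mathbb{R}$ and $g_2(x,m(x),h(m)(x))\ge0$ for all $m\in\mathcal{M}_{ac}(\mathbb{T}^d)$. (2) There is $c>0$ with $\int_{\mathbb{T}^d} g_2(x,m,h(m))\,dx\le c\,(1+\int_{\mathbb{T}^d} m\,dx)$ for all $m\in\mathcal{M}_{ac}(\mathbb{T}^d)$. (3) For all $\delta>0$ there is $C_\delta>0$ with $\max\{\int_{\mathbb{T}^d} g_1(x,m,h(m))\,dx,\int_{\mathbb{T}^d} m\,dx\}\le\delta\int_{\mathbb{T}^d} m g_1(x,m,h(m))\,dx+C_\delta$ for all $m\in\mathcal{M}_{ac}(\mathbb{T}^d)$. (4) There is $R\ge0$ with $\int_{\mathbb{T}^d} mg_1(x,m,h(m))\,dx\ge-R$ for all $m\in\mathcal{M}_{ac}(\mathbb{T}^d)$. (g-compactness)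 If $(m_j)\subset\mathcal{M}_{ac}(\mathbb{T}^d)$ and $\sup_j\int_{\mathbb{T}^d} m_jg_1(x,m_j,h(m_j))\,dx<+\infty$, then a subsequence of $(m_j)$ converges weakly in $L^1(\mathbb{T}^d)$. (H-growth) There are constants $\gamma>1$, $0\le\tau<1$, $C_1,C_2,C_3,C_4>0$ such that, with the given continuous function $g:\mathbb{T}^d\times\mathbb{E}\times\mathbb{R}\to\mathbb{R}$ (the same $g=g_1+g_2$ as in (g-structure)): (a) for all $(x,p,M,m,\theta)$, $-H+D_pH\cdot p+D_MH:M\ge\frac1{C_1}m^{-\tau}|p|^\gamma+C_2g(x,m,\theta)-C_1$, with $H$ and derivatives evaluated at $(x,p,M,m,\theta)$; (b) for all $(m,u)\in\mathcal{M}_{ac}(\mathbb{T}^d)\times W^{1,\gamma}(\mathbb{T}^d)$ with $D^2u$ a measurable function, $$-C_3\int_{\mathbb{T}^d} g(x,m,h(m))dx+\frac1{C_1}\int_{\mathbb{T}^d}|Du|^\gamma m^{-\tau}dx-C_1\le\int_{\mathbb{T}^d} H(x,Du,D^2u,m,h(m))dx\le-C_4\int_{\mathbb{T}^d} g(x,m,h(m))dx+C_1\Big(1+\int_{\mathbb{T}^d}|Du|^\gamma m^{-\tau}dx\Big).$$ (H-smoothness) $H$ is of class $C^\infty$ on $\mathbb{T}^d\times\mathbb{R}^d\times\mathbb{R}^{d\times d}\times\mathbb{E}\times\mathbb{R}$. (monotonicity) For all $(\eta,v),(\bar\eta,\bar v)\in C^\infty(\mathbb{T}^d;\mathbb{E})\times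 C^\infty(\mathbb{T}^d)$, $\big(A(\eta,v)-A(\bar\eta,\bar v),(\eta,v)-(\bar\eta,\bar v)\big)_{L^2(\mathbb{T}^d)\times L^2(\mathbb{T}^d)}\ge0$. (degenerate structure with drift growth) $H(x,p,M,m,\theta)=H_0(x,p,m,\theta)-\sum_{i,j=1}^da_{ij}(x)M_{ij}$, where $H_0$ is a real-valued $C^\infty$ function and $(a_{ij})_{1\le i,j\le d}$ is a $C^\infty$ matrix-valued function on $\mathbb{T}^d$ (so $D_pH=D_pH_0$ does not depend on $M$); (H-growth) holds with $\tau=0$; and there are constants $C_5>0$ and $\alpha>0$ such that, for all $(x,p,m,\theta)\in\mathbb{T}^d\times\mathbb{R}^d\times\mathbb{E}\times\mathbb{R}$, $|D_pH_0(x,p,m,\theta)|\le C_5(1+|p|^{\gamma-1})$ and $g_1(x,m,\theta)\ge\frac1{C_5}m^\alpha-C_5$. (Lagrangian lower semicontinuity) For $(x,v,m,\theta)\in\mathbb{T}^d\times\mathbb{R}^d\times\mathbb{E}\times\mathbb{R}$ let $L_0(x,v,m,\theta)=\sup_{p\in\mathbb{R}^d}\{-p\cdot v-H_0(x,p,m,\theta)\}$. For all $(x,m,\theta)\in\mathbb{T}^d\times\mathbb{E}\times\mathbb{R}$ the map $p\mapsto H_0(x,p,m,\theta)$ is convex; moreover the functional $(m,J)\in L^{\alpha+1}(\mathbb{T}^d)\times L^q(\mathbb{T}^d;\mathbb{R}^d)\mapsto\int_{\mathbb{T}^d}mL_0\big(x,\frac Jm,m,h(m)\big)dx$ (with $m\ge0$),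 $q=\frac{(\alpha+1)\gamma}{(\alpha+1)\gamma-\alpha}$, is sequentially weakly lower semicontinuous in $L^{\alpha+1}(\mathbb{T}^d)\times L^q(\mathbb{T}^d;\mathbb{R}^d)$. Convention where $m=0$: the integrand $mL_0(x,J/m,m,h(m))$ is $0$ if $J=0$ and $+\infty$ if $J\ne0$, and $H_0(x,D\varphi,m,h(m))\,m=0$. *)

(* Defs.v *)
From HB Require Import structures.
From mathcomp Require Import all_boot all_order all_algebra.
From mathcomp Require Import all_classical all_reals all_analysis.

Set Implicit Arguments.
Unset Strict Implicit.
Unset Printing Implicit Defensive.

Import Order.TTheory GRing.Theory Num.Theory.
Import numFieldNormedType.Exports.

Local Open Scope classical_set_scope.
Local Open Scope ring_scope.

(* Functions on the torus T^d = R^d / Z^d are represented by Z^d-periodic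
   functions on 'rV[R]_d.  Integrals over T^d are integrals against [leb], the
   Lebesgue measure of R^d restricted to the unit cube [0,1]^d, which is a
   fundamental domain up to a null set; "almost everywhere" refers to [leb]. *)

Definition rV_display : measure_display -> measure_display.
Proof. exact. Qed.

Section measurable_rV.
Context {R : realType} (n : nat).

Let coord : 'I_n -> 'rV[R]_n -> R := fun i x => x ord0 i.

Let rV_set0 : g_sigma_preimage coord set0.
Proof. exact: sigma_algebra0. Qed.

Let rV_setC A : g_sigma_preimage coord A -> g_sigma_preimage coord (~` A).
Proof. exact: sigma_algebraC. Qed.

Let rV_bigcup (F : _^nat) : (forall i, g_sigma_preimage coord (F i)) ->
  g_sigma_preimage coord (\bigcup_i (F i)).
Proof. exact: sigma_algebra_bigcup. Qed.

(* The product (= Borel) sigma-algebra, generated by the coordinates. *)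
HB.instance Definition _ :=
  @isMeasurable.Build (rV_display default_measure_display) 'rV[R]_n
    (g_sigma_preimage coord) rV_set0 rV_setC rV_bigcup.

Lemma measurable_rV_coord (i : 'I_n) :
  measurable_fun [set: 'rV[R]_n] (fun x : 'rV[R]_n => x ord0 i).
Proof.
move=> _ Y mY; rewrite setTI; apply: sub_sigma_algebra => /=.
rewrite -bigcup_seq/=; exists i => /=; first by rewrite mem_index_enum.
by exists Y => //; rewrite setTI.
Qed.

Lemma measurable_fun_rV d (T : measurableType d) (f : T -> 'rV[R]_n) :
  (forall i, measurable_fun [set: T] (fun t => f t ord0 i)) ->
  measurable_fun [set: T] f.
Proof.
move=> mf _ Y mY; rewrite setTI.
pose G := [set A : set 'rV[R]_n | measurable (f @^-1` A)].
suff : G Y by [].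
apply: (mY G); split.
  split=> [|A GA|F GF]; rewrite /G /=.
  - by rewrite preimage_set0.
  - by rewrite setTD -preimage_setC; exact: measurableC.
  - by rewrite preimage_bigcup; exact: bigcupT_measurable.
rewrite -bigcup_seq => A [i _ [B mB <-]].
by rewrite /G /= setTI; rewrite -[X in measurable X]setTI; exact: (mf i).
Qed.

End measurable_rV.

Section torus_measure.
Context {R : realType}.

Definition rV_cons n (xv : measurableTypeR R * 'rV[R]_n) : 'rV[R]_n.+1 :=
  \row_i oapp (fun j => xv.2 ord0 j) xv.1 (unlift ord0 i).

Lemma measurable_rV_cons n : measurable_fun setT (@rV_cons n).
Proof.
apply: measurable_fun_rV => i; rewrite /rV_cons.
case: (unliftP ord0 i) => [j ij|ij].
  rewrite (_ : (fun _ => _) =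
    (fun v : 'rV[R]_n => v ord0 j) \o (@snd (measurableTypeR R) 'rV[R]_n)); last first.
    by apply/funext => xv /=; rewrite mxE ij liftK.
  apply: measurableT_comp; last exact: measurable_snd.
  exact: measurable_rV_coord.
rewrite (_ : (fun _ => _) = @fst (measurableTypeR R) 'rV[R]_n); first exact: measurable_fst.
by apply/funext => xv /=; rewrite mxE ij unlift_none.
Qed.

HB.instance Definition _ n :=
  isMeasurableFun.Build _ _ _ _ (@rV_cons n) (@measurable_rV_cons n).

Fixpoint leb (n : nat) : probability 'rV[R]_n R :=
  match n with
  | 0 => \d_(0 : 'rV[R]_0)
  | n'.+1 =>
    distribution (uniform_prob (@ltr01 R) \x leb n')%E (@rV_cons n')
  end.

End torus_measure.

Section smoothness.
Context {R : realType}.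

(* C^oo regularity on a set D which is either open or has smooth boundary:
   all iterated directional derivatives, taken inside D (hence one-sided at
   boundary points), exist and are continuous on D; F s is the derivative of f
   along the directions listed in s. *)
Definition smooth_on (V : normedModType R) (D : set V) (f : V -> R) :=
  exists F : seq V -> V -> R,
    (forall x, D x -> F [::] x = f x) /\
    forall s : seq V,
      {within D, continuous (F s)} /\
      forall v x, D x ->
        (fun t : R => t^-1 * (F s (x + t *: v) - F s x))
          @ within [set t | D (x + t *: v)] 0^' --> F (v :: s) x.

End smoothness.

Section torus.
Context {R : realType} {d : nat}.
Local Notation V := 'rV[R]_d.
Local Notation mu := (@leb R d).

Definition periodic (S : Type) (f : V -> S) :=
  forall (x : V) (k : 'rV[int]_d), f (x + map_mx intr k) = f x.

Definition smooth (f : V -> R) := periodic f /\ smooth_on setT f.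

Definition ebase (i : 'I_d) : V := delta_mx ord0 i.

Definition dot (v w : V) : R := \sum_i v ord0 i * w ord0 i.

(* Euclidean norm; the library norm of 'rV[R]_d is the sup norm. *)
Definition enorm (v : V) : R := Num.sqrt (dot v v).

Definition partial (i : 'I_d) (f : V -> R) : V -> R :=
  fun x => 'D_(ebase i) f x.

Definition partials (s : seq 'I_d) (f : V -> R) : V -> R := foldr partial f s.

Definition grad (f : V -> R) (x : V) : V := \row_i partial i f x.

Definition hess (f : V -> R) (x : V) : 'M[R]_d :=
  \matrix_(i, j) partials [:: j; i] f x.

Definition inLp (p : \bar R) (f : V -> R) := periodic f /\ f \in Lfun mu p.

Definition inLp_vec (p : \bar R) (f : V -> V) :=
  forall i, inLp p (fun x => f x ord0 i).

(* Densities of the elements of M_ac(T^d). *)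
Definition Mac (m : V -> R) := inLp 1%E m /\ \forall x \ae mu, 0 <= m x.

Definition MacE (E : set R) (m : V -> R) :=
  Mac m /\ \forall x \ae mu, E (m x).

Definition is_wderiv (s : seq 'I_d) (f g : V -> R) :=
  [/\ inLp 1%E f, inLp 1%E g & forall phi, smooth phi ->
    \int[mu]_x (f x * partials s phi x) =
    (- 1) ^+ size s * \int[mu]_x (g x * phi x)].

Definition wderivable (s : seq 'I_d) (f : V -> R) := exists g, is_wderiv s f g.

(* A representative of the weak derivative, 0 if there is none. *)
Definition wD (s : seq 'I_d) (f : V -> R) : V -> R :=
  xget (cst 0) [set g | is_wderiv s f g].

Definition wgrad (u : V -> R) (x : V) : V := \row_i wD [:: i] u x.

Definition whess (u : V -> R) (x : V) : 'M[R]_d :=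
  \matrix_(i, j) wD [:: j; i] u x.

Definition wlap (f : V -> R) (x : V) : R := \sum_i wD [:: i; i] f x.

Definition sobolev (k : nat) (p : \bar R) (f : V -> R) :=
  inLp p f /\ forall s : seq 'I_d, (size s <= k)%N ->
    exists2 g, inLp p g & is_wderiv s f g.

(* The norm of W^{k,2}(T^d): the sum over the tuples s of length j is the
   squared L^2 norm of the tensor D^j f. *)
Definition sobolev2_norm (k : nat) (f : V -> R) : R :=
  Num.sqrt (\sum_(j < k.+1) \sum_(s : j.-tuple 'I_d)
    \int[mu]_x (wD s f x ^+ 2)).

(* Weak convergence in L^p(T^d), L^p(T^d; R^d) and W^{1,p}(T^d), tested against
   the conjugate exponent; hoelder_conjugate 1 = +oo. *)
Definition weak_Lp (p : \bar R) (f_ : nat -> V -> R) (f : V -> R) :=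
  [/\ forall k, inLp p (f_ k), inLp p f & forall psi,
    inLp (hoelder_conjugate p) psi ->
    (fun k => \int[mu]_x (f_ k x * psi x)) @ \oo --> \int[mu]_x (f x * psi x)].

Definition weak_Lp_vec (p : \bar R) (J_ : nat -> V -> V) (J : V -> V) :=
  [/\ forall k, inLp_vec p (J_ k), inLp_vec p J & forall psi,
    inLp_vec (hoelder_conjugate p) psi ->
    (fun k => \int[mu]_x dot (J_ k x) (psi x)) @ \oo
      --> \int[mu]_x dot (J x) (psi x)].

Definition weak_W1p (p : \bar R) (u_ : nat -> V -> R) (u : V -> R) :=
  [/\ forall k, sobolev 1 p (u_ k), sobolev 1 p u, weak_Lp p u_ u &
    weak_Lp_vec p (fun k => wgrad (u_ k)) (wgrad u)].

(* D'(T^d): linear functionals on C^oo(T^d) that are continuous, i.e. bounded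
   by finitely many of the seminorms sup |D^s phi|. *)
Definition distribution_on (T : (V -> R) -> R) :=
  (forall (a : R) phi psi, smooth phi -> smooth psi ->
     T (fun x => a * phi x + psi x) = a * T phi + T psi) /\
  exists (C : R) (k : nat), forall phi (B : R), smooth phi ->
    (forall s : seq 'I_d, (size s <= k)%N ->
       forall x, `|partials s phi x| <= B) ->
    `|T phi| <= C * B.

Definition regular_distribution (f : V -> R) : (V -> R) -> R :=
  fun phi => \int[mu]_x (f x * phi x).

Section operators.
Variable E : set R.

(* An operator h : M_ac(T^d) -> C(T^d); measures with a.e. equal densities are
   the same element of M_ac(T^d). *)
Definition operator_Mac_C (h : (V -> R) -> V -> R) :=
  (forall m, Mac m -> periodic (h m) /\ continuous (h m)) /\
  forall m m', Mac m -> Mac m' -> (\forall x \ae mu, m x = m' x) -> h m = h m'.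

Definition frechet_W2 (k : nat) (h : (V -> R) -> V -> R) (m : V -> R) :=
  exists L : (V -> R) -> V -> R,
    [/\ forall f, sobolev k 2%:E f -> sobolev k 2%:E (L f),
        forall (a : R) f g, sobolev k 2%:E f -> sobolev k 2%:E g ->
          \forall x \ae mu, L (fun y => a * f y + g y) x = a * L f x + L g x,
        exists C : R, forall f, sobolev k 2%:E f ->
          sobolev2_norm k (L f) <= C * sobolev2_norm k f &
        forall e : R, 0 < e -> exists2 r : R, 0 < r &
          forall m', sobolev k 2%:E m' -> (\forall x \ae mu, 0 <= m' x) ->
            sobolev2_norm k (m' \- m) < r ->
            sobolev2_norm k ((h m' \- h m) \- L (m' \- m)) <=
              e * sobolev2_norm k (m' \- m)].

Definition h_regularity (h : (V -> R) -> V -> R) :=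
  forall k : nat, (d%:R / 2 + 1 < k%:R :> R) ->
  forall m, sobolev k 2%:E m -> (\forall x \ae mu, 0 <= m x) ->
    sobolev k 2%:E (h m) /\ frechet_W2 k h m.

Definition comp_g (g : V -> R -> R -> R) (h : (V -> R) -> V -> R)
  (m : V -> R) : V -> R := fun x => g x (m x) (h m x).

Definition continuous_coupling (g : V -> R -> R -> R) :=
  (forall m th, periodic (fun x => g x m th)) /\
  {within [set z : V * R * R | E z.1.2],
    continuous (fun z => g z.1.1 z.1.2 z.2)}.

(* Integrals that may be infinite are extended-real valued.  The measurability
   clause is what the integrals of g_1 and g_2 in the conditions presuppose. *)
Definition g_structure (h : (V -> R) -> V -> R) (g g1 g2 : V -> R -> R -> R) :=
  [/\ (forall x m th, E m -> g x m th = g1 x m th + g2 x m th) /\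
      (forall m th, periodic (fun x => g1 x m th) /\
                    periodic (fun x => g2 x m th)) /\
      (forall m, Mac m -> (forall x, E (m x)) ->
         measurable_fun setT (comp_g g1 h m)) /\
      (forall m, MacE E m -> \forall x \ae mu, 0 <= comp_g g2 h m x),
      exists2 c : R, 0 < c & forall m, MacE E m ->
        (\int[mu]_x (comp_g g2 h m x)%:E <=
         c%:E * (1 + \int[mu]_x (m x)%:E))%E,
      forall delta : R, 0 < delta -> exists2 C : R, 0 < C &
        forall m, MacE E m ->
        (maxe (\int[mu]_x (comp_g g1 h m x)%:E) (\int[mu]_x (m x)%:E) <=
         delta%:E * (\int[mu]_x (m x * comp_g g1 h m x)%:E) + C%:E)%E &
      exists2 r : R, 0 <= r & forall m, MacE E m ->
        ((- r)%:E <= \int[mu]_x (m x * comp_g g1 h m x)%:E)%E].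

Definition g_compactness (h : (V -> R) -> V -> R) (g1 : V -> R -> R -> R) :=
  forall m_ : nat -> V -> R, (forall j, MacE E (m_ j)) ->
  (exists C : R, forall j,
     (\int[mu]_x (m_ j x * comp_g g1 h (m_ j) x)%:E <= C%:E)%E) ->
  exists (sigma : nat -> nat) (m : V -> R),
    {homo sigma : i j / (i < j)%N} /\ weak_Lp 1%E (fun k => m_ (sigma k)) m.

Definition hamiltonian := V -> V -> 'M[R]_d -> R -> R -> R.

Definition DpH (H : hamiltonian) (i : 'I_d) : hamiltonian :=
  fun x p M m th => 'D_(ebase i) (fun p' : V => H x p' M m th) p.

Definition DMH (H : hamiltonian) (i j : 'I_d) : hamiltonian :=
  fun x p M m th =>
    'D_(delta_mx i j) (fun M' : 'M[R]_d => H x p M' m th) M.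

(* x |-> H(x, P(x), Q(x), m(x), th(x)) *)
Definition along (H : hamiltonian) (P : V -> V) (Q : V -> 'M[R]_d)
  (m th : V -> R) : V -> R := fun x => H x (P x) (Q x) (m x) (th x).

Definition H_smoothness (H : hamiltonian) :=
  (forall p M m th, periodic (fun x => H x p M m th)) /\
  smooth_on [set z : V * V * 'M[R]_d * R * R | E z.1.2]
    (fun z => H z.1.1.1.1 z.1.1.1.2 z.1.1.2 z.1.2 z.2).

(* M1 : M2 is the entrywise product, equal to tr (M1 M2) for symmetric
   matrices.  When tau = 0, the powers m `^ (- tau) below are all 1, including
   at m = 0. *)
Definition H_growth (H : hamiltonian) (h : (V -> R) -> V -> R)
    (g : V -> R -> R -> R) (gamma tau : R) :=
  [/\ 1 < gamma, 0 <= tau < 1 &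
  exists C1 C2 C3 C4 : R,
  [/\ [/\ 0 < C1, 0 < C2, 0 < C3 & 0 < C4],
    forall x p M m th, E m ->
      C1^-1 * m `^ (- tau) * enorm p `^ gamma + C2 * g x m th - C1 <=
      - H x p M m th + \sum_i DpH H i x p M m th * p ord0 i
      + \sum_i \sum_j DMH H i j x p M m th * M i j &
    forall m u, MacE E m -> sobolev 1 gamma%:E u ->
      (forall i j, wderivable [:: j; i] u) ->
      let IDu := (\int[mu]_x (enorm (wgrad u x) `^ gamma * m x `^ (- tau))%:E)%E in
      let Ig := (\int[mu]_x (comp_g g h m x)%:E)%E in
      let IH := (\int[mu]_x (along H (wgrad u) (whess u) m (h m) x)%:E)%E in
      ((- C3)%:E * Ig + C1^-1%:E * IDu - C1%:E <= IH /\
       IH <= (- C4)%:E * Ig + C1%:E * (1 + IDu))%E]].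

Definition A1 (H : hamiltonian) (h : (V -> R) -> V -> R) (eta v : V -> R)
    : V -> R :=
  fun x => - v x - along H (grad v) (hess v) eta (h eta) x.

Definition A2 (H : hamiltonian) (h : (V -> R) -> V -> R) (eta v : V -> R)
    : V -> R :=
  fun x => eta x
    - \sum_i partial i
        (fun y => eta y * along (DpH H i) (grad v) (hess v) eta (h eta) y) x
    + \sum_i \sum_j partials [:: j; i]
        (fun y => eta y * along (DMH H i j) (grad v) (hess v) eta (h eta) y) x
    - 1.

Definition smoothE (eta : V -> R) := smooth eta /\ forall x, E (eta x).

Definition monotonicity (H : hamiltonian) (h : (V -> R) -> V -> R) :=
  forall eta v eta' v', smoothE eta -> smooth v -> smoothE eta' -> smooth v' ->
  0 <= \int[mu]_x ((A1 H h eta v x - A1 H h eta' v' x) * (eta x - eta' x)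
                 + (A2 H h eta v x - A2 H h eta' v' x) * (v x - v' x)).

Definition weak_solution (H : hamiltonian) (h : (V -> R) -> V -> R)
    (m u : (V -> R) -> R) :=
  [/\ distribution_on m, distribution_on u,
    forall phi, smooth phi -> (forall x, 0 <= phi x) -> 0 <= m phi &
    forall eta v, smoothE eta -> smooth v ->
      0 <= (\int[mu]_x (eta x * A1 H h eta v x + v x * A2 H h eta v x))
           - (m (A1 H h eta v) + u (A2 H h eta v))].

Definition penalization (q0 : R) (beta : R -> R -> R) :=
  d%:R < q0 /\
  forall e1 : R, 0 < e1 < 1 ->
  [/\ smooth_on [set s : R | 0 < s] (beta e1),
      forall s t, 0 < s -> s <= t -> beta e1 s <= beta e1 t,
      forall s, 0 < s -> beta e1 s <= 0,
      forall s, e1 <= s -> beta e1 s = 0 &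
      forall s, 0 < s -> s <= e1 / 2 -> beta e1 s = - (s `^ (- q0))].

(* The density m is represented so that its infimum over the torus, and not
   only its essential infimum, is positive. *)
Definition reg_domain (N : nat) (m u : V -> R) :=
  [/\ sobolev (4 * N)%N 2%:E m, sobolev (4 * N)%N 2%:E u &
      exists2 c : R, 0 < c & forall x, c <= m x].

(* Strong (a.e.) solutions.  The weak derivatives of the fluxes exist by
   Sobolev embedding when 2N - 4 > d/2 + 1; their existence is recorded since
   wD would otherwise take the default value 0. *)
Definition reg_solution (H : hamiltonian) (h : (V -> R) -> V -> R)
    (beta : R -> R -> R) (N : nat) (e1 e2 : R) (m u : V -> R) :=
  let F i := fun y => m y * along (DpH H i) (wgrad u) (whess u) m (h m) y in
  let G i j :=
    fun y => m y * along (DMH H i j) (wgrad u) (whess u) m (h m) y in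
  [/\ forall i, wderivable [:: i] (F i),
      forall i j, wderivable [:: j; i] (G i j),
      \forall x \ae mu,
        - u x - along H (wgrad u) (whess u) m (h m) x
        + e1 * (m x + iter (2 * N)%N wlap m x) + e2 * (m x - wlap m x)
        + beta e1 (m x) = 0 &
      \forall x \ae mu,
        m x - \sum_i wD [:: i] (F i) x
        + \sum_i \sum_j wD [:: j; i] (G i j) x - 1
        + e1 * (u x + iter (2 * N)%N wlap u x) + e2 * (u x - wlap u x) = 0].

(* As D_pH does not depend on M in the degenerate case, D_pH = D_pH_0. *)
Definition DpH0 (H0 : V -> V -> R -> R -> R) (x p : V) (m th : R) : V :=
  \row_i 'D_(ebase i) (fun p' : V => H0 x p' m th) p.

(* The growth condition itself is H_growth, whose exponents are gamma, tau. *)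
Definition degenerate_structure (H : hamiltonian) (H0 : V -> V -> R -> R -> R)
    (a : V -> 'M[R]_d) (g1 : V -> R -> R -> R) (gamma tau alpha : R) :=
  [/\ (forall p m th, periodic (fun x => H0 x p m th)) /\
      smooth_on [set z : V * V * R * R | E z.1.2]
        (fun z => H0 z.1.1.1 z.1.1.2 z.1.2 z.2),
      forall i j, smooth (fun x => a x i j),
      forall x p M m th, E m ->
        H x p M m th = H0 x p m th - \sum_i \sum_j a x i j * M i j,
      tau = 0 &
      0 < alpha /\ exists2 C5 : R, 0 < C5 &
        forall x p m th, E m ->
          enorm (DpH0 H0 x p m th) <= C5 * (1 + enorm p `^ (gamma - 1)) /\
          C5^-1 * m `^ alpha - C5 <= g1 x m th].

Definition L0 (H0 : V -> V -> R -> R -> R) (x v : V) (m th : R) : \bar R :=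
  ereal_sup (range (fun p : V => (- dot p v - H0 x p m th)%:E)).

(* m L_0(x, J/m, m, h(m)) with its convention where m = 0. *)
Definition mL0 (H0 : V -> V -> R -> R -> R) (h : (V -> R) -> V -> R)
    (m : V -> R) (J : V -> V) (x : V) : \bar R :=
  if m x == 0 then (if J x == 0 then 0%E else +oo%E)
  else ((m x)%:E * L0 H0 x ((m x)^-1 *: J x) (m x) (h m x))%E.

Definition lagrangian_lsc (H0 : V -> V -> R -> R -> R)
    (h : (V -> R) -> V -> R) (alpha q : R) :=
  (forall x m th, E m ->
     convex_function [set: V] (fun p : V => H0 x p m th)) /\
  forall (m_ : nat -> V -> R) (m : V -> R) (J_ : nat -> V -> V) (J : V -> V),
    (forall k, \forall x \ae mu, 0 <= m_ k x) ->
    (\forall x \ae mu, 0 <= m x) ->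
    weak_Lp (alpha + 1)%:E m_ m -> weak_Lp_vec q%:E J_ J ->
    (\int[mu]_x mL0 H0 h m J x <=
     limn_einf (fun k => \int[mu]_x mL0 H0 h (m_ k) (J_ k) x))%E.

(* H_0(x, Dphi, m, h(m)) m with its convention where m = 0. *)
Definition H0m (H0 : V -> V -> R -> R -> R) (h : (V -> R) -> V -> R)
    (phi m : V -> R) (x : V) : R :=
  if m x == 0 then 0 else H0 x (grad phi x) (m x) (h m x) * m x.

End operators.
End torus.

(* Main.v *)
(* Testing the continuity equation of the regularized system with (the Fourier
   partial sums of) u^eps and the Hamilton-Jacobi equation with m^eps, and
   dropping the signed eps-terms, gives
     int Phi^eps - int u^eps + int m^eps beta(m^eps) <= 0,
     Phi^eps = m^eps (Du^eps . D_pH_0 - H_0),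
   where convexity of H_0 in p identifies Phi^eps with m^eps L_0(x, - J^eps / m^eps).
   Testing the Hamilton-Jacobi equation with 1 as well, the growth conditions
   bound int m^eps g_1 and int |beta(m^eps)| (1 - m^eps).  The first bound
   controls int (m^eps)^(alpha + 1), which turns the weak L^1 convergence of
   m^eps into weak L^(alpha + 1) convergence; the second makes
   int m^eps beta(m^eps) vanish, since beta is supported where m^eps < eps_1.
   Lower semicontinuity, applied along (m^eps, - J^eps), yields
   int m L_0(x, - J / m) <= int u, and
   J . Dphi - H_0(x, Dphi) m <= m L_0(x, - J / m) is Fenchel's inequality.
   The test functions u^eps are only in a Sobolev space, which is why weak
   derivatives, Sobolev embedding and the signs of the Laplacian terms are
   derived from Fourier series. *)
Require Import Defs.
From HB Require Import structures.
From mathcomp Require Import all_boot all_order all_algebra.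
From mathcomp Require Import all_classical all_reals all_analysis.
From mathcomp Require Import measurable_realfun ess_sup_inf ring lra zify.
Import Order.TTheory GRing.Theory Num.Theory.
Import numFieldNormedType.Exports.
Local Open Scope classical_set_scope.
Local Open Scope ring_scope.

Set Implicit Arguments.
Unset Strict Implicit.
Unset Printing Implicit Defensive.

(** * Integrals against a probability measure *)

(** The obstacle is low regularity: the derivatives of the fluxes are known only in $L^1$ and test
    functions must be smooth. Reading weak derivatives off Fourier coefficients resolves it, since
    the derivatives of a partial sum are the partial sums of the weak derivatives. All derivatives
    then fall on the partial sums, and the fluxes have to be only in $L^2$. This follows from the
    boundedness of [m] and [Du] and the growth of [DpH0], whereas the square integrability of the
    Hamiltonian is read off the equation itself. Adding the two tested equations cancels the
    integral of [u], so the estimates depend only on the mass of [m]; the factor [e1 / (1 - e1)]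
    compares m with 1 - m on the support of the penalty. Two measure-theoretic points shape the
    rest. The sigma-algebra of the row vectors is generated by coordinates while [H0] is smooth only
    over [E], hence countably valued approximations. The function m L_0 is a supremum of unknown
    measurability and the final integrand may fail to be integrable, hence comparisons of extended
    integrals with measurable functions. *)

Section integrals.
Context d (T : measurableType d) (R : realType) (mu : probability T R).
Implicit Types f g : T -> R.
Local Notation L1 f := (mu.-integrable setT (EFin \o f)).

Lemma L1_meas f : L1 f -> measurable_fun setT f.
Proof. by move=> /measurable_int/measurable_EFinP. Qed.

Lemma L1D f g : L1 f -> L1 g -> L1 (fun x => f x + g x).
Proof.
move=> lf lg; have := integrableD measurableT lf lg.
exact: eq_integrable.
Qed.

Lemma L1Z (c : R) f : L1 f -> L1 (fun x => c * f x).
Proof.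
by move=> /(integrableZl measurableT c); apply: eq_integrable.
Qed.

Lemma L1N f : L1 f -> L1 (fun x => - f x).
Proof.
by move=> /(@integrableN _ _ _ _ setT); apply: eq_integrable.
Qed.

Lemma L1B f g : L1 f -> L1 g -> L1 (fun x => f x - g x).
Proof. by move=> ? ?; apply: L1D => //; exact: L1N. Qed.

Lemma L1_cst (c : R) : L1 (fun _ => c).
Proof. exact: finite_measure_integrable_cst. Qed.

Lemma L1_sum I (s : seq I) (P : pred I) (F : I -> T -> R) :
  (forall i, L1 (F i)) -> L1 (fun x => \sum_(i <- s | P i) F i x).
Proof.
move=> h; apply: (@eq_integrable _ _ _ _ _ _
  (fun x => (\sum_(i <- s | P i) (F i x)%:E)%E)) => //.
  by move=> x _; rewrite /= -sumEFin.
apply: (integrable_sum measurableT s (P := P)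
  (h := fun i x => (F i x)%:E)) => i _; exact: h.
Qed.

Lemma L1_le f g : measurable_fun setT f -> L1 g ->
  (forall x, `|f x| <= g x) -> L1 f.
Proof.
move=> mf ig fg; apply: (le_integrable measurableT _ _ ig).
  exact/measurable_EFinP.
by move=> x _ /=; rewrite lee_fin (le_trans (fg x))// ler_norm.
Qed.

Lemma L1_bnd f (c : R) : measurable_fun setT f -> (forall x, `|f x| <= c) ->
  L1 f.
Proof. by move=> mf h; exact: (L1_le mf (L1_cst c) h). Qed.

Lemma L1_bndM f g (c : R) : measurable_fun setT f -> (forall x, `|f x| <= c) ->
  L1 g -> L1 (fun x => f x * g x).
Proof.
move=> mf fc ig; apply: (@L1_le _ (fun x => c * `|g x|)).
- by apply: measurable_funM => //; exact: L1_meas.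
- exact: L1Z (integrable_norm ig).
- by move=> x; rewrite normrM ler_wpM2r.
Qed.

Lemma IntD f g : L1 f -> L1 g ->
  \int[mu]_x (f x + g x) = \int[mu]_x f x + \int[mu]_x g x.
Proof. by move=> ? ?; rewrite RintegralD. Qed.

Lemma IntB f g : L1 f -> L1 g ->
  \int[mu]_x (f x - g x) = \int[mu]_x f x - \int[mu]_x g x.
Proof. by move=> ? ?; rewrite RintegralB. Qed.

Lemma IntZ (c : R) f : L1 f -> \int[mu]_x (c * f x) = c * \int[mu]_x f x.
Proof. by move=> ?; rewrite RintegralZl. Qed.

Lemma Int_cst (c : R) : \int[mu]_x c = c.
Proof. by rewrite Rintegral_cst//= probability_setT mulr1. Qed.

Lemma IntN f : L1 f -> \int[mu]_x (- f x) = - \int[mu]_x f x.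
Proof.
by move=> ?; under eq_Rintegral do rewrite -mulN1r; rewrite IntZ// mulN1r.
Qed.

Lemma Int_sum I (s : seq I) (P : pred I) (F : I -> T -> R) :
  (forall i, L1 (F i)) ->
  \int[mu]_x (\sum_(i <- s | P i) F i x) =
  \sum_(i <- s | P i) \int[mu]_x F i x.
Proof.
move=> h; elim: s => [|i s IH].
  by rewrite big_nil; under eq_Rintegral do rewrite big_nil; rewrite Int_cst.
rewrite big_cons; under eq_Rintegral do rewrite big_cons.
case: (P i) => //; rewrite IntD ?IH//; exact: L1_sum.
Qed.

Lemma ae_eq_Int f g : measurable_fun setT f -> measurable_fun setT g ->
  (\forall x \ae mu, f x = g x) -> \int[mu]_x f x = \int[mu]_x g x.
Proof.
move=> mf mg fg; congr fine; apply: ae_eq_integral => //.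
- exact/measurable_EFinP.
- exact/measurable_EFinP.
- by apply: filterS fg => x /= -> _.
Qed.

Lemma ae_eq_L1 f g : measurable_fun setT g ->
  (\forall x \ae mu, f x = g x) -> L1 f -> L1 g.
Proof.
move=> mg fg lf.
have /measurable_EFinP mf := measurable_int _ lf.
apply/integrableP; split; first exact/measurable_EFinP.
have /integrableP[_] := lf.
rewrite [in X in _ -> X](@ae_eq_integral _ _ _ mu setT (fun x => `|(f x)%:E|%E))//.
- exact/measurableT_comp/measurable_EFinP.
- exact/measurableT_comp/measurable_EFinP.
- by apply: filterS fg => x /= -> _.
Qed.

Lemma Int_ge0 f : (\forall x \ae mu, 0 <= f x) -> measurable_fun setT f ->
  0 <= \int[mu]_x f x.
Proof.
move=> f0 mf; rewrite (@ae_eq_Int _ (fun x => `|f x|))//.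
- by apply: Rintegral_ge0 => x _.
- exact: measurableT_comp.
- by apply: filterS f0 => x ?; rewrite ger0_norm.
Qed.

Lemma le_Int f g : L1 f -> L1 g -> (\forall x \ae mu, f x <= g x) ->
  \int[mu]_x f x <= \int[mu]_x g x.
Proof.
move=> lf lg fg; rewrite -subr_ge0 -IntB//; apply: Int_ge0.
  by apply: filterS fg => x; rewrite subr_ge0.
by apply: measurable_funB; exact: L1_meas.
Qed.

Lemma EInt f : L1 f -> (\int[mu]_x (f x)%:E)%E = (\int[mu]_x f x)%:E.
Proof. by move=> lf; rewrite /Rintegral fineK//; exact: integrable_fin_num. Qed.

(** Turns membership in [Lfun mu 2%:E], defined by a finite norm, into integrability of the square,
    to which the $L^1$ lemmas apply. *)
Lemma L2P f : f \in Lfun mu 2%:E <->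
  measurable_fun setT f /\ L1 (fun x => f x ^+ 2).
Proof.
split=> [h|[mf hf]].
  split; last exact: Lfun2_integrable_sqr.
  by move: h; rewrite inE => /andP[]; rewrite inE.
rewrite inE; apply/andP; split; rewrite inE//=.
rewrite /finite_norm unlock poweR_lty//.
move/integrable_lty : hf => /(_ measurableT); apply: le_lt_trans.
rewrite le_eqVlt; apply/orP; left; apply/eqP; apply: eq_integral => x _ /=.
by rewrite powR_mulrn// -normrX ger0_norm ?sqr_ge0.
Qed.

Lemma L2_meas f : f \in Lfun mu 2%:E -> measurable_fun setT f.
Proof. by move=> /L2P[]. Qed.

Lemma L2_sqr f : f \in Lfun mu 2%:E -> L1 (fun x => f x ^+ 2).
Proof. by move=> /L2P[]. Qed.

Lemma L2D f g : f \in Lfun mu 2%:E -> g \in Lfun mu 2%:E ->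
  (fun x => f x + g x) \in Lfun mu 2%:E.
Proof. by move=> ? ?; apply: (@Lfun_addr_closed _ _ _ mu 2%:E _).2 => //; rewrite lee1n. Qed.

Lemma L2Z (c : R) f : f \in Lfun mu 2%:E -> (fun x => c * f x) \in Lfun mu 2%:E.
Proof.
move=> /L2P[mf hf]; apply/L2P; split; first exact: measurable_funM.
by under eq_fun do rewrite exprMn; exact: L1Z.
Qed.

Lemma L2N f : f \in Lfun mu 2%:E -> (fun x => - f x) \in Lfun mu 2%:E.
Proof.
move=> /L2P[mf hf]; apply/L2P; split; first exact: measurableT_comp.
by under eq_fun do rewrite sqrrN.
Qed.

Lemma L2B f g : f \in Lfun mu 2%:E -> g \in Lfun mu 2%:E ->
  (fun x => f x - g x) \in Lfun mu 2%:E.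
Proof. by move=> ? ?; apply: L2D => //; exact: L2N. Qed.

Lemma L2_bnd f (c : R) : measurable_fun setT f -> (forall x, `|f x| <= c) ->
  f \in Lfun mu 2%:E.
Proof.
move=> mf h; apply/L2P; split=> //; apply: (@L1_bnd _ (c ^+ 2)).
  exact: measurable_funX.
move=> x; rewrite normrX lerXn2r ?nnegrE//.
exact: le_trans (h x).
Qed.

Lemma L2_cst (c : R) : (fun _ => c) \in Lfun mu 2%:E.
Proof. exact: (@L2_bnd _ `|c|). Qed.

Lemma L2_bndM f g (c : R) : measurable_fun setT f -> (forall x, `|f x| <= c) ->
  g \in Lfun mu 2%:E -> (fun x => f x * g x) \in Lfun mu 2%:E.
Proof.
move=> mf fc /L2P[mg ig]; apply/L2P; split; first exact: measurable_funM.
under eq_fun do rewrite exprMn.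
apply: (@L1_bndM _ _ (c ^+ 2)) => //; first exact: measurable_funX.
move=> x; rewrite normrX lerXn2r ?nnegrE//.
exact: le_trans (fc x).
Qed.

Lemma L2M_L1 f g : f \in Lfun mu 2%:E -> g \in Lfun mu 2%:E ->
  L1 (fun x => f x * g x).
Proof. by move=> lf lg; exact/Lfun1_integrable/Lfun2_mul_Lfun1. Qed.

Lemma L2_L1 f : f \in Lfun mu 2%:E -> L1 f.
Proof.
move=> lf; have := L2M_L1 lf (L2_cst 1).
by under eq_fun do rewrite mulr1.
Qed.

Lemma ae_eq_L2 f g : measurable_fun setT g ->
  (\forall x \ae mu, f x = g x) -> f \in Lfun mu 2%:E -> g \in Lfun mu 2%:E.
Proof.
move=> mg fg /L2P[mf lf]; apply/L2P; split=> //; apply: ae_eq_L1 lf.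
  exact: measurable_funX.
by apply: filterS fg => x ->.
Qed.

(** The free weight [c] takes the place of the square roots of Cauchy-Schwarz: a convergence proof
    chooses it small against the integral of one square and then makes the other one small. The
    bound comes from expanding [c * (a - c^-1 * b) ^+ 2 >= 0]. *)
Lemma Int_Young f g (c : R) : 0 < c -> f \in Lfun mu 2%:E ->
  g \in Lfun mu 2%:E ->
  `|\int[mu]_x (f x * g x)| <=
  c * \int[mu]_x (f x ^+ 2) + c^-1 * \int[mu]_x (g x ^+ 2).
Proof.
move=> c0 lf lg; have lfg := L2M_L1 lf lg.
apply: (le_trans (le_normr_Rintegral measurableT lfg)).
rewrite -!IntZ ?L2_sqr// -IntD; last 2 first.
- exact/L1Z/L2_sqr.
- exact/L1Z/L2_sqr.
apply: le_Int.
- exact: integrable_norm.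
- by apply: L1D; apply/L1Z/L2_sqr.
apply: aeW => x; rewrite normrM.
have h (a b : R) : 0 <= a -> 0 <= b -> a * b <= c * a ^+ 2 + c^-1 * b ^+ 2.
  move=> a0 b0; have c1 : 0 <= c^-1 by rewrite invr_ge0 ltW.
  have : 0 <= c * (a - c^-1 * b) ^+ 2 by rewrite mulr_ge0 ?sqr_ge0// ltW.
  rewrite sqrrB mulrDr mulrBr exprMn expr2 [c^-1 ^+ 2]expr2.
  rewrite -[c^-1 * c^-1 * _]mulrA [c * (c^-1 * _)]mulrA divff ?gt_eqF// mul1r.
  rewrite -mulr_natr.
  rewrite (_ : c * (a * (c^-1 * b) * 2) = 2 * (c / c) * (a * b)); last by ring.
  rewrite divff ?gt_eqF// mulr1.
  have := mulr_ge0 a0 b0; nra.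
have := h _ _ (normr_ge0 (f x)) (normr_ge0 (g x)).
by rewrite !real_normK ?num_real.
Qed.

Lemma DCT (f_ : nat -> T -> R) f g :
  (forall n, measurable_fun setT (f_ n)) -> measurable_fun setT f ->
  (\forall x \ae mu, f_ ^~ x @ \oo --> f x) -> L1 g ->
  (\forall x \ae mu, forall n, `|f_ n x| <= g x) ->
  L1 f /\ \int[mu]_x (f_ n x) @[n --> \oo] --> \int[mu]_x f x.
Proof.
move=> mf_ mf cf lg fg.
have [] := @dominated_convergence _ _ _ mu setT measurableT
  (fun n => EFin \o f_ n) (EFin \o f) (EFin \o g).
- by move=> n; exact/measurable_EFinP.
- exact/measurable_EFinP.
- by apply: filterS cf => x cx _; exact/cvg_EFin/cx/nearW.
- by [].
- by apply: filterS fg => x h n _ /=; rewrite lee_fin.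
move=> lf _ h; split=> //; apply: fine_cvg => /=.
by rewrite fineK//; exact: integrable_fin_num.
Qed.

End integrals.

(* Z is a pointwise limit of countably-valued measurable maps with values in D.
   This gives measurability of f o Z for f continuous on D without comparing the
   Borel and the product sigma-algebras. *)
Definition stepapprox d (T : measurableType d) (W : topologicalType)
    (D : set W) (Z : T -> W) :=
  exists (c : nat -> nat -> W) (k : nat -> T -> nat),
  [/\ forall n j, measurable (k n @^-1` [set j]),
      forall n t, D (c n (k n t)) &
      forall t, c n (k n t) @[n --> \oo] --> Z t].

(** * Measurability of compositions with functions continuous on a set *)

Section stepapprox.
Context d (T : measurableType d) (R : realType).

Lemma stepapprox_sub (W : topologicalType) (D D' : set W) (Z : T -> W) :
  D `<=` D' -> stepapprox D Z -> stepapprox D' Z.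
Proof.
by move=> DD' [c [k [mk Dk ck]]]; exists c, k; split=> // n t; exact/DD'/Dk.
Qed.

(** Each approximant has countably many values, so preimages under it are countable unions of
    fibres. The approximants stay in [D], which is what lets continuity within [D] give pointwise
    convergence. *)
Lemma measurable_stepapprox (W : topologicalType) (D : set W) (Z : T -> W)
    (f : W -> R) : {within D, continuous f} -> (forall t, D (Z t)) ->
  stepapprox D Z -> measurable_fun setT (fun t => f (Z t)).
Proof.
move=> cf DZ [c [k [mk Dk ck]]].
apply: (@measurable_fun_cvg _ _ _ _ (fun n t => f (c n (k n t)))).
  move=> n _ B mB; rewrite setTI.
  rewrite (_ : _ @^-1` B =
    \bigcup_(j in [set j | B (f (c n j))]) (k n @^-1` [set j])).
    by apply: bigcup_measurable => j _; exact: mk.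
  apply/seteqP; split=> [t /= Bt|t /= [j /= Bj] ktj]; first by exists (k n t).
  by rewrite ktj.
move=> t _; move/subspace_continuousP : cf => /(_ _ (DZ t)).
apply: cvg_comp => A DA; have [N _ hN] := ck t _ DA.
by exists N => // n Nn; exact: (hN n Nn (Dk n t)).
Qed.

(** Lets the steps be indexed by any countable type through its codes: the fibre over a number that
    codes nothing is empty. *)
Lemma measurable_unpickle (K : countType) (Y : T -> K) :
  (forall x, measurable (Y @^-1` [set x])) ->
  forall j, measurable ((fun t => pickle (Y t)) @^-1` [set j]).
Proof.
move=> mY j; have [[x xj]|h] := pselect (exists x : K, pickle x = j).
  rewrite (_ : _ @^-1` _ = Y @^-1` [set x]); first exact: mY.
  apply/seteqP; split=> t /=; last by move=> ->.
  by rewrite -xj => /(pcan_inj pickleK).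
rewrite (_ : _ @^-1` _ = set0)//.
by apply/seteqP; split=> // t /= tj; apply: h; exists (Y t).
Qed.

Lemma stepapprox_pair (W1 W2 : topologicalType) (D1 : set W1) (D2 : set W2)
    (Z1 : T -> W1) (Z2 : T -> W2) :
  stepapprox D1 Z1 -> stepapprox D2 Z2 ->
  stepapprox (D1 `*` D2) (fun t => (Z1 t, Z2 t)).
Proof.
move=> [c1 [k1 [mk1 Dk1 ck1]]] [c2 [k2 [mk2 Dk2 ck2]]].
exists (fun n j => let p := odflt (0, 0)%N (unpickle j) in (c1 n p.1, c2 n p.2)).
exists (fun n t => pickle (k1 n t, k2 n t)); split.
- move=> n; apply: measurable_unpickle => -[j1 j2].
  rewrite (_ : _ @^-1` _ = k1 n @^-1` [set j1] `&` k2 n @^-1` [set j2]).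
    exact: measurableI.
  by apply/seteqP; split=> t /=; [case=> -> ->|case=> -> ->].
- by move=> n t /=; rewrite pickleK/=; split.
- move=> t; under eq_fun do rewrite pickleK/=.
  exact: cvg_pair (ck1 t) (ck2 t).
Qed.

(** Rounding up: the values (floor (Z (n + 1)) + 1) / (n + 1) lie strictly above [Z], hence in [D].
    For positive [Z] this treats both choices of [E] at once. *)
Lemma stepapprox_gt (D : set R) (Z : T -> R) : measurable_fun setT Z ->
  (forall t s, Z t < s -> D s) -> stepapprox D Z.
Proof.
move=> mZ ZD.
exists (fun n j => ((odflt 0 (unpickle j))%:~R + 1) / n.+1%:R).
exists (fun n t => pickle (Num.floor (Z t * n.+1%:R))); split.
- move=> n; apply: measurable_unpickle => i.
  rewrite (_ : _ @^-1` _ = (fun t => Z t * n.+1%:R) @^-1` `[i%:~R, (i + 1)%:~R[%classic).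
    rewrite -[X in measurable X]setTI.
    by apply: (measurable_funM mZ (measurable_cst _)).
  by apply/seteqP; split=> t /=; rewrite in_itv/= -floor_eq => /eqP.
- move=> n t /=; apply: (ZD t); rewrite pickleK/= ltr_pdivlMr ?ltr0n//.
  have := floor_itv (Z t * n.+1%:R).
  by rewrite intrD => /andP[].
- move=> t; under eq_fun do rewrite pickleK/=.
  apply: (squeeze_cvgr (f := fun=> Z t) (h := fun n => Z t + n.+1%:R^-1)).
  + apply: nearW => n; rewrite ler_pdivlMr ?ltr0n// ler_pdivrMr ?ltr0n//.
    rewrite mulrDl mulVf ?pnatr_eq0//.
    have := floor_itv (Z t * n.+1%:R).
    by rewrite intrD => /andP[h1 /ltW h2]; rewrite h2 lerD2r.
  + exact: cvg_cst.
  + rewrite -[X in _ --> X]addr0; apply: cvgD; first exact: cvg_cst.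
    exact: cvg_harmonic.
Qed.

Lemma stepapprox_real (Z : T -> R) : measurable_fun setT Z -> stepapprox setT Z.
Proof. by move=> mZ; exact: stepapprox_gt. Qed.

Lemma stepapprox_row m (Z : T -> 'rV[R]_m) :
  (forall i, stepapprox setT (fun t => Z t ord0 i)) -> stepapprox setT Z.
Proof.
move=> /choice[c] /choice[k ck].
exists (fun n j => let p := odflt [ffun _ : 'I_m => 0%N] (unpickle j) in
  \row_i c i n (p i)).
exists (fun n t => pickle [ffun i => k i n t]); split=> //.
- move=> n; apply: measurable_unpickle => g.
  rewrite (_ : _ @^-1` _ = \bigcap_(i : 'I_m) (k i n @^-1` [set g i])).
    apply: fin_bigcap_measurable => // i _.
    by have [mk _ _] := ck i; exact: mk.
  apply/seteqP; split=> t /=; first by move=> <- i _ /=; rewrite ffunE.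
  by move=> h; apply/ffunP => i; rewrite ffunE; exact: h.
- move=> t; under eq_fun do rewrite pickleK/=.
  apply/cvgrPdist_lt => e e0.
  have : \forall n \near \oo, forall i, `|Z t ord0 i - c i n (k i n t)| < e.
    apply: filter_forall => i; have [_ _ /(_ t)] := ck i.
    by move/cvgrPdist_lt; exact.
  apply: filterS => n h; rewrite /Num.norm/= mx_normrE.
  apply: bigmax_lt => //= -[i j] _ /=; rewrite (ord1 i) !mxE ffunE; exact: h.
Qed.
End stepapprox.

(** The sigma-algebra of ['rV[R]_m] is generated by the coordinates, so open sets are not measurable
    by definition; the identity is approximated coordinatewise instead. *)
Lemma measurable_continuous_rV (R : realType) m (f : 'rV[R]_m -> R) :
  continuous f -> measurable_fun setT f.
Proof.
move=> cf; apply: (@measurable_stepapprox _ 'rV[R]_m _ 'rV[R]_m setT (fun x => x) f) => //.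
  exact: continuous_subspaceT.
apply: stepapprox_row => i; apply: stepapprox_real.
exact: measurable_rV_coord.
Qed.

(** * Trigonometric polynomials on the torus *)

Section cas.
Context {R : realType}.
Implicit Types t a b : R.

(* cas = cos + sin gives a real orthonormal basis x |-> cas (2 pi k.x), k in Z^d. *)
Definition cas t : R := sin t + cos t.

Lemma cas_sin t : cas t = sin t + sin (t + pi / 2).
Proof. by rewrite sinDpihalf. Qed.

(** By [is_derive_cas] the left side is the derivative of [cas]: differentiating a wave reverses its
    frequency. *)
Lemma casDpihalf t : cas (t + pi / 2) = cas (- t).
Proof. by rewrite /cas sinDpihalf cosDpihalf sinN cosN addrC. Qed.

(** The product is cos (a - b) + sin (a + b), rewritten through [cas]. Orthonormality of the waves
    and stability of trigonometric polynomials under products both rest on it. *)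
Lemma cas_mul a b : cas a * cas b =
  2^-1 * (cas (a - b) + cas (b - a)) + 2^-1 * (cas (a + b) - cas (- (a + b))).
Proof.
have -> : b - a = - (a - b) by rewrite opprB.
rewrite /cas !sinN !cosN sinB cosB sinD cosD; by field.
Qed.

Lemma cos_cas a : cos a = 2^-1 * (cas a + cas (- a)).
Proof. by rewrite /cas sinN cosN; field. Qed.

Lemma sin_cas a : sin a = 2^-1 * (cas a - cas (- a)).
Proof. by rewrite /cas sinN cosN; field. Qed.

Lemma cas_le2 t : `|cas t| <= 2.
Proof.
have := (sin_le1 t, sin_geN1 t, cos_le1 t, cos_geN1 t).
by move=> [[[? ?] ?] ?]; rewrite /cas ler_norml; apply/andP; split; lra.
Qed.

Lemma casDz t (z : int) : cas (t + pi * 2 * z%:~R) = cas t.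
Proof.
have h n s : cas (s + pi * 2 * n%:R) = cas s.
  rewrite (_ : pi * 2 * n%:R = (pi *+ 2) *+ n :> R); last first.
    by rewrite -(mulr_natr (pi *+ 2)) -(mulr_natr pi).
  rewrite /cas; congr (_ + _).
    exact: (periodicn (@sinD2pi R)).
  exact: (periodicn (@cosD2pi R)).
case: z => n; first exact: h.
by rewrite NegzE rmorphN/= mulrN -{2}(subrK (pi * 2 * n.+1%:R) t) h.
Qed.

Lemma is_derive_cas t : is_derive t 1 cas (cas (t + pi / 2)).
Proof.
rewrite /cas sinDpihalf cosDpihalf.
by apply: is_deriveD.
Qed.

Lemma continuous_cas : continuous cas.
Proof.
move=> t; apply: cvgD; [exact: continuous_sin|exact: continuous_cos].
Qed.

Lemma cas_slope a b :
  t^-1 * (cas (a + t * b) - cas a) @[t --> 0^'] --> b * cas (a + pi / 2).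
Proof.
have h : is_derive (0 : R) 1 (fun t => cas (a + t * b)) (b * cas (a + pi / 2)).
  have -> : (fun t => cas (a + t * b)) = cas \o (fun t => a + t * b) by [].
  rewrite -[X in cas (X + _)]addr0 -[in X in cas (_ + X + _)](mul0r b).
  rewrite [b * _]mulrC.
  apply: is_derive1_comp; first exact: is_derive_cas.
  have : is_derive (0 : R) 1 (cst a + (b \*: (@idfun R))) (0 + b *: 1).
    by apply: is_deriveD.
  rewrite add0r /GRing.scale/= mulr1.
  by congr is_derive; apply/funext => x; rewrite /= !fctE mulrC.
case: h => h1 h2; rewrite -h2; move: h1; rewrite /derivable /derive.
have -> // : (fun h : R => h^-1 *: ((((fun t0 => cas (a + t0 * b)) \o shift 0) (h *: 1))
    - cas (a + 0 * b))) = (fun t0 => t0^-1 * (cas (a + t0 * b) - cas a)).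
by apply/funext => h; rewrite /= addr0 mul0r addr0 /GRing.scale/= mulr1.
Qed.

Lemma Int_unif_sin a (k : int) :
  \int[uniform_prob (@ltr01 R)]_t sin (a + pi * 2 * k%:~R * t) =
  (k == 0)%:R * sin a.
Proof.
have [->|k0] := eqVneq k 0.
  rewrite mul1r; under eq_Rintegral do rewrite mulr0 mul0r addr0.
  by rewrite Int_cst.
rewrite mul0r.
set b := pi * 2 * k%:~R.
have b0 : b != 0.
  by rewrite !mulf_neq0// ?intr_eq0// gt_eqF// ?pi_gt0// ltr0n.
have cs : continuous (fun t => sin (a + b * t)).
  move=> t; apply: continuous_comp; last exact: continuous_sin.
  apply: cvgD; first exact: cvg_cst.
  by apply: cvgM; [exact: cvg_cst|exact: cvg_id].
have ms : measurable_fun setT (fun t => sin (a + b * t)).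
  exact: continuous_measurable_fun.
have is1 : (uniform_prob (@ltr01 R)).-integrable setT
    (EFin \o (fun t => sin (a + b * t))).
  by apply: (@L1_bnd _ _ _ _ _ 1) => // t; rewrite ler_norml sin_geN1 sin_le1.
have := @IntD _ _ _ (uniform_prob (@ltr01 R)) _ _ (L1_cst _ 1) is1.
rewrite Int_cst => H.
(* Adding 1 makes the integrand nonnegative, as the formula for integrals against the uniform law
   requires. *)
suff : \int[uniform_prob (@ltr01 R)]_x (1 + sin (a + b * x)) = 1 by lra.
rewrite /Rintegral integral_uniform; last 2 first.
- by apply/measurable_EFinP; exact: measurable_funD.
- by move=> x; rewrite lee_fin; have := sin_geN1 (a + b * x); lra.
pose F t : R := t - b^-1 * cos (a + b * t).
have dF (t : R) : is_derive t 1 F (1 + sin (a + b * t)).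
  have h : is_derive t 1 (cos \o (fun t => a + b * t)) (- sin (a + b * t) * b).
    apply: is_derive1_comp.
    have : is_derive t 1 (cst a + (b \*: (@idfun R))) (0 + b *: 1).
      by apply: is_deriveD.
    rewrite add0r /GRing.scale/= mulr1.
    by congr is_derive.
  have : is_derive t 1 ((@idfun R) - (b^-1 \*: (cos \o (fun t => a + b * t))))
     (1 - b^-1 *: (- sin (a + b * t) * b)) by apply: is_deriveB.
  rewrite [_ *: _]mulrC -mulrA divff// mulr1 opprK.
  by congr is_derive.
rewrite (@continuous_FTC2 _ _ F)//.
- rewrite subr0 invr1 mul1e /F mulr1 mulr0 addr0 -EFinB/=.
  have -> : cos (a + b) = cos a.
    by rewrite cos_cas (casDz a k) opprD -mulrN -rmorphN casDz -cos_cas.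
  by rewrite sub0r opprK subrK.
- apply: continuous_subspaceT => t; apply: cvgD; [exact: cvg_cst|exact: cs].
- split.
  + by move=> x _; case: (dF x).
  + apply: cvg_at_right_filter; apply: differentiable_continuous.
    by apply/derivable1_diffP; case: (dF 0).
  + apply: cvg_at_left_filter; apply: differentiable_continuous.
    by apply/derivable1_diffP; case: (dF 1).
- by move=> x _; rewrite derive1E; case: (dF x).
Qed.

End cas.

Lemma cvg_sumr (R : realType) T (F : set_system T) (FF : Filter F) I (s : seq I)
    (P : pred I) (f : I -> T -> R) (l : I -> R) :
  (forall i, f i x @[x --> F] --> l i) ->
  \sum_(i <- s | P i) f i x @[x --> F] --> \sum_(i <- s | P i) l i.
Proof.
move=> fl; elim: s => [|i s IH].
  by rewrite big_nil; under eq_fun do rewrite big_nil; exact: cvg_cst.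
rewrite big_cons; under eq_fun do rewrite big_cons.
by case: (P i) => //; apply: cvgD.
Qed.

Section continuous_ring.
Context {R : realType} {W : topologicalType}.
Implicit Types f g : W -> R.

Lemma cont_cst (c : R) : continuous (fun _ : W => c).
Proof. exact: cst_continuous. Qed.

Lemma contD f g : continuous f -> continuous g ->
  continuous (fun x => f x + g x).
Proof. by move=> cf cg x; apply: cvgD; [exact: cf|exact: cg]. Qed.

Lemma contM f g : continuous f -> continuous g ->
  continuous (fun x => f x * g x).
Proof. by move=> cf cg x; apply: cvgM; [exact: cf|exact: cg]. Qed.

Lemma cont_sum I (s : seq I) (P : pred I) (F : I -> W -> R) :
  (forall i, continuous (F i)) ->
  continuous (fun x => \sum_(i <- s | P i) F i x).
Proof. by move=> cF x; apply: cvg_sumr => i; exact: cF. Qed.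

Lemma cont_comp f (g : R -> R) : continuous f -> continuous g ->
  continuous (fun x => g (f x)).
Proof.
by move=> cf cg x; apply: (@continuous_comp _ _ _ f g); [exact: cf|exact: cg].
Qed.

End continuous_ring.

(** * Real Fourier waves on the torus *)

Section phase.
Context {R : realType} {d : nat}.
Local Notation V := 'rV[R]_d.
Local Notation Z := 'rV[int]_d.
Local Notation mu := (@leb R d).
Implicit Types (k l : Z) (x y v : V).

Definition phase k x : R := \sum_i pi * 2 * (k ord0 i)%:~R * x ord0 i.

Lemma phaseD k x y : phase k (x + y) = phase k x + phase k y.
Proof.
by rewrite /phase -big_split; apply: eq_bigr => i _; rewrite mxE mulrDr.
Qed.

Lemma phaseZ k (t : R) x : phase k (t *: x) = t * phase k x.
Proof.
by rewrite /phase mulr_sumr; apply: eq_bigr => i _; rewrite mxE mulrCA.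
Qed.

Lemma phase_addk k l x : phase (k + l) x = phase k x + phase l x.
Proof.
rewrite /phase -big_split; apply: eq_bigr => i _.
by rewrite mxE rmorphD/= mulrDr mulrDl.
Qed.

Lemma phase_oppk k x : phase (- k) x = - phase k x.
Proof.
rewrite /phase -sumrN; apply: eq_bigr => i _.
by rewrite mxE rmorphN/= mulrN mulNr.
Qed.

Lemma phase_int k (n : Z) : exists z : int,
  phase k (map_mx intr n) = pi * 2 * z%:~R.
Proof.
exists (\sum_i k ord0 i * n ord0 i); rewrite /phase rmorph_sum mulr_sumr.
by apply: eq_bigr => i _; rewrite mxE rmorphM/= mulrA.
Qed.

Lemma phase_ebase k i : phase k (ebase i) = pi * 2 * (k ord0 i)%:~R.
Proof.
rewrite /phase (bigD1 i)//= mxE !eqxx mulr1 big1 ?addr0// => j ji.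
by rewrite mxE eqxx (negbTE ji) mulr0.
Qed.

Lemma continuous_phase k : continuous (phase k).
Proof.
apply: cont_sum => i; apply: contM; first exact: cont_cst.
exact: coord_continuous.
Qed.

Definition wave k x : R := cas (phase k x).

Lemma wave0 x : wave 0 x = 1.
Proof.
rewrite /wave (_ : phase 0 x = 0) /cas ?sin0 ?cos0 ?add0r//.
by rewrite /phase big1// => i _; rewrite mxE mulr0 mul0r.
Qed.

Lemma wave_le2 k x : `|wave k x| <= 2. Proof. exact: cas_le2. Qed.

Lemma continuous_wave k : continuous (wave k).
Proof.
exact: cont_comp (@continuous_phase k) (@continuous_cas R).
Qed.

Lemma measurable_wave k : measurable_fun setT (wave k).
Proof. exact: measurable_continuous_rV (@continuous_wave k). Qed.

Lemma wave_mul k l x : wave k x * wave l x =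
  2^-1 * (wave (k - l) x + wave (l - k) x) +
  2^-1 * (wave (k + l) x - wave (- (k + l)) x).
Proof. by rewrite /wave cas_mul !phase_oppk !phase_addk !phase_oppk. Qed.

Lemma wave_slope k x v b :
  t^-1 * (cas (phase k (x + t *: v) + b) - cas (phase k x + b)) @[t --> 0^'] -->
  phase k v * cas (phase k x + b + pi / 2).
Proof.
have := @cas_slope R (phase k x + b) (phase k v).
apply: cvg_trans; apply: near_eq_cvg; apply: nearW => t.
by rewrite phaseD phaseZ (addrAC (phase k x) b).
Qed.

Lemma periodic_wave k : Defs.periodic (wave k).
Proof.
move=> x n; rewrite /wave phaseD.
by have [z ->] := phase_int k n; rewrite casDz.
Qed.

Lemma smooth_wave k : smooth (wave k).
Proof.
split; first exact: periodic_wave.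
(* Each directional derivative multiplies by [phase k v] and advances the argument by a quarter
   period. *)
exists (fun s x => (\prod_(v <- s) phase k v) *
  cas (phase k x + (size s)%:R * (pi / 2))); split=> [x _|s].
  by rewrite big_nil mul1r mul0r addr0.
split.
  apply: continuous_subspaceT; apply: contM; first exact: cont_cst.
  apply: cont_comp; last exact: continuous_cas.
  by apply: contD; [exact: continuous_phase|exact: cont_cst].
move=> v x _.
rewrite big_cons -[X in _ --> X]mulrA [X in _ --> X]mulrCA.
have -> : phase k x + (size (v :: s))%:R * (pi / 2) =
    phase k x + (size s)%:R * (pi / 2) + pi / 2.
  by rewrite /= mulrSr mulrDl mul1r addrA.
have h : (\prod_(j <- s) phase k j) *
    (t^-1 * (cas (phase k (x + t *: v) + (size s)%:R * (pi / 2)) -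
      cas (phase k x + (size s)%:R * (pi / 2)))) @[t --> 0^'] -->
    (\prod_(j <- s) phase k j) *
    (phase k v * cas (phase k x + (size s)%:R * (pi / 2) + pi / 2)).
  by apply: cvgM; [exact: cvg_cst|exact: wave_slope].
apply: cvg_within_filter; apply: cvg_trans h; apply: near_eq_cvg.
by apply: nearW => t; rewrite -mulrBr mulrCA.
Qed.

Lemma partial_slope i (f : V -> R) x (l : R) :
  t^-1 * (f (x + t *: ebase i) - f x) @[t --> 0^'] --> l -> partial i f x = l.
Proof.
move=> h; apply: cvg_lim => //; apply: cvg_trans h; apply: near_eq_cvg.
by apply: nearW => t; rewrite /= [X in f X]addrC.
Qed.

Lemma partial_wave i k : partial i (wave k) =
  (fun x => pi * 2 * (k ord0 i)%:~R * wave (- k) x).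
Proof.
apply/funext => x; apply: partial_slope.
have := @wave_slope k x (ebase i) 0; rewrite phase_ebase addr0.
rewrite casDpihalf -phase_oppk; apply: cvg_trans; apply: near_eq_cvg.
by apply: nearW => t; rewrite /= addr0.
Qed.

End phase.

Lemma phase_rV_cons {R : realType} d (k : 'rV[int]_d.+1) (tx : R * 'rV[R]_d) :
  phase k (rV_cons tx) = pi * 2 * (k ord0 ord0)%:~R * tx.1 +
    phase (\row_i k ord0 (lift ord0 i)) tx.2.
Proof.
rewrite /phase big_ord_recl mxE unlift_none/=; congr (_ + _).
by apply: eq_bigr => i _; rewrite !mxE liftK.
Qed.

(** The shift [a] covers sine and cosine at once. Induction on the dimension and Fubini: while the
    first coordinate is integrated, the phase of the others is merely part of the shift in
    [Int_unif_sin]. *)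
Lemma Int_sin_phase {R : realType} d (k : 'rV[int]_d) (a : R) :
  \int[leb d]_x sin (a + phase k x) = (k == 0)%:R * sin a.
Proof.
have msin n (l : 'rV[int]_n) (b : R) :
    measurable_fun setT (fun x : 'rV[R]_n => sin (b + phase l x)).
  apply: measurable_continuous_rV; apply: cont_comp; last exact: continuous_sin.
  by apply: contD; [exact: cont_cst|exact: continuous_phase].
have bsin (t : R) : `|sin t| <= 1 by rewrite ler_norml sin_geN1 sin_le1.
elim: d k a => [|d IH] k a.
  have -> : k = 0 by apply/rowP => -[].
  rewrite eqxx mul1r; under eq_Rintegral do rewrite /phase big_ord0 addr0.
  by rewrite Int_cst.
pose k' : 'rV[int]_d := \row_i k ord0 (lift ord0 i).
have -> : (k == 0) = (k ord0 ord0 == 0) && (k' == 0).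
  apply/eqP/andP => [k0|[/eqP k0 /eqP k1]].
    split; first by rewrite k0 mxE.
    by apply/eqP/rowP => i; rewrite !mxE k0 mxE.
  apply/rowP => i; rewrite mxE; case: (unliftP ord0 i) => [j ->|-> //].
  by move/rowP: k1 => /(_ j); rewrite !mxE.
rewrite /Rintegral /=.
pose G (tx : measurableTypeR R * 'rV[R]_d) := sin (a + phase k (rV_cons tx)).
have mG : measurable_fun setT G.
  exact: (measurableT_comp (msin _ k a) (@measurable_rV_cons R d)).
have iG : (uniform_prob (@ltr01 R) \x leb d)%E.-integrable setT (EFin \o G).
  by apply: (@L1_bnd _ _ _ _ _ 1) => // t; exact: bsin.
have mk : measurable_fun setT
    (fun y : 'rV[R]_d.+1 => (sin (a + phase k y))%:E).
  by apply/measurable_EFinP; exact: msin.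
have := @integral_pushforward _ _ _ _ R (@rV_cons R d) (@measurable_rV_cons R d)
  (uniform_prob (@ltr01 R) \x leb d)%E setT _ mk.
rewrite preimage_setT => /(_ iG measurableT) E; rewrite [X in fine X]E {E}.
transitivity
  (fine (\int[(uniform_prob (@ltr01 R) \x leb d)%E]_z (EFin (G z)))%E) => //.
rewrite -(integral21_prod_meas1 iG) /fubini_G /=.
have inner (y : 'rV[R]_d) :
    (\int[uniform_prob (@ltr01 R)]_x (G (x, y))%:E =
     ((k ord0 ord0 == 0)%:R * sin (a + phase k' y))%:E)%E.
  rewrite -Int_unif_sin EInt.
    congr (_%:E); apply: eq_Rintegral => t _.
    by rewrite /G phase_rV_cons/= addrCA addrC (addrC (a + _)) addrA.
  apply: (@L1_bnd _ _ _ _ _ 1); first exact: measurable_fun_pair1.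
  by move=> t; exact: bsin.
under eq_integral do rewrite inner.
rewrite -/(Rintegral _ _ _) IntZ; last first.
  by apply: (@L1_bnd _ _ _ _ _ 1); [exact: msin|move=> t; exact: bsin].
by rewrite IH mulrA -natrM mulnb.
Qed.

(** * Polynomial approximation of a step *)

Section step.
Context {R : realType}.
Implicit Types y r : R.

Lemma bernoulli_ineq r n : -1 <= r -> 1 + n%:R * r <= (1 + r) ^+ n.
Proof.
move=> r1; elim: n => [|n IH]; first by rewrite mul0r addr0 expr0.
have r0 : 0 <= 1 + r by lra.
rewrite exprS; apply: (le_trans _ (ler_wpM2l r0 IH)).
rewrite -natr1; have : 0 <= n%:R * r ^+ 2 by rewrite mulr_ge0// sqr_ge0.
nra.
Qed.

(** Write r^n = s^n s^n with s the square root of r: Bernoulli's inequality for 1/s bounds n s^n,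
    and the other factor tends to 0. *)
Lemma cvg_natM_expr r : 0 <= r < 1 -> n%:R * r ^+ n @[n --> \oo] --> (0 : R).
Proof.
move=> /andP[r0 r1]; have [->|rN0] := eqVneq r 0.
  apply: cvg_near_cst; apply: nearW => -[|n]; first by rewrite mul0r.
  by rewrite expr0n mulr0.
pose s := Num.sqrt r.
have s0 : 0 < s by rewrite sqrtr_gt0 lt_neqAle eq_sym rN0.
have s1 : s < 1 by rewrite -sqrtr1 ltr_sqrt.
have rs n : r ^+ n = s ^+ n * s ^+ n.
  by rewrite -expr2 -exprM mulnC exprM sqr_sqrtr.
pose h := s^-1 - 1.
have h0 : 0 < h by rewrite subr_gt0 invf_gt1.
have key n : n%:R * s ^+ n <= h^-1.
  have sn0 : 0 < s ^+ n by rewrite exprn_gt0.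
  have e : 1 + h = s^-1 by rewrite /h; ring.
  have H : n%:R * h <= (s ^+ n)^-1.
    rewrite -exprVn -e; apply: le_trans (bernoulli_ineq _ _); first by rewrite lerDr.
    by lra.
  rewrite -[h^-1]mul1r ler_pdivlMr// mulrAC -ler_pdivlMr//.
  by rewrite mul1r.
apply: (squeeze_cvgr (f := fun=> 0) (h := fun n => h^-1 * s ^+ n)).
- apply: nearW => n; rewrite mulr_ge0 ?ler0n ?exprn_ge0//=.
  by rewrite rs mulrA ler_wpM2r// ltW// exprn_gt0.
- exact: cvg_cst.
- rewrite -[X in _ --> X](mulr0 h^-1); apply: cvgM; first exact: cvg_cst.
  by apply: cvg_expr; rewrite ger0_norm// ltW.
Qed.

(* Converges to the indicator of y < 1/2 on [0, 1]; this is the polynomial step of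
   Brosowski and Deutsch's proof of the Stone-Weierstrass theorem. *)
Definition qstep n y := (1 - y ^+ n) ^+ (n * 2 ^ n).

Lemma qstep01 n y : 0 <= y <= 1 -> 0 <= qstep n y <= 1.
Proof.
move=> /andP[y0 y1]; have h1 := exprn_ile1 n y0 y1; have h0 := exprn_ge0 n y0.
by rewrite /qstep exprn_ge0 ?exprn_ile1//; lra.
Qed.

(** The exponent n 2^n in [qstep] turns y^n into n (2 y)^n under Bernoulli's inequality; this tends
    to 0 for y < 1/2 and is at least n otherwise. *)
Lemma cvg_qstep y : 0 <= y <= 1 -> qstep n y @[n --> \oo] --> ((y < 2^-1)%R%:R : R).
Proof.
move=> y01; have /andP[y0 y1] := y01.
have [yh|yh] := ltP y 2^-1.
  apply: (squeeze_cvgr (f := fun n => 1 - n%:R * (2 * y) ^+ n) (h := fun=> 1)).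
  - apply: nearW => n; have /andP[_ ->] := qstep01 n y01; rewrite andbT.
    have h1 := exprn_ile1 n y0 y1.
    have := @bernoulli_ineq (- y ^+ n) (n * 2 ^ n).
    rewrite natrM natrX exprMn mulrA mulrN; apply; lra.
  - rewrite -[X in _ --> X]subr0; apply: cvgB; first exact: cvg_cst.
    by apply: cvg_natM_expr; apply/andP; split; lra.
  - exact: cvg_cst.
apply: (squeeze_cvgr (f := fun=> 0) (h := fun n => n.+1%:R^-1)).
- apply: nearW => n; have /andP[-> _] := qstep01 n y01; rewrite /=.
  have h1 := exprn_ile1 n y0 y1; have h0 := exprn_ge0 n y0.
  rewrite -[leRHS]mul1r ler_pdivlMr ?ltr0n//.
  (* Since (1 - y^n) (1 + y^n) <= 1, it is enough that the second factor, raised to the same power,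
     is at least n + 1. *)
  apply: (@le_trans _ _ (qstep n y * (1 + y ^+ n) ^+ (n * 2 ^ n))).
    rewrite ler_wpM2l//; first by have /andP[] := qstep01 n y01.
    apply: le_trans (bernoulli_ineq _ _); last lra.
    rewrite natrM natrX -mulrA -exprMn -natr1 addrC lerD2l ler_peMr//.
    by rewrite exprn_ege1//; lra.
  rewrite /qstep -exprMn exprn_ile1//.
    by rewrite mulr_ge0//; lra.
  nra.
- exact: cvg_cst.
- exact: cvg_harmonic.
Qed.

End step.

(** * The algebra of trigonometric polynomials *)

Section trigpoly.
Context {R : realType} {d : nat}.
Local Notation V := 'rV[R]_d.
Local Notation Z := 'rV[int]_d.
Local Notation mu := (@leb R d).

Lemma Int_wave (k : Z) : \int[mu]_x wave k x = (k == 0)%:R.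
Proof.
have si a : mu.-integrable setT (EFin \o (fun x => sin (a + phase k x))).
  apply: (@L1_bnd _ _ _ _ _ 1); last by move=> x; rewrite ler_norml sin_geN1 sin_le1.
  apply: measurable_continuous_rV; apply: cont_comp; last exact: continuous_sin.
  by apply: contD; [exact: cont_cst|exact: continuous_phase].
have -> : \int[mu]_x wave k x =
    \int[mu]_x (sin (0 + phase k x) + sin (pi / 2 + phase k x)).
  by apply: eq_Rintegral => x _; rewrite /wave cas_sin add0r (addrC (pi / 2)).
by rewrite IntD// !Int_sin_phase sin0 sin_pihalf mulr0 add0r mulr1.
Qed.

Lemma L1_wave (k : Z) : mu.-integrable setT (EFin \o wave k).
Proof. exact: (@L1_bnd _ _ _ _ _ 2 (measurable_wave k) (wave_le2 k)). Qed.

Lemma Int_waveM (k l : Z) : \int[mu]_x (wave k x * wave l x) = (k == l)%:R.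
Proof.
under eq_Rintegral do rewrite wave_mul.
have lw := L1_wave.
have iD a b : \int[mu]_x (wave a x + wave b x) = (a == 0)%:R + (b == 0)%:R.
  by rewrite (IntD (lw a) (lw b)) !Int_wave.
have iB a b : \int[mu]_x (wave a x - wave b x) = (a == 0)%:R - (b == 0)%:R.
  by rewrite (IntB (lw a) (lw b)) !Int_wave.
rewrite (IntD (L1Z _ (L1D (lw _) (lw _))) (L1Z _ (L1B (lw _) (lw _)))).
rewrite (IntZ _ (L1D (lw _) (lw _))) (IntZ _ (L1B (lw _) (lw _))) iD iB.
rewrite oppr_eq0 subrr mulr0 addr0 !subr_eq0 [l == k]eq_sym.
by field.
Qed.

Definition trigpoly (f : V -> R) := exists s : seq (R * Z),
  f = fun x => \sum_(c <- s) c.1 * wave c.2 x.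

Lemma trigpolyD f g : trigpoly f -> trigpoly g -> trigpoly (fun x => f x + g x).
Proof.
move=> [s ->] [t ->]; exists (s ++ t).
by apply/funext => x; rewrite big_cat.
Qed.

Lemma trigpoly_wave k : trigpoly (wave k).
Proof. by exists [:: (1, k)]; apply/funext => x; rewrite big_seq1 mul1r. Qed.

Lemma trigpolyZ (c : R) f : trigpoly f -> trigpoly (fun x => c * f x).
Proof.
move=> [s ->]; exists [seq (c * p.1, p.2) | p <- s]; apply/funext => x.
by rewrite big_map mulr_sumr; apply: eq_bigr => p _ /=; rewrite mulrA.
Qed.

Lemma trigpolyB f g : trigpoly f -> trigpoly g -> trigpoly (fun x => f x - g x).
Proof.
move=> tf tg; have := trigpolyD tf (trigpolyZ (-1) tg).
by under eq_fun do rewrite mulN1r.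
Qed.

Lemma trigpoly_cst (c : R) : trigpoly (fun _ => c).
Proof.
have := trigpolyZ c (trigpoly_wave 0).
by under eq_fun do rewrite wave0 mulr1.
Qed.

Lemma trigpoly_sum I (s : seq I) (F : I -> V -> R) : (forall i, trigpoly (F i)) ->
  trigpoly (fun x => \sum_(i <- s) F i x).
Proof.
move=> h; elim: s => [|i s IH].
  by under eq_fun do rewrite big_nil; exact: trigpoly_cst.
by under eq_fun do rewrite big_cons; exact: trigpolyD.
Qed.

Lemma trigpolyM f g : trigpoly f -> trigpoly g -> trigpoly (fun x => f x * g x).
Proof.
move=> [s ->] [t ->].
under eq_fun => x do rewrite big_distrlr /=.
apply: trigpoly_sum => p; apply: trigpoly_sum => q.
under eq_fun do rewrite mulrACA wave_mul.
by apply: trigpolyZ; apply: trigpolyD; apply: trigpolyZ;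
  [apply: trigpolyD|apply: trigpolyB]; exact: trigpoly_wave.
Qed.

Lemma trigpolyX f n : trigpoly f -> trigpoly (fun x => f x ^+ n).
Proof.
move=> tf; elim: n => [|n IH].
  by under eq_fun do rewrite expr0; exact: trigpoly_cst.
by under eq_fun do rewrite exprS; exact: trigpolyM.
Qed.

Lemma trigpoly_prod I (s : seq I) (F : I -> V -> R) : (forall i, trigpoly (F i)) ->
  trigpoly (fun x => \prod_(i <- s) F i x).
Proof.
move=> h; elim: s => [|i s IH].
  by under eq_fun do rewrite big_nil; exact: trigpoly_cst.
by under eq_fun do rewrite big_cons; exact: trigpolyM.
Qed.

Lemma trigpoly_bnd f : trigpoly f -> exists2 M : R, 0 < M & forall x, `|f x| <= M.
Proof.
move=> [s ->]; exists (1 + \sum_(c <- s) `|c.1| * 2).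
  by rewrite ltr_wpDr// sumr_ge0// => c _; rewrite mulr_ge0.
move=> x; rewrite (le_trans (ler_norm_sum _ _ _))// ler_wpDl//.
by apply: ler_sum => c _; rewrite normrM ler_wpM2l// wave_le2.
Qed.

Lemma measurable_trigpoly f : trigpoly f -> measurable_fun setT f.
Proof.
move=> [s ->]; apply: measurable_sum => c; apply: measurable_funM => //.
exact: measurable_wave.
Qed.

Lemma L2_trigpoly f : trigpoly f -> f \in Lfun mu 2%:E.
Proof.
move=> tf; have [M _ fM] := trigpoly_bnd tf.
exact: (@L2_bnd _ _ _ mu _ M (measurable_trigpoly tf) fM).
Qed.

(** [y] rescales [p] affinely into [0, 1] and sends 0 to 1/2, the threshold of [qstep]; composing
    with the polynomial [qstep] gives a trigonometric polynomial again. *)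
Lemma trigpoly_lt0 p : trigpoly p -> exists q : nat -> V -> R,
  [/\ forall n, trigpoly (q n), forall n x, 0 <= q n x <= 1 &
      forall x, q n x @[n --> \oo] --> ((p x < 0)%R%:R : R)].
Proof.
move=> tp; have [M M0 pM] := trigpoly_bnd tp.
pose y x := 2^-1 + (2 * M)^-1 * p x.
have y01 x : 0 <= y x <= 1.
  have := pM x; rewrite ler_norml => /andP[p1 p2].
  have e : y x = (2 * M)^-1 * (M + p x).
    by rewrite /y; field; rewrite gt_eqF.
  rewrite e; apply/andP; split.
    by rewrite mulr_ge0// ?invr_ge0; lra.
  by rewrite mulrC ler_pdivrMr; lra.
exists (fun n x => qstep n (y x)); split.
- move=> n; apply: trigpolyX; apply: trigpolyB; first exact: trigpoly_cst.
  apply: trigpolyX; apply: trigpolyD; first exact: trigpoly_cst.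
  exact: trigpolyZ.
- by move=> n x; exact: qstep01.
- move=> x; rewrite (_ : (p x < 0) = (y x < 2^-1)); first exact: cvg_qstep.
  by rewrite /y -[X in _ = (_ < X)]addr0 ltrD2l pmulr_rlt0// invr_gt0 mulr_gt0.
Qed.

(* On ]0, 1[, x_i < c iff cos (pi c) < cos (2 pi x_i - pi c), since
   |2 pi x_i - pi c| < pi c exactly when 0 < x_i < c. *)
Definition coord_poly (i : 'I_d) (c : R) (x : V) : R :=
  cos (pi * c) - cos (pi * 2 * x ord0 i - pi * c).

Lemma trigpoly_coord i c : trigpoly (coord_poly i c).
Proof.
pose k : Z := delta_mx ord0 i.
have phk (x : V) : phase k x = pi * 2 * x ord0 i.
  rewrite /phase (bigD1 i)//= mxE !eqxx mulr1 big1 ?addr0// => j ji.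
  by rewrite mxE eqxx (negbTE ji) mulr0 mul0r.
have -> : coord_poly i c = fun x => cos (pi * c) -
    (cos (pi * c) * (2^-1 * (wave k x + wave (- k) x)) +
     sin (pi * c) * (2^-1 * (wave k x - wave (- k) x))).
  apply/funext => x.
  rewrite /coord_poly /wave phase_oppk -cos_cas -sin_cas phk cosB.
  by rewrite [cos (pi * c) * _]mulrC [sin (pi * c) * _]mulrC.
apply: trigpolyB; first exact: trigpoly_cst.
by apply: trigpolyD; do 2 apply: trigpolyZ; [apply: trigpolyD|apply: trigpolyB];
  exact: trigpoly_wave.
Qed.

Lemma coord_poly_lt0 i (c : R) (x : V) : 0 < c < 1 -> 0 < x ord0 i < 1 ->
  (coord_poly i c x < 0) = (x ord0 i < c).
Proof.
set t := x ord0 i => /andP[c0 c1] /andP[t0 t1].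
have p0 := @pi_gt0 R.
(* The first sine is positive for t in ]0, 1[, so the sign is that of sin (pi (t - c)), whose
   argument has modulus below pi. *)
have e : coord_poly i c x = 2 * (sin (pi * t) * sin (pi * (t - c))).
  rewrite /coord_poly -/t.
  have -> : pi * c = pi * t - pi * (t - c) by ring.
  have -> : pi * 2 * t - (pi * t - pi * (t - c)) = pi * t + pi * (t - c) by ring.
  by rewrite cosB cosD; ring.
have st : 0 < sin (pi * t).
  apply: sin_gt0_pi; rewrite mulr_gt0//=.
  by rewrite -[ltRHS]mulr1 ltr_pM2l.
rewrite e pmulr_rlt0// pmulr_rlt0//.
have [tc|tc|tc] := ltgtP t c.
- rewrite -oppr_gt0 -sinN -mulrN opprB; apply: sin_gt0_pi.
  rewrite mulr_gt0 ?subr_gt0//= -[ltRHS]mulr1 ltr_pM2l//; lra.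
- apply/negbTE; rewrite -leNgt ltW//; apply: sin_gt0_pi.
  rewrite mulr_gt0 ?subr_gt0//= -[ltRHS]mulr1 ltr_pM2l//; lra.
- by rewrite tc subrr mulr0 sin0 ltxx.
Qed.

End trigpoly.

(** * Completeness of the trigonometric system *)

Section cube.
Context {R : realType}.

Lemma unif01 : uniform_prob (@ltr01 R) (~` `]0, 1[%classic) = 0%E.
Proof.
have m01 : measurable (~` `]0, 1[%classic : set (measurableTypeR R)).
  by apply: measurableC; exact: measurable_itv.
rewrite /uniform_prob integral_uniform_pdf.
apply: null_set_integral => //.
- apply: measurableI => //; exact: measurable_itv.
- by apply/measurable_EFinP/measurable_funTS; exact: measurable_uniform_pdf.
- rewrite (_ : _ `&` _ = [set 0] `|` [set 1]).
    by apply: null_set_setU => //; exact: lebesgue_measure_set1.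
  apply/seteqP; split=> x /=; rewrite !in_itv/=.
    move=> [/negP + /andP[x0 x1]]; rewrite negb_and -!leNgt => /orP[h|h].
      by left; apply/eqP; rewrite eq_le h.
    by right; apply/eqP; rewrite eq_le h x1.
  by case=> ->; rewrite ?ltxx ?lexx ?ler01//= ?andbF.
Qed.

Lemma leb_coord d (i : 'I_d) (B : set (measurableTypeR R)) : measurable B ->
  leb d [set x : 'rV[R]_d | B (x ord0 i)] = uniform_prob (@ltr01 R) B.
Proof.
move=> mB; elim: d i => [|d IH] i; first by case: i.
rewrite /= /distribution /pushforward.
case: (unliftP ord0 i) => [j ->|->].
  rewrite (_ : _ @^-1` _ = setT `*` [set x : 'rV[R]_d | B (x ord0 j)]).
    rewrite product_measure1E//.
      rewrite [X in (X * _)%E](_ : _ = 1%E); first by rewrite mul1e; exact: IH.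
      exact: (probability_setT (uniform_prob (@ltr01 R))).
    by rewrite -[X in measurable X]setTI; exact: measurable_rV_coord.
  by apply/seteqP; split=> -[t x] /=; rewrite mxE liftK//= => -[].
rewrite (_ : _ @^-1` _ = B `*` setT).
  rewrite product_measure1E// [X in (_ * X)%E](_ : _ = 1%E) ?mule1//.
  exact: probability_setT.
by apply/seteqP; split=> -[t x] /=; rewrite mxE unlift_none//= => -[].
Qed.

(** Puts almost every point inside the open cube, where [coord_poly_lt0] decides the sign of
    [coord_poly]. *)
Lemma leb_cube d :
  \forall x \ae (@leb R d), forall i : 'I_d, 0 < (x : 'rV[R]_d) ord0 i < 1.
Proof.
apply: filter_forall => i.
have m01 : measurable (~` `]0, 1[%classic : set (measurableTypeR R)).
  by apply: measurableC; exact: measurable_itv.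
exists [set x : 'rV[R]_d | (~` `]0, 1[%classic) (x ord0 i)]; split.
- by rewrite -[X in measurable X]setTI; exact: measurable_rV_coord.
- exact: (etrans (leb_coord i m01) unif01).
- by move=> x /=; rewrite in_itv.
Qed.

Definition orthant d (c : 'rV[R]_d) : set 'rV[R]_d :=
  [set x | forall i, x ord0 i < c ord0 i].

Lemma setI_closed_orthant d : setI_closed (range (@orthant d)).
Proof.
move=> _ _ [a _ <-] [b _ <-].
exists (\row_i Num.min (a ord0 i) (b ord0 i)) => //.
apply/seteqP; split=> x /=.
  by move=> h; split=> i; have := h i; rewrite mxE lt_min => /andP[].
by move=> [h1 h2] i; rewrite mxE lt_min h1 h2.
Qed.

Lemma measurable_rV_orthant d :
  (@measurable _ 'rV[R]_d) `<=` <<s range (@orthant d) >>.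
Proof.
have sO := smallest_sigma_algebra (setT : set 'rV[R]_d) (range (@orthant d)).
apply: smallest_sub => //.
rewrite -bigcup_seq => A [i _ [B mB <-]]; rewrite setTI.
have {mB} : (RGenInftyO.G (R := R)).-sigma.-measurable B.
  by rewrite -RGenInftyO.measurableE.
move: B; apply: smallest_sub.
  split=> [|B hB|F hF] /=.
  - by rewrite preimage_set0; case: sO.
  - by rewrite setTD preimage_setC -setTD; case: sO => _ + _; exact.
  - by rewrite preimage_bigcup; case: sO => _ _; exact.
move=> _ [c ->] /=.
rewrite (_ : _ @^-1` _ =
  \bigcup_n orthant (\row_j if j == i then c else n%:R)).
  case: sO => _ _; apply => n; apply: sub_sigma_algebra.
  by eexists; last reflexivity.
apply/seteqP; split=> x /=; rewrite in_itv/=.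
  (* The half-space is exhausted by orthants whose other sides sit at n; a sum of bounds dominates
     all the coordinates at the same time. *)
  move=> xc; exists (\sum_j Num.bound (x ord0 j))%N => // j.
  rewrite mxE; case: eqP => [-> //|_].
  apply: (lt_le_trans (unstable.ltr_bound _)).
  by rewrite ler_nat (bigD1 j)//= leq_addr.
by move=> [n _ /(_ i)]; rewrite mxE eqxx.
Qed.

Lemma measurable_orthant d c : measurable (@orthant d c).
Proof.
rewrite (_ : orthant c = \bigcap_(i : 'I_d) [set x | x ord0 i < c ord0 i]).
  apply: fin_bigcap_measurable => // i _.
  rewrite -[X in measurable X]setTI.
  have := @measurable_rV_coord R d i measurableT `]-oo, c ord0 i[%classic.
  rewrite (_ : _ @^-1` _ = [set x : 'rV[R]_d | x ord0 i < c ord0 i]).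
    by apply; exact: measurable_itv.
  by apply/seteqP; split=> x /=; rewrite in_itv.
by apply/seteqP; split=> x h i //=; exact: h.
Qed.

(** The values are kept in [0, 1] so that dominated convergence applies to integrals against any
    integrable function. *)
Definition trig_limit d (A : set 'rV[R]_d) := exists q : nat -> 'rV[R]_d -> R,
  [/\ forall n, trigpoly (q n), forall n x, 0 <= q n x <= 1 &
      \forall x \ae (@leb R d), q n x @[n --> \oo] --> (\1_A x : R)].

Lemma trig_limit_orthant d (c : 'rV[R]_d) : trig_limit (orthant c).
Proof.
(* On the open cube a side outside ]0, 1[ makes the constraint trivial; a constant of the right sign
   then stands in for [coord_poly]. *)
pose p i : 'rV[R]_d -> R := if c ord0 i <= 0 then fun=> 1 else
  if 1 <= c ord0 i then fun=> -1 else coord_poly i (c ord0 i).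
have tp i : trigpoly (p i).
  rewrite /p; case: ifP => _; first exact: trigpoly_cst.
  case: ifP => _; first exact: trigpoly_cst.
  exact: trigpoly_coord.
have /choice[q hq] i := trigpoly_lt0 (tp i).
exists (fun n x => \prod_i q i n x); split.
- by move=> n; apply: trigpoly_prod => i; have [] := hq i.
- move=> n x; apply/andP; split.
    by apply: prodr_ge0 => i _; have [_ /(_ n x)/andP[]] := hq i.
  by apply: prodr_ile1 => i _; have [_ /(_ n x)] := hq i.
- apply: filterS (leb_cube d) => x x01.
  have -> : \1_(orthant c) x = \prod_i ((p i x < 0)%R%:R : R).
    rewrite indicE.
    have pE i : (p i x < 0) = (x ord0 i < c ord0 i).
      have := x01 i; rewrite /p => xi.
      case: ifPn => [c0|]; last rewrite -ltNge => c0.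
        rewrite ltr10; apply/esym/negbTE; rewrite -leNgt.
        by case/andP: xi => /ltW x0 _; exact: le_trans x0.
      case: ifPn => [c1|]; last rewrite -ltNge => c1.
        by rewrite ltrN10; case/andP: xi => _ x1; rewrite (lt_le_trans x1).
      by rewrite coord_poly_lt0// c0.
    have [xc|xc] := boolP (x \in orthant c).
      by move: xc; rewrite inE => xc; rewrite big1// => i _; rewrite pE xc.
    move: xc; rewrite notin_setE => /existsNP[i /negP/negbTE ni].
    by rewrite (bigD1 i)//= pE ni mul0r.
  elim: (index_enum _) => [|i s IH].
    by rewrite big_nil; under eq_fun do rewrite big_nil; exact: cvg_cst.
  rewrite big_cons; under eq_fun do rewrite big_cons.
  by apply: cvgM => //; have [_ _] := hq i; exact.
Qed.

Lemma trig_limit_setT d : @trig_limit d setT.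
Proof.
exists (fun _ _ => 1); split=> [n|n x|]; first exact: trigpoly_cst.
  by rewrite ler01 lexx.
by apply: aeW => x; rewrite indicT; exact: cvg_cst.
Qed.

(** Dynkin's lemma: orthants are stable under intersection and generate the sigma-algebra, so only
    proper differences and increasing unions have to be handled. *)
Lemma trig_induction d (P : set (set 'rV[R]_d)) :
  (forall A, measurable A -> trig_limit A -> P A) ->
  (forall A B, measurable A -> measurable B -> B `<=` A -> P A -> P B ->
    P (A `\` B)) ->
  (forall F : nat -> set 'rV[R]_d, (forall n, measurable (F n)) ->
    {homo F : n m / (n <= m)%N >-> n `<=` m} ->
    (forall n, P (F n)) -> P (\bigcup_n F n)) ->
  forall A, measurable A -> P A.
Proof.
move=> Plim PD Pbig A mA.
suff : <<s range (@orthant d) >> `<=` [set B | measurable B /\ P B].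
  by move=> /(_ A (measurable_rV_orthant mA))[].
apply: lambda_system_subset => //.
- exact: setI_closed_orthant.
- split=> //.
  + by split=> //; apply: Plim => //; exact: trig_limit_setT.
  + move=> B C CB [mB PB] [mC PC]; split; first exact: measurableD.
    exact: PD.
  + move=> F ndF hF; split.
      by apply: bigcup_measurable => n _; have [] := hF n.
    apply: Pbig => [n|n m nm|n]; [by have [] := hF n| |by have [] := hF n].
    by apply/subsetPset/ndF.
- move=> _ [c _ <-]; split; first exact: measurable_orthant.
  by apply: Plim; [exact: measurable_orthant|exact: trig_limit_orthant].
Qed.

End cube.

(** * Uniqueness of Fourier coefficients and density in $L^2$ *)

Section density.
Context {R : realType} {d : nat}.
Local Notation V := 'rV[R]_d.
Local Notation Z := 'rV[int]_d.
Local Notation mu := (@leb R d).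
Local Notation L1 f := (mu.-integrable setT (EFin \o f)).
Implicit Types (f g : V -> R) (A : set V).

Lemma cvg_indic_bigcup (F : nat -> set V) x :
  {homo F : n m / (n <= m)%N >-> n `<=` m} ->
  \1_(F n) x @[n --> \oo] --> (\1_(\bigcup_n F n) x : R).
Proof.
move=> ndF; have [[n _ Fnx]|nF] := pselect ((\bigcup_n F n) x).
  rewrite [X in _ --> X]indicE mem_set; last by exists n.
  apply: cvg_near_cst; exists n => // m nm.
  by rewrite indicE mem_set//; exact: ndF nm _ Fnx.
rewrite [X in _ --> X]indicE memNset//; apply: cvg_near_cst; apply: nearW => n.
by rewrite indicE memNset// => Fnx; apply: nF; exists n.
Qed.

Lemma indicD A B x : B `<=` A -> \1_(A `\` B) x = \1_A x - \1_B x :> R.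
Proof.
move=> BA; rewrite !indicE in_setD; have [xB|xB] := boolP (x \in B).
  by rewrite mem_set ?subrr//; apply: BA; rewrite inE in xB.
by rewrite andbT subr0.
Qed.

Lemma indic_le1 A x : `|\1_A x| <= (1 : R).
Proof. by rewrite ger0_norm// indicE; case: (x \in A). Qed.

Lemma measurable_indicr A : measurable A -> measurable_fun setT (\1_A : V -> R).
Proof. by move=> mA; exact: measurable_indic. Qed.

Lemma trigpoly_ortho f : L1 f -> (forall k, \int[mu]_x (f x * wave k x) = 0) ->
  forall p, trigpoly p -> \int[mu]_x (f x * p x) = 0.
Proof.
move=> lf f0 p [s ->].
under eq_Rintegral do rewrite mulr_sumr.
rewrite Int_sum; first rewrite big1// => c _.
  under eq_Rintegral do rewrite mulrCA.
  rewrite IntZ ?f0 ?mulr0//.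
  under eq_fun do rewrite mulrC.
  exact: (L1_bndM (measurable_wave _) (@wave_le2 _ _ c.2) lf).
move=> c; under eq_fun do rewrite mulrCA [f _ * _]mulrC.
apply: L1Z.
exact: (L1_bndM (measurable_wave _) (@wave_le2 _ _ c.2) lf).
Qed.

(** Orthogonality to waves passes to bounded limits of trigonometric polynomials, hence to the
    indicators of all measurable sets. It is stated in $L^1$ because uniqueness of weak derivatives
    calls for that. *)
Lemma wave_ortho_eq0 f : L1 f -> (forall k, \int[mu]_x (f x * wave k x) = 0) ->
  \forall x \ae mu, f x = 0.
Proof.
move=> lf f0.
have mf := L1_meas lf.
have lfA A : measurable A -> L1 (fun x => f x * \1_A x).
  move=> mA; under eq_fun do rewrite mulrC.
  exact: (L1_bndM (measurable_indicr mA) (indic_le1 A) lf).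
have dom (q : nat -> V -> R) A : measurable A ->
    (forall n, measurable_fun setT (q n)) -> (forall n x, `|q n x| <= 1) ->
    (\forall x \ae mu, q n x @[n --> \oo] --> (\1_A x : R)) ->
    (forall n, \int[mu]_x (f x * q n x) = 0) -> \int[mu]_x (f x * \1_A x) = 0.
  move=> mA mq q1 qA q0.
  have [|||||_] := @DCT _ _ _ mu (fun n x => f x * q n x)
    (fun x => f x * \1_A x) (fun x => `|f x|).
  - by move=> n; apply: measurable_funM.
  - by apply: measurable_funM => //; exact: measurable_indicr.
  - by apply: filterS qA => x hx; apply: cvgM => //; exact: cvg_cst.
  - exact: integrable_norm.
  - by apply: aeW => x n; rewrite normrM ler_piMr.
  by under eq_fun do rewrite q0; move/cvg_lim => <- //; rewrite lim_cst.
have fA : forall A, measurable A -> \int[mu]_x (f x * \1_A x) = 0.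
  apply: trig_induction.
  - move=> A mA [q [tq q01 qA]]; apply: (dom q) => //.
    + by move=> n; exact: measurable_trigpoly.
    + by move=> n x; have /andP[h1 h2] := q01 n x; rewrite ger0_norm.
    + by move=> n; exact: trigpoly_ortho.
  - move=> A B mA mB BA hA hB.
    under eq_Rintegral do rewrite indicD// mulrBr.
    by rewrite IntB ?hA ?hB ?subrr//; exact: lfA.
  - move=> F mF ndF hF; apply: (dom (fun n => \1_(F n))) => //.
    + exact: bigcup_measurable.
    + by move=> n; exact: indic_le1.
    + by apply: aeW => x; exact: cvg_indic_bigcup.
have : ae_eq mu setT (EFin \o f) (EFin \o cst 0).
  apply: integral_ae_eq; [by []|by []| |move=> E _ mE].
    exact/measurable_EFinP/measurable_cst.
  rewrite [RHS]integral0_eq// [LHS]integral_mkcond.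
  have -> : (EFin \o f) \_ E = EFin \o (fun x => f x * \1_E x).
    apply/funext => x; rewrite patchE /= indicE.
    by case: (x \in E); rewrite ?mulr1 ?mulr0.
  by rewrite EInt ?fA//; exact: lfA.
by apply: filterS => x /(_ Logic.I) [].
Qed.

Definition trig_dense f := f \in Lfun mu 2%:E /\ forall e, 0 < e ->
  exists2 p, trigpoly p & \int[mu]_x ((f x - p x) ^+ 2) <= e.

Lemma Int_sqrD f g : f \in Lfun mu 2%:E -> g \in Lfun mu 2%:E ->
  \int[mu]_x ((f x + g x) ^+ 2) <=
  2 * \int[mu]_x (f x ^+ 2) + 2 * \int[mu]_x (g x ^+ 2).
Proof.
move=> lf lg; have hf := L2_sqr lf; have hg := L2_sqr lg.
rewrite -!IntZ// -IntD; [|exact: L1Z|exact: L1Z].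
apply: le_Int.
- exact/L2_sqr/L2D.
- by apply: L1D; exact: L1Z.
- apply: aeW => x; have := sqr_ge0 (f x - g x); nra.
Qed.

Lemma trig_denseD f g : trig_dense f -> trig_dense g ->
  trig_dense (fun x => f x + g x).
Proof.
move=> [lf hf] [lg hg]; split; first exact: L2D.
move=> e e0; have e4 : 0 < e / 4 by rewrite divr_gt0.
have [p tp fp] := hf _ e4; have [r tr gr] := hg _ e4.
exists (fun x => p x + r x); first exact: trigpolyD.
under eq_Rintegral do rewrite opprD addrACA.
apply: (le_trans (Int_sqrD _ _)).
- by apply: L2B => //; exact: L2_trigpoly.
- by apply: L2B => //; exact: L2_trigpoly.
- lra.
Qed.

Lemma trig_denseZ (c : R) f : trig_dense f -> trig_dense (fun x => c * f x).
Proof.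
move=> [lf hf]; split; first exact: L2Z.
move=> e e0; have c0 : 0 < c ^+ 2 + 1 by rewrite ltr_wpDl// sqr_ge0.
have [p tp fp] := hf _ (divr_gt0 e0 c0).
exists (fun x => c * p x); first exact: trigpolyZ.
under eq_Rintegral do rewrite -mulrBr exprMn.
have l2 : (fun x => f x - p x) \in Lfun mu 2%:E.
  by apply: L2B => //; exact: L2_trigpoly.
rewrite IntZ; last exact: L2_sqr.
move: fp; rewrite ler_pdivlMr// => fp; apply: le_trans fp.
rewrite mulrC ler_wpM2l ?lerDl//.
by apply: Rintegral_ge0 => x _; exact: sqr_ge0.
Qed.

Lemma trig_dense_lim f : f \in Lfun mu 2%:E -> (forall e, 0 < e ->
  exists2 g, trig_dense g & \int[mu]_x ((f x - g x) ^+ 2) <= e) -> trig_dense f.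
Proof.
move=> lf hf; split=> // e e0; have e4 : 0 < e / 4 by rewrite divr_gt0.
have [g [lg dg] fg] := hf _ e4; have [p tp gp] := dg _ e4; exists p => //.
have -> : \int[mu]_x (f x - p x) ^+ 2 =
    \int[mu]_x ((f x - g x) + (g x - p x)) ^+ 2.
  by apply: eq_Rintegral => x _; rewrite addrA subrK.
apply: (le_trans (Int_sqrD _ _)).
- exact: L2B.
- by apply: L2B => //; exact: L2_trigpoly.
- lra.
Qed.

Lemma trig_dense_cvg f (g : nat -> V -> R) M : L1 M ->
  measurable_fun setT f ->
  f \in Lfun mu 2%:E -> (forall n, trig_dense (g n)) ->
  (\forall x \ae mu, g n x @[n --> \oo] --> f x) ->
  (\forall x \ae mu, forall n, (f x - g n x) ^+ 2 <= M x) -> trig_dense f.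
Proof.
move=> lM mf lf hg gf gM; apply: trig_dense_lim => // e e0.
have mg n : measurable_fun setT (g n) by have [/L2_meas] := hg n.
have [|||||_] := @DCT _ _ _ mu (fun n x => (f x - g n x) ^+ 2) (fun x => 0) M.
- by move=> n; apply: measurable_funX; apply: measurable_funB.
- exact: measurable_cst.
- apply: filterS gf => x hx.
  have : (f x - g n x) * (f x - g n x) @[n --> \oo] -->
      (f x - f x) * (f x - f x).
    by apply: (cvgM (cvgB (cvg_cst _) hx) (cvgB (cvg_cst _) hx)).
  by rewrite subrr mulr0.
- exact: lM.
- by apply: filterS gM => x h n; rewrite ger0_norm// sqr_ge0.
rewrite Int_cst => /cvgr0Pnorm_le/(_ _ e0)[n _ /(_ n (leqnn n)) /= h].
exists (g n) => //; apply: le_trans h; exact: ler_norm.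
Qed.

Lemma trig_dense_trigpoly p : trigpoly p -> trig_dense p.
Proof.
move=> tp; split; first exact: L2_trigpoly.
move=> e e0; exists p => //.
by under eq_Rintegral do rewrite subrr expr0n; rewrite Int_cst ltW.
Qed.

Lemma trig_dense_indic A : measurable A -> trig_dense \1_A.
Proof.
have l2 B : measurable B -> (\1_B : V -> R) \in Lfun mu 2%:E.
  by move=> mB; exact: (@L2_bnd _ _ _ mu _ 1 (measurable_indicr mB) (indic_le1 B)).
have sq1 (a b : R) : 0 <= a <= 1 -> 0 <= b <= 1 -> (a - b) ^+ 2 <= 1.
  by move=> /andP[? ?] /andP[? ?]; nra.
move: A; apply: trig_induction.
- move=> A mA [q [tq q01 qA]].
  apply: (@trig_dense_cvg _ q (fun=> 1)) => //.
  + exact: L1_cst.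
  + exact: l2.
  + by move=> n; exact: trig_dense_trigpoly.
  + apply: aeW => x n; have := q01 n x; apply: sq1.
    by rewrite indicE; case: (_ \in _); rewrite ?lexx ?ler01.
- move=> A B mA mB BA hA hB.
  have -> : \1_(A `\` B) = (fun x => \1_A x + (-1) * \1_B x) :> (V -> R).
    by apply/funext => x; rewrite indicD// mulN1r.
  by apply: trig_denseD => //; exact: trig_denseZ.
- move=> F mF ndF hF.
  apply: (@trig_dense_cvg _ (fun n => \1_(F n)) (fun=> 1)) => //.
  + exact: L1_cst.
  + by apply: measurable_indicr; exact: bigcup_measurable.
  + by apply: l2; exact: bigcup_measurable.
  + by apply: aeW => x; exact: cvg_indic_bigcup.
  + apply: aeW => x n; rewrite !indicE.
    by apply: sq1; case: (_ \in _); rewrite ?lexx ?ler01.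
Qed.

Lemma trig_dense_sum I (s : seq I) (F : I -> V -> R) :
  (forall i, trig_dense (F i)) -> trig_dense (fun x => \sum_(i <- s) F i x).
Proof.
move=> h; elim: s => [|i s IH].
  under eq_fun do rewrite big_nil; apply: trig_dense_trigpoly.
  exact: trigpoly_cst.
by under eq_fun do rewrite big_cons; exact: trig_denseD.
Qed.

Import HBSimple HBNNSimple.

(** Simple functions from below: 0 <= g_n <= f dominates the squared error (f - g_n)^2 by f^2. *)
Lemma trig_dense_ge0 f : f \in Lfun mu 2%:E -> (forall x, 0 <= f x) ->
  trig_dense f.
Proof.
move=> lf f0; have mf := L2_meas lf.
have mEf : measurable_fun setT (EFin \o f) by exact/measurable_EFinP.
pose g n : V -> R := nnsfun_approx measurableT mEf n.
have g0 n x : 0 <= g n x by exact: fun_ge0.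
have gf n x : g n x <= f x.
  rewrite -lee_fin /g nnsfun_approxE; apply: le_approx => // y _.
  by rewrite lee_fin.
apply: (@trig_dense_cvg _ g (fun x => f x ^+ 2)) => //.
- exact: L2_sqr.
- move=> n; have [s ->] : exists s : seq R,
      g n = (fun x => \sum_(y <- s) y * \1_(g n @^-1` [set y]) x).
    by eexists; apply/funext => x; rewrite {1}/g fimfunE fsbig_finite.
  apply: trig_dense_sum => i; apply: trig_denseZ; apply: trig_dense_indic.
  rewrite -[X in measurable X]setTI; exact: measurable_funP.
- apply: aeW => x; have := @cvg_nnsfun_approx _ _ _ _ measurableT _ mEf.
  move=> /(_ (fun y _ => _) x Logic.I) h.
  have {}h := h (fun y => f0 y).
  exact: (fine_cvg h).
- apply: aeW => x n; rewrite lerXn2r ?nnegrE ?subr_ge0//.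
  by rewrite gerBl.
Qed.

Lemma trig_denseT f : f \in Lfun mu 2%:E -> trig_dense f.
Proof.
move=> lf; have mf := L2_meas lf.
have -> : f = (fun x => Num.max (f x) 0 + (-1) * Num.max (- f x) 0).
  apply/funext => x; rewrite /Num.max; case: (ltrgt0P (f x)) => h.
  - by rewrite oppr_lt0 h; lra.
  - by rewrite oppr_lt0 ltNge (ltW h)/=; lra.
  - by rewrite h oppr0 ltxx; lra.
have pos (h : V -> R) : h \in Lfun mu 2%:E ->
    trig_dense (fun x => Num.max (h x) 0).
  move=> lh; apply: trig_dense_ge0; last by move=> x; rewrite le_max lexx orbT.
  have mh := L2_meas lh.
  apply/L2P; split; first exact: measurable_maxr.
  apply: (L1_le _ (L2_sqr lh)).
    by apply: measurable_funX; exact: measurable_maxr.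
  move=> x; rewrite ger0_norm ?sqr_ge0// /Num.max.
  by case: ifP => // _; rewrite expr0n sqr_ge0.
by apply: trig_denseD; [exact: pos|apply/trig_denseZ/pos/L2N].
Qed.

End density.

(** * Smooth functions, Fourier series and weak derivatives *)

Section smooth_functions.
Context {R : realType} {d : nat}.
Local Notation V := 'rV[R]_d.
Local Notation Z := 'rV[int]_d.
Local Notation mu := (@leb R d).
Implicit Types (f g : V -> R).

Lemma cvg_slope_within (G : R -> R) (l : R) (v x : V) :
  (G t @[t --> within [set t | (setT : set V) (x + t *: v)] 0^'] --> l) <->
  (G t @[t --> 0^'] --> l).
Proof.
split; last exact: cvg_within_filter.
by move=> h A /h [e e0 he]; exists e => // t te t0; exact: he.
Qed.

Lemma smooth_slope f : smooth f -> forall i x,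
  t^-1 * (f (x + t *: ebase i) - f x) @[t --> 0^'] --> partial i f x.
Proof.
move=> [_ [F [F0 Fs]]] i x.
have [_ /(_ (ebase i) x Logic.I) /cvg_slope_within h] := Fs [::].
have {}h : t^-1 * (f (x + t *: ebase i) - f x) @[t --> 0^'] --> F [:: ebase i] x.
  apply: cvg_trans h; apply: near_eq_cvg; apply: nearW => t.
  by rewrite !F0.
by rewrite (partial_slope h).
Qed.

Lemma smooth_partial i f : smooth f -> smooth (partial i f).
Proof.
move=> sf; have [pf [F [F0 Fs]]] := sf; split.
  move=> x k; apply: partial_slope.
  have h := @smooth_slope f sf i x.
  apply: cvg_trans h; apply: near_eq_cvg; apply: nearW => t.
  by rewrite addrAC !pf.
exists (fun s => F (s ++ [:: ebase i])); split=> [x _|s]; last exact: Fs.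
apply/esym; apply: partial_slope.
have [_ /(_ (ebase i) x Logic.I) /cvg_slope_within h] := Fs [::].
by apply: cvg_trans h; apply: near_eq_cvg; apply: nearW => t; rewrite !F0.
Qed.

Lemma smooth_partials s f : smooth f -> smooth (partials s f).
Proof. by move=> sf; elim: s => [//|i s IH] /=; exact: smooth_partial. Qed.

Lemma smooth_continuous f : smooth f -> continuous f.
Proof.
move=> [_ [F [F0 Fs]]].
have -> : f = F [::] by apply/funext => x; rewrite F0.
have [cF _] := Fs [::].
by apply/continuous_subspace_setT.
Qed.

Lemma smooth_lin (a : R) f g : smooth f -> smooth g ->
  smooth (fun x => a * f x + g x).
Proof.
move=> [pf [F [F0 Fs]]] [pg [G [G0 Gs]]]; split.
  by move=> x k; rewrite pf pg.
exists (fun s x => a * F s x + G s x); split=> [x _|s]; first by rewrite F0// G0.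
have [cF dF] := Fs s; have [cG dG] := Gs s; split.
  apply: contD => //; apply: contM => //; exact: cont_cst.
move=> v x _; apply/cvg_slope_within.
have /cvg_slope_within hF := dF v x Logic.I.
have /cvg_slope_within hG := dG v x Logic.I.
have : a * (t^-1 * (F s (x + t *: v) - F s x)) +
  t^-1 * (G s (x + t *: v) - G s x) @[t --> 0^'] --> a * F (v :: s) x + G (v :: s) x.
  by apply: cvgD => //; apply: cvgM => //; exact: cvg_cst.
apply: cvg_trans; apply: near_eq_cvg; apply: nearW => t /=; ring.
Qed.

Lemma partial_lin i (a : R) f g : smooth f -> smooth g ->
  partial i (fun x => a * f x + g x) =
  (fun x => a * partial i f x + partial i g x).
Proof.
move=> sf sg; apply/funext => x; apply: partial_slope.
have : a * (t^-1 * (f (x + t *: ebase i) - f x)) +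
  t^-1 * (g (x + t *: ebase i) - g x) @[t --> 0^'] -->
  a * partial i f x + partial i g x.
  apply: cvgD; last exact: smooth_slope.
  by apply: cvgM; [exact: cvg_cst|exact: smooth_slope].
apply: cvg_trans; apply: near_eq_cvg; apply: nearW => t /=; ring.
Qed.

Lemma partials_lin s (a : R) f g : smooth f -> smooth g ->
  partials s (fun x => a * f x + g x) =
  (fun x => a * partials s f x + partials s g x).
Proof.
move=> sf sg; elim: s => [//|i s /= ->].
by rewrite partial_lin//; exact: smooth_partials.
Qed.

Lemma smooth_cst (c : R) : smooth (fun _ : V => c).
Proof.
have := smooth_lin (c - 1) (@smooth_wave R d 0) (@smooth_wave R d 0).
by under eq_fun do rewrite wave0 mulr1 subrK.
Qed.

Lemma partial_cst i (c : R) : partial i (fun _ : V => c) = (fun=> 0).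
Proof.
apply/funext => x; apply: partial_slope; under eq_fun do rewrite subrr mulr0.
exact: cvg_cst.
Qed.

Lemma partials_cst0 s : partials s (fun _ : V => 0 : R) = (fun=> 0).
Proof. by elim: s => [//|i s /= ->]; rewrite partial_cst. Qed.

Lemma smooth_sum I (r : seq I) (c : I -> R) (F : I -> V -> R) :
  (forall i, smooth (F i)) -> smooth (fun x => \sum_(i <- r) c i * F i x).
Proof.
move=> sF; elim: r => [|i r IH].
  by under eq_fun do rewrite big_nil; exact: smooth_cst.
by under eq_fun do rewrite big_cons; exact: smooth_lin.
Qed.

Lemma partials_sum s I (r : seq I) (c : I -> R) (F : I -> V -> R) :
  (forall i, smooth (F i)) ->
  partials s (fun x => \sum_(i <- r) c i * F i x) =
  (fun x => \sum_(i <- r) c i * partials s (F i) x).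
Proof.
move=> sF; elim: r => [|i r IH].
  under eq_fun do rewrite big_nil; rewrite partials_cst0.
  by apply/funext => x; rewrite big_nil.
under eq_fun do rewrite big_cons.
rewrite partials_lin//; last exact: smooth_sum.
by rewrite IH; apply/funext => x; rewrite big_cons.
Qed.

Lemma measurable_smooth f : smooth f -> measurable_fun setT f.
Proof. by move=> /smooth_continuous; exact: measurable_continuous_rV. Qed.

End smooth_functions.

(** * Fourier partial sums over cubes of frequencies *)

Section fourier.
Context {R : realType} {d : nat}.
Local Notation V := 'rV[R]_d.
Local Notation Z := 'rV[int]_d.
Local Notation mu := (@leb R d).
Local Notation L1 f := (mu.-integrable setT (EFin \o f)).
Local Notation L2 f := (f \in Lfun mu 2%:E).
Implicit Types (f g : V -> R) (k : Z).

Definition fcoef f k : R := \int[mu]_x (f x * wave k x).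

(** Indexes the frequencies in [-n, n]^d by a finite type. The cube is symmetric so that the map k
    -> - k, which differentiation brings in, permutes it. *)
Definition box n : finType := {ffun 'I_d -> 'I_(n.*2.+1)}.

Definition freq n (j : box n) : Z := \row_i ((j i)%:Z - n%:Z).

Lemma freq_inj n : injective (@freq n).
Proof.
move=> j l jl; apply/ffunP => i; move/rowP : jl => /(_ i).
by rewrite !mxE => /addIr [] /ord_inj.
Qed.

Definition freqN n (j : box n) : box n := [ffun i => rev_ord (j i)].

Lemma freqNE n (j : box n) : freq (freqN j) = - freq j.
Proof.
apply/rowP => i; rewrite !mxE ffunE /=.
have := ltn_ord (j i); move: (nat_of_ord (j i)) => a; rewrite ltnS subSS => h.
by rewrite -subzn// -addnn PoszD; ring.
Qed.

Lemma freq_surj n k : (forall i, `|k ord0 i| <= n)%N ->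
  exists j : box n, freq j = k.
Proof.
move=> kn; exists [ffun i => inord (absz (k ord0 i + n%:Z))].
apply/rowP => i; rewrite mxE ffunE inordK.
  rewrite gez0_abs; first by rewrite addrK.
  by have := kn i; lia.
by have := kn i; rewrite -addnn; lia.
Qed.

Definition comb n (c : box n -> R) : V -> R :=
  fun x => \sum_j c j * wave (freq j) x.

Definition fpsum n f : V -> R := comb (fun j : box n => fcoef f (freq j)).

Lemma trigpoly_comb n (c : box n -> R) : trigpoly (comb c).
Proof.
by apply: trigpoly_sum => j; apply: trigpolyZ; exact: trigpoly_wave.
Qed.

Lemma smooth_comb n (c : box n -> R) : smooth (comb c).
Proof. by apply: smooth_sum => j; exact: smooth_wave. Qed.

Lemma L1_wavel f k : L1 f -> L1 (fun x => f x * wave k x).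
Proof.
move=> lf; under eq_fun do rewrite mulrC.
exact: (L1_bndM (measurable_wave k) (wave_le2 k) lf).
Qed.

Lemma Int_comb n (c : box n -> R) f : L1 f ->
  \int[mu]_x (f x * comb c x) = \sum_j c j * fcoef f (freq j).
Proof.
move=> lf; under eq_Rintegral do rewrite mulr_sumr.
rewrite Int_sum.
  apply: eq_bigr => j _; rewrite -IntZ; last exact: L1_wavel.
  by apply: eq_Rintegral => x _; rewrite mulrCA.
move=> j; under eq_fun do rewrite mulrCA.
by apply: L1Z; exact: L1_wavel.
Qed.

Lemma fcoef_comb n (c : box n -> R) j : fcoef (comb c) (freq j) = c j.
Proof.
have l1 : L1 (comb c) by apply: L2_L1; apply: L2_trigpoly; exact: trigpoly_comb.
rewrite /fcoef; under eq_Rintegral do rewrite mulrC.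
rewrite (Int_comb c (L1_wave _)) (bigD1 j)//= big1 ?addr0.
  by rewrite /fcoef Int_waveM eqxx mulr1.
by move=> l lj; rewrite /fcoef Int_waveM (inj_eq (@freq_inj n)) eq_sym (negbTE lj) mulr0.
Qed.

Lemma Int_comb_dist n (c : box n -> R) f : L2 f ->
  \int[mu]_x ((f x - comb c x) ^+ 2) =
  \int[mu]_x (f x ^+ 2) - 2 * (\sum_j c j * fcoef f (freq j)) + \sum_j c j ^+ 2.
Proof.
move=> lf; have lc : L2 (comb c) by apply: L2_trigpoly; exact: trigpoly_comb.
under eq_Rintegral do rewrite sqrrB -mulr_natl.
have l1 := L2_sqr lf; have l2 := L2M_L1 lf lc; have l3 := L2_sqr lc.
rewrite IntD//; last by apply: L1B => //; exact: L1Z.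
rewrite IntB//; last exact: L1Z.
rewrite IntZ// Int_comb; last exact: L2_L1.
congr (_ + _).
under eq_Rintegral do rewrite expr2.
rewrite Int_comb; last exact: L2_L1.
by apply: eq_bigr => j _; rewrite fcoef_comb expr2.
Qed.

Lemma Int_fpsum_dist n f : L2 f -> \int[mu]_x ((f x - fpsum n f x) ^+ 2) =
  \int[mu]_x (f x ^+ 2) - \sum_(j : box n) fcoef f (freq j) ^+ 2.
Proof.
move=> lf; rewrite Int_comb_dist//; under eq_bigr do rewrite -expr2.
ring.
Qed.

Lemma bessel n f : L2 f ->
  \sum_(j : box n) fcoef f (freq j) ^+ 2 <= \int[mu]_x (f x ^+ 2).
Proof.
move=> lf; rewrite -subr_ge0 -Int_fpsum_dist//.
by apply: Rintegral_ge0 => x _; exact: sqr_ge0.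
Qed.

(** By [Int_comb_dist] the two errors differ by the sum of the squares of
    [c j - fcoef f (freq j)]. *)
Lemma fpsum_best n (c : box n -> R) f : L2 f ->
  \int[mu]_x ((f x - fpsum n f x) ^+ 2) <= \int[mu]_x ((f x - comb c x) ^+ 2).
Proof.
move=> lf; rewrite Int_fpsum_dist// Int_comb_dist// -addrA lerD2l -subr_ge0.
rewrite opprK mulr_sumr -sumrN -!big_split; apply: sumr_ge0 => j _ /=.
have := sqr_ge0 (c j - fcoef f (freq j)); nra.
Qed.

(** Covers every large [n], so that the whole sequence of partial sums converges in [fpsum_cvg]. *)
Lemma trigpoly_combE p : trigpoly p -> exists n0, forall n, (n0 <= n)%N ->
  exists c : box n -> R, p = comb c.
Proof.
move=> [s ->]; elim: s => [|[a k] s [n0 IH]].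
  exists 0%N => n _; exists (fun=> 0); apply/funext => x.
  by rewrite big_nil /comb big1// => j _; rewrite mul0r.
exists (maxn n0 (\sum_i `|k ord0 i|)%N) => n; rewrite geq_max => /andP[nn0 nk].
have [c cE] := IH n nn0.
have [|j jE] := @freq_surj n k.
  by move=> i; apply: leq_trans nk; rewrite (bigD1 i)//= leq_addr.
exists (fun l => a * (l == j)%:R + c l); apply/funext => x.
have /(congr1 (fun h => h x)) cx := cE.
rewrite big_cons cx /comb; under [in RHS]eq_bigr do rewrite mulrDl.
rewrite big_split; congr (_ + _); rewrite (bigD1 j)//= eqxx mulr1 jE big1 ?addr0//.
by move=> l /negbTE ->; rewrite mulr0 mul0r.
Qed.

Lemma fpsum_cvg f : L2 f ->
  \int[mu]_x ((f x - fpsum n f x) ^+ 2) @[n --> \oo] --> (0 : R).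
Proof.
move=> lf; apply/cvgr0Pnorm_le => e e0.
have [_ /(_ e e0)[p tp pe]] := trig_denseT lf.
have [n0 hn] := trigpoly_combE tp.
exists n0 => // n n0n /=; have [c cE] := hn n n0n.
rewrite ger0_norm; last by apply: Rintegral_ge0 => x _; exact: sqr_ge0.
by apply: le_trans pe; rewrite cE; exact: fpsum_best.
Qed.

Lemma L2_fpsum n f : L2 (fpsum n f).
Proof. by apply: L2_trigpoly; exact: trigpoly_comb. Qed.

Lemma Int_fpsum_cvg f g : L2 f -> L2 g ->
  \int[mu]_x (f x * fpsum n g x) @[n --> \oo] --> \int[mu]_x (f x * g x).
Proof.
move=> lf lg; apply/cvgrPdist_le => e e0.
pose F := \int[mu]_x (f x ^+ 2).
have F0 : 0 <= F by apply: Rintegral_ge0 => x _; exact: sqr_ge0.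
(* Weight for [Int_Young]: the term with [f] becomes at most e / 2, and the added 1 keeps the
   division meaningful when F = 0. *)
pose c := e / 2 / (F + 1).
have c0 : 0 < c by rewrite !divr_gt0// ltr_wpDl.
have /cvgr0Pnorm_le/(_ _ (mulr_gt0 c0 (divr_gt0 e0 (ltr0n _ 2)))) := fpsum_cvg lg.
apply: filterS => n; rewrite ger0_norm; last first.
  by apply: Rintegral_ge0 => x _; exact: sqr_ge0.
move=> h; rewrite -IntB; [|exact: L2M_L1|by apply: L2M_L1 => //; exact: L2_fpsum].
under eq_Rintegral do rewrite -mulrBr.
have lgs : L2 (fun x => g x - fpsum n g x) by apply: L2B => //; exact: L2_fpsum.
apply: (le_trans (Int_Young c0 lf lgs)).
have h1 : c * F <= e / 2.
  rewrite /c mulrAC ler_pdivrMr ?ltr_wpDl//.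
  by apply: ler_wpM2l; [rewrite divr_ge0 ?ltW|rewrite lerDl].
have h2 : c^-1 * \int[mu]_x ((g x - fpsum n g x) ^+ 2) <= e / 2.
  by rewrite mulrC ler_pdivrMr// mulrC.
by rewrite [leRHS]splitr lerD.
Qed.

End fourier.

(** * Weak derivatives as Fourier multipliers *)

Section weak_derivatives.
Context {R : realType} {d : nat}.
Local Notation V := 'rV[R]_d.
Local Notation Z := 'rV[int]_d.
Local Notation mu := (@leb R d).
Local Notation L1 f := (mu.-integrable setT (EFin \o f)).
Local Notation L2 f := (f \in Lfun mu 2%:E).
Implicit Types (f g v : V -> R) (k : Z) (s t : seq 'I_d).

Lemma inLp1P f : inLp 1%E f <-> Defs.periodic f /\ L1 f.
Proof. by split=> -[pf /Lfun1_integrable]. Qed.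

Lemma inLp2_L1 f : inLp 2%:E f -> inLp 1%E f.
Proof. by move=> [pf lf]; apply/inLp1P; split=> //; exact: L2_L1. Qed.

Lemma smooth_bnd f : smooth f -> exists M : R, forall x, `|f x| <= M.
Proof.
move=> sf; have [pf _] := sf; have cf := smooth_continuous sf.
pose K : set V := [set x | forall i, (`[0, 1]%classic : set R) (x ord0 i)].
have cK : compact K.
  exact: (@rV_compact R d (fun=> `[0, 1]%classic) (fun=> @segment_compact R 0 1)).
have : compact (f @` K).
  by apply: continuous_compact => //; exact: continuous_subspaceT.
move=> /compact_bounded[M [_ hM]].
exists (M + 1) => x.
(* By periodicity, translation by minus the integer parts brings any point into the compact unit
   cube. *)
pose n : Z := \row_i (- Num.floor (x ord0 i)).
rewrite -(pf x n).
have /hM : M < M + 1 by rewrite ltrDl.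
apply.
exists (x + map_mx intr n) => // i /=; rewrite !mxE in_itv/= rmorphN/=.
have := floor_itv (x ord0 i); rewrite intrD => /andP[h1 h2].
by apply/andP; split; lra.
Qed.

Lemma L1_smoothM f phi : L1 f -> smooth phi -> L1 (fun x => f x * phi x).
Proof.
move=> lf sp; have [M hM] := smooth_bnd sp.
under eq_fun do rewrite mulrC.
exact: (L1_bndM (measurable_smooth sp) hM lf).
Qed.

(* A derivative maps wave k to a multiple of wave (- k). *)
Definition sgfreq s k : Z := if odd (size s) then - k else k.

Fixpoint symb s k : R := if s is i :: s' then
  symb s' k * (pi * 2 * (sgfreq s' k ord0 i)%:~R) else 1.

Lemma sgfreqN s k : sgfreq s (- k) = - sgfreq s k.
Proof. by rewrite /sgfreq; case: odd. Qed.

Lemma sgfreqK s k : sgfreq s (sgfreq s k) = k.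
Proof. by rewrite /sgfreq; case: odd => //; rewrite opprK. Qed.

Lemma symbN s k : symb s (- k) = (-1) ^+ size s * symb s k.
Proof.
elim: s => [|i s IH] /=; first by rewrite expr0 mulr1.
by rewrite IH sgfreqN mxE rmorphN/= exprS; ring.
Qed.

Lemma symb_sgfreq s k : (-1) ^+ size s * symb s (sgfreq s k) = symb s k.
Proof.
rewrite /sgfreq; case: ifPn => o; last first.
  by rewrite -signr_odd (negbTE o) expr0 mul1r.
by rewrite symbN mulrA -expr2 sqrr_sign mul1r.
Qed.

Lemma partials_wave s k :
  partials s (wave k) = (fun x : V => symb s k * wave (sgfreq s k) x).
Proof.
elim: s => [|i s /= ->].
  by apply/funext => x; rewrite /= mul1r.
have -> : (fun x : V => symb s k * wave (sgfreq s k) x) =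
    (fun x : V => symb s k * wave (sgfreq s k) x + 0).
  by apply/funext => x; rewrite addr0.
rewrite partial_lin; [|exact: smooth_wave|exact: smooth_cst].
rewrite partial_cst partial_wave; apply/funext => x.
rewrite addr0 mulrA; congr (_ * wave _ x).
by rewrite /sgfreq /=; case: odd => //=; rewrite opprK.
Qed.

Lemma wderiv_fcoef s f g k : is_wderiv s f g ->
  fcoef g k = (-1) ^+ size s * symb s k * fcoef f (sgfreq s k).
Proof.
move=> [/inLp1P[_ lf] _ /(_ _ (smooth_wave k))].
rewrite partials_wave.
under eq_Rintegral do rewrite mulrCA.
rewrite IntZ; last exact: L1_wavel.
rewrite -/(fcoef f _) -/(fcoef g _) => h.
by rewrite -mulrA h mulrA -expr2 sqrr_sign mul1r.
Qed.

(** An odd number of derivatives sends each wave to the opposite frequency, so the box is permuted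
    by [freqN]. Hence the derivatives of smooth partial sums converge in $L^2$ to the weak
    derivatives that are in $L^2$. *)
Lemma partials_fpsum s f g n : is_wderiv s f g ->
  partials s (fpsum n f) = fpsum n g.
Proof.
move=> fg; rewrite /fpsum /comb partials_sum; last by move=> j; exact: smooth_wave.
apply/funext => x.
under eq_bigr do rewrite partials_wave.
pose sgj (j : @box d n) : @box d n := if odd (size s) then freqN j else j.
have sgjE j : freq (sgj j) = sgfreq s (freq j).
  by rewrite /sgj /sgfreq; case: odd => //; rewrite freqNE.
have sgjK : involutive sgj.
  by move=> j; apply: freq_inj; rewrite !sgjE sgfreqK.
rewrite [RHS](reindex_inj (inv_inj sgjK)); apply: eq_bigr => j _ /=.
rewrite mulrA sgjE; congr (_ * _).
by rewrite (wderiv_fcoef _ fg) sgfreqK symb_sgfreq mulrC.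
Qed.

(** Waves are admissible tests, so the definition fixes all Fourier coefficients of a weak
    derivative. *)
Lemma wderiv_unique s f g g' : is_wderiv s f g -> is_wderiv s f g' ->
  \forall x \ae mu, g x = g' x.
Proof.
move=> hg hg'; have [_ /inLp1P[_ lg] _] := hg; have [_ /inLp1P[_ lg'] _] := hg'.
have : \forall x \ae mu, g x - g' x = 0.
  apply: wave_ortho_eq0; first exact: L1B.
  move=> k; under eq_Rintegral do rewrite mulrBl.
  rewrite IntB; [|exact: L1_wavel|exact: L1_wavel].
  by rewrite -!/(fcoef _ _) (wderiv_fcoef k hg) (wderiv_fcoef k hg') subrr.
by apply: filterS => x /subr0_eq.
Qed.

Lemma partials_cat s t (phi : V -> R) : partials (s ++ t) phi = partials s (partials t phi).
Proof. by rewrite /partials foldr_cat. Qed.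

Lemma wderiv_cat s t f v g : is_wderiv s f v -> is_wderiv (s ++ t) f g ->
  is_wderiv t v g.
Proof.
move=> [lf lv hv] [_ lg hg]; split=> // phi sphi.
have := hg _ sphi; rewrite partials_cat (hv _ (smooth_partials t sphi)).
rewrite size_cat exprD -mulrA => /(congr1 ( *%R ((-1) ^+ size s))).
by rewrite !mulrA -expr2 sqrr_sign !mul1r.
Qed.

Lemma wderivP s f : wderivable s f -> is_wderiv s f (wD s f).
Proof. by move=> [g hg]; exact: (@xgetPex _ _ [set g | is_wderiv s f g] (ex_intro _ g hg)). Qed.

Lemma wderiv_lin s (a : R) f g f' g' : is_wderiv s f f' -> is_wderiv s g g' ->
  is_wderiv s (fun x => a * f x + g x) (fun x => a * f' x + g' x).
Proof.
move=> [/inLp1P[pf lf] /inLp1P[pf' lf'] hf] [/inLp1P[pg lg] /inLp1P[pg' lg'] hg].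
split.
- apply/inLp1P; split; first by move=> x k; rewrite pf pg.
  by apply: L1D => //; exact: L1Z.
- apply/inLp1P; split; first by move=> x k; rewrite pf' pg'.
  by apply: L1D => //; exact: L1Z.
- move=> phi sphi.
  have E (F G psi : V -> R) : L1 F -> L1 G -> smooth psi ->
     \int[mu]_x ((a * F x + G x) * psi x) =
     a * \int[mu]_x (F x * psi x) + \int[mu]_x (G x * psi x).
    move=> lF lG sp; under eq_Rintegral do rewrite mulrDl -mulrA.
    rewrite IntD ?IntZ//; [exact: L1_smoothM|apply: L1Z; exact: L1_smoothM|].
    exact: L1_smoothM.
  rewrite !E//; last exact: smooth_partials.
  by rewrite hf// hg//; ring.
Qed.

Lemma wderiv0 s : is_wderiv s (fun=> 0) (fun _ : V => 0 : R).
Proof.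
have i0 : inLp 1%E (fun _ : V => 0 : R) by apply/inLp1P; split=> //; exact: L1_cst.
split=> // phi _.
by under eq_Rintegral do rewrite mul0r; under [in RHS]eq_Rintegral do rewrite mul0r;
  rewrite Int_cst mulr0.
Qed.

Lemma sobolev_L2 n f : sobolev n 2%:E f -> L2 f.
Proof. by move=> [[]]. Qed.

Lemma inLp2_lin (a : R) f g : inLp 2%:E f -> inLp 2%:E g ->
  inLp 2%:E (fun x => a * f x + g x).
Proof.
move=> [pf lf] [pg lg]; split; first by move=> x k; rewrite pf pg.
by apply: L2D => //; exact: L2Z.
Qed.

Lemma sobolev_lin n (a : R) f g : sobolev n 2%:E f -> sobolev n 2%:E g ->
  sobolev n 2%:E (fun x => a * f x + g x).
Proof.
move=> [lf hf] [lg hg]; split; first exact: inLp2_lin.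
move=> s sn; have [f' lf' wf] := hf s sn; have [g' lg' wg] := hg s sn.
by exists (fun x => a * f' x + g' x); [exact: inLp2_lin|exact: wderiv_lin].
Qed.

Lemma sobolev_cst0 n : sobolev n 2%:E (fun _ : V => 0 : R).
Proof.
have i0 : inLp 2%:E (fun _ : V => 0 : R) by split=> //; exact: L2_cst.
by split=> // s _; exists (fun=> 0) => //; exact: wderiv0.
Qed.

Lemma sobolev_sum n I (r : seq I) (F : I -> V -> R) :
  (forall i, sobolev n 2%:E (F i)) ->
  sobolev n 2%:E (fun x => \sum_(i <- r) F i x).
Proof.
move=> h; elim: r => [|i r IH].
  by under eq_fun do rewrite big_nil; exact: sobolev_cst0.
have := sobolev_lin 1 (h i) IH.
by under [X in sobolev _ _ X -> _]eq_fun do rewrite mul1r;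
  under [X in _ -> sobolev _ _ X]eq_fun do rewrite big_cons.
Qed.

Lemma sobolev_wderivable n f s : sobolev n 2%:E f -> (size s <= n)%N ->
  wderivable s f.
Proof. by move=> [_ h] /h [g _ hg]; exists g. Qed.

(** [wD] selects some $L^1$ representative, while the Sobolev condition speaks of an $L^2$ one;
    uniqueness almost everywhere transfers the integrability. *)
Lemma sobolev_wD n f s : sobolev (size s + n) 2%:E f -> sobolev n 2%:E (wD s f).
Proof.
move=> sf; have hw : is_wderiv s f (wD s f).
  by apply: wderivP; apply: sobolev_wderivable sf _; rewrite leq_addr.
have [_ h] := sf; split.
  have [|g [pg lg] hg] := h s; first by rewrite leq_addr.
  have [_ /inLp1P[pw lw] _] := hw; split=> //.
  apply: ae_eq_L2 lg; first exact: L1_meas lw.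
  exact: wderiv_unique hg hw.
move=> t tn; have [|g lg hg] := h (s ++ t); first by rewrite size_cat leq_add2l.
by exists g => //; exact: wderiv_cat hw hg.
Qed.

Lemma sobolev_wD_L2 n f s : sobolev n 2%:E f -> (size s <= n)%N -> L2 (wD s f).
Proof.
move=> sf sn; apply: (@sobolev_L2 (n - size s)); apply: sobolev_wD.
by rewrite subnKC.
Qed.

Lemma sobolevW n n' f : (n' <= n)%N -> sobolev n 2%:E f -> sobolev n' 2%:E f.
Proof. by move=> nn [lf h]; split=> // s sn; apply: h; exact: leq_trans nn. Qed.

Lemma sobolev_wlap n f : sobolev (2 + n) 2%:E f -> sobolev n 2%:E (wlap f).
Proof. by move=> sf; apply: sobolev_sum => i; exact: (@sobolev_wD n f [:: i; i]). Qed.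

(** Eigenvalue of minus the Laplacian on [wave k]. *)
Definition freq2 k : R := \sum_i (pi * 2 * (k ord0 i)%:~R) ^+ 2.

Lemma fcoef_lin (a : R) f g k : L1 f -> L1 g ->
  fcoef (fun x => a * f x + g x) k = a * fcoef f k + fcoef g k.
Proof.
move=> lf lg; rewrite /fcoef; under eq_Rintegral do rewrite mulrDl -mulrA.
by rewrite IntD ?IntZ//; [exact: L1_wavel|apply: L1Z; exact: L1_wavel|exact: L1_wavel].
Qed.

Lemma fcoef_wlap n f k : sobolev (2 + n) 2%:E f ->
  fcoef (wlap f) k = - freq2 k * fcoef f k.
Proof.
move=> sf; rewrite /fcoef /wlap; under eq_Rintegral do rewrite mulr_suml.
rewrite Int_sum; last first.
  move=> i; apply: L1_wavel; apply: L2_L1.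
  by apply: sobolev_wD_L2 sf _.
rewrite /freq2 -sumrN mulr_suml; apply: eq_bigr => i _.
have /wderivP h : wderivable [:: i; i] f by exact: sobolev_wderivable sf _.
rewrite -/(fcoef _ _) (wderiv_fcoef k h) /= /sgfreq/= mxE rmorphN/= -/(fcoef _ _).
ring.
Qed.

Lemma sobolev_iter_wlap n m f : sobolev (2 * m + n) 2%:E f ->
  sobolev n 2%:E (iter m wlap f).
Proof.
elim: m n => [//|m IH] n sf; rewrite iterS; apply: sobolev_wlap; apply: IH.
by rewrite addnA -mulnSr.
Qed.

Lemma fcoef_iter_wlap n m f k : sobolev (2 * m + n) 2%:E f ->
  fcoef (iter m wlap f) k = (- freq2 k) ^+ m * fcoef f k.
Proof.
elim: m n => [|m IH] n sf; first by rewrite expr0 mul1r.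
have sf' : sobolev (2 * m + (2 + n)) 2%:E f by rewrite addnA -mulnSr.
rewrite iterS (@fcoef_wlap n); last exact: sobolev_iter_wlap.
by rewrite (IH _ sf') mulrA exprS.
Qed.

Lemma freq2_ge0 k : 0 <= freq2 k.
Proof. by apply: sumr_ge0 => i _; exact: sqr_ge0. Qed.

(** Paired with a partial sum of [f], the Laplacian gives minus a sum of [freq2] times squared
    coefficients, and the sign survives the limit. *)
Lemma Int_wlap_le0 f : sobolev 2 2%:E f -> \int[mu]_x (wlap f x * f x) <= 0.
Proof.
move=> sf; have sf' : sobolev (2 + 0) 2%:E f by [].
have lw : L2 (wlap f) by apply: sobolev_L2; exact: sobolev_wlap sf'.
apply: (cvgr_to_le (Int_fpsum_cvg lw (sobolev_L2 sf))).
apply: nearW => n; rewrite Int_comb; last exact: L2_L1.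
apply: sumr_le0 => j _; rewrite (fcoef_wlap _ sf').
rewrite mulrCA -expr2 mulNr oppr_le0 mulr_ge0 ?sqr_ge0 ?freq2_ge0//.
Qed.

(** Here the multiplier is an even power of [- freq2 k]. *)
Lemma Int_iter_wlap_ge0 m f : sobolev (2 * (2 * m)) 2%:E f ->
  0 <= \int[mu]_x (iter (2 * m) wlap f x * f x).
Proof.
move=> sf; have sf' : sobolev (2 * (2 * m) + 0) 2%:E f by rewrite addn0.
have lw : L2 (iter (2 * m) wlap f).
  by apply: sobolev_L2; exact: sobolev_iter_wlap sf'.
apply: (cvgr_to_ge (Int_fpsum_cvg lw (sobolev_L2 sf))).
apply: nearW => n; rewrite Int_comb; last exact: L2_L1.
apply: sumr_ge0 => j _; rewrite (fcoef_iter_wlap _ sf').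
by rewrite mulrCA -expr2 mulr_ge0 ?sqr_ge0// exprM sqrrN exprn_ge0// sqr_ge0.
Qed.

Lemma freq2_0 : freq2 0 = 0.
Proof. by rewrite /freq2 big1// => i _; rewrite mxE mulr0 expr0n. Qed.

Lemma fcoef0 f : fcoef f 0 = \int[mu]_x f x.
Proof. by apply: eq_Rintegral => x _; rewrite wave0 mulr1. Qed.

(** The mean is the coefficient at frequency 0, where the multiplier vanishes. *)
Lemma Int_iter_wlap0 m f : (0 < m)%N -> sobolev (2 * m) 2%:E f ->
  \int[mu]_x iter m wlap f x = 0.
Proof.
move=> m0; rewrite -[(2 * m)%N]addn0 => sf.
by rewrite -fcoef0 (fcoef_iter_wlap _ sf) freq2_0 oppr0 expr0n eqn0Ngt m0 mul0r.
Qed.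

End weak_derivatives.

(** * Sobolev functions of high order are bounded *)

Section sobolev_embedding.
Context {R : realType} {d : nat}.
Local Notation V := 'rV[R]_d.
Local Notation Z := 'rV[int]_d.
Local Notation mu := (@leb R d).
Local Notation L1 f := (mu.-integrable setT (EFin \o f)).
Local Notation L2 f := (f \in Lfun mu 2%:E).
Implicit Types (f g v : V -> R) (k : Z) (s t : seq 'I_d).

Lemma sum_inv_sqr n : \sum_(0 <= k < n) (1 + k%:R ^+ 2)^-1 <= (4 : R).
Proof.
(* Telescoping: the term of index n is at most 4 / ((n + 1) (n + 2)) = 4 / (n + 1) - 4 / (n + 2). *)
suff : \sum_(0 <= k < n) (1 + k%:R ^+ 2)^-1 <= 4 - 4 / n.+1%:R :> R.
  by move=> /le_trans; apply; rewrite gerBl divr_ge0.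
elim: n => [|n IH]; first by rewrite big_nil divr1 subrr.
rewrite big_nat_recr//=.
have -> : 4 - 4 / n.+2%:R = 4 - 4 / n.+1%:R + (4 / n.+1%:R - 4 / n.+2%:R) :> R by ring.
apply: lerD => //.
have n0 : 0 <= n%:R :> R by [].
have e1 : n.+1%:R = n%:R + 1 :> R by rewrite natr1.
have e2 : n.+2%:R = n%:R + 1 + 1 :> R by rewrite !natr1.
rewrite e1 e2; set x : R := n%:R in n0 *.
have -> : 4 / (x + 1) - 4 / (x + 1 + 1) = 4 / ((x + 1) * (x + 1 + 1)).
  by field; rewrite !gt_eqF//; lra.
rewrite -[leLHS]mul1r ler_pdivrMr; last by rewrite ltr_pwDl// sqr_ge0.
rewrite mulrAC ler_pdivlMr; last by rewrite mulr_gt0//; lra.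
nra.
Qed.

(** The factor 2 pi >= 1 only decreases the terms, and the negative and nonnegative frequencies
    contribute 4 each. *)
Lemma sum_inv_freq n :
  \sum_(a < n.*2.+1) (1 + (pi * 2 * ((a : nat)%:Z - n%:Z)%:~R) ^+ 2)^-1 <= (8 : R).
Proof.
pose g (k : nat) : R := (1 + k%:R ^+ 2)^-1.
have h (z : int) : (1 + (pi * 2 * z%:~R) ^+ 2)^-1 <= g `|z|%N.
  rewrite /g; have -> : ((`|z|%N)%:R : R) ^+ 2 = z%:~R ^+ 2.
    by rewrite natr_absz intr_norm real_normK ?num_real.
  have z0 : 0 <= (z%:~R : R) ^+ 2 by exact: sqr_ge0.
  rewrite lef_pV2 ?posrE; last 2 first.
  - by rewrite ltr_pwDl// sqr_ge0.
  - by rewrite ltr_pwDl.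
  rewrite lerD2l exprMn ler_peMl//; have := pi_ge2 R; set p := pi => p2; nra.
apply: (le_trans (ler_sum _ (fun a _ => h _))).
rewrite -(big_mkord xpredT (fun a => g `|a%:Z - n%:Z|%N)).
rewrite (@big_cat_nat _ _ _ n)//=; last by lia.
rewrite (_ : 8 = 4 + 4 :> R); last by ring.
apply: lerD.
  rewrite big_nat_rev /= add0n.
  have -> : \sum_(0 <= i < n) g `|(n - i.+1)%N%:Z - n%:Z|%N =
     \sum_(0 <= i < n) g i.+1.
    by apply: eq_big_nat => i ilt; congr g; lia.
  apply: le_trans (sum_inv_sqr n.+1); rewrite [leRHS]big_nat_recl//.
  by rewrite lerDr invr_ge0 addr_ge0// sqr_ge0.
rewrite -{1}[n]add0n big_addn.
apply: le_trans (sum_inv_sqr n.+1).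
have -> : (n.*2.+1 - n = n.+1)%N by lia.
rewrite le_eqVlt; apply/orP; left; apply/eqP.
by apply: eq_big_nat => i _; congr g; lia.
Qed.

Lemma sum_box_inv n :
  \sum_(j : @box d n) \prod_i (1 + (pi * 2 * (freq j ord0 i)%:~R) ^+ 2)^-1
  <= (8 : R) ^+ d.
Proof.
pose F (i : 'I_d) (a : 'I_(n.*2.+1)) : R :=
  (1 + (pi * 2 * ((a : nat)%:Z - n%:Z)%:~R) ^+ 2)^-1.
have -> : \sum_(j : @box d n) \prod_i (1 + (pi * 2 * (freq j ord0 i)%:~R) ^+ 2)^-1 =
    \sum_(j : @box d n) \prod_i F i (j i).
  by apply: eq_bigr => j _; apply: eq_bigr => i _; rewrite mxE.
(* The sum over the box of a product over coordinates factors into one-dimensional sums. *)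
rewrite -(bigA_distr_bigA F).
rewrite /F big_const_ord iter_mulr_1.
by apply: lerXn2r; rewrite ?nnegrE ?sum_inv_freq// sumr_ge0// => a _;
  rewrite invr_ge0 addr_ge0// sqr_ge0.
Qed.

(** The operator 1 - Laplacian, written in the shape of [sobolev_lin] and [fcoef_lin]. *)
Definition bessel_pot f : V -> R := fun x => -1 * wlap f x + f x.

Lemma sobolev_bessel_pot n f : sobolev (2 + n) 2%:E f ->
  sobolev n 2%:E (bessel_pot f).
Proof.
move=> sf; apply: sobolev_lin; first exact: sobolev_wlap.
by apply: sobolevW sf; rewrite leq_addl.
Qed.

Lemma fcoef_bessel_pot n f k : sobolev (2 + n) 2%:E f ->
  fcoef (bessel_pot f) k = (1 + freq2 k) * fcoef f k.
Proof.
move=> sf; rewrite fcoef_lin.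
- by rewrite (fcoef_wlap _ sf); ring.
- by apply: L2_L1; apply: sobolev_L2; exact: sobolev_wlap sf.
- by apply: L2_L1; exact: sobolev_L2 sf.
Qed.

Lemma sobolev_iter_bessel n m f : sobolev (2 * m + n) 2%:E f ->
  sobolev n 2%:E (iter m bessel_pot f).
Proof.
elim: m n => [//|m IH] n sf; rewrite iterS; apply: sobolev_bessel_pot; apply: IH.
by rewrite addnA -mulnSr.
Qed.

Lemma fcoef_iter_bessel n m f k : sobolev (2 * m + n) 2%:E f ->
  fcoef (iter m bessel_pot f) k = (1 + freq2 k) ^+ m * fcoef f k.
Proof.
elim: m n => [|m IH] n sf; first by rewrite expr0 mul1r.
have sf' : sobolev (2 * m + (2 + n)) 2%:E f by rewrite addnA -mulnSr.
rewrite iterS (@fcoef_bessel_pot n); last exact: sobolev_iter_bessel.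
by rewrite (IH _ sf') mulrA exprS.
Qed.

Lemma prod_le_freq2 m k : (d <= m)%N ->
  \prod_i (1 + (pi * 2 * (k ord0 i)%:~R) ^+ 2) <= (1 + freq2 k : R) ^+ m.
Proof.
move=> dm; have q0 := @freq2_ge0 R d k.
apply: (@le_trans _ _ ((1 + freq2 k) ^+ d)); last by rewrite ler_weXn2l// lerDl.
rewrite -[X in _ ^+ X](card_ord d) -prodr_const.
apply: ler_prod => i _; rewrite addr_ge0 ?sqr_ge0//= lerD2l.
by rewrite /freq2 (bigD1 i)//= lerDl sumr_ge0// => j _; exact: sqr_ge0.
Qed.

(* AM-GM on each Fourier coefficient of f, which is w^-m times that of
   (1 - Lap)^m f: 2 |a| <= (w^m a)^2 + w^(-2m), and w^(-2m) is dominated by the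
   summable product over the coordinates of 1 / (1 + (2 pi k_i)^2). *)
Lemma fpsum_bnd m f : (d <= 2 * m)%N -> sobolev (2 * m) 2%:E f ->
  exists M : R, forall n x, `|fpsum n f x| <= M.
Proof.
rewrite -[X in sobolev X](addn0 (2 * m)) => dm sf.
have lb : L2 (iter m bessel_pot f) by apply: sobolev_L2; exact: sobolev_iter_bessel sf.
exists (\int[mu]_x (iter m bessel_pot f x ^+ 2) + 8 ^+ d) => n x.
apply: (le_trans (ler_norm_sum _ _ _)).
apply: (le_trans _ (lerD (bessel n lb) (sum_box_inv n))).
rewrite -big_split; apply: ler_sum => j _ /=.
rewrite normrM (fcoef_iter_bessel _ sf).
set a := fcoef f _; set w := 1 + freq2 _.
have w1 : 1 <= w by rewrite lerDl freq2_ge0.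
have w0 : 0 < w by lra.
have h : (w ^+ m) ^+ 2 * \prod_i (1 + (pi * 2 * (freq j ord0 i)%:~R) ^+ 2)^-1 >= 1.
  rewrite prodfV -exprM mulnC ler_pdivlMr ?mul1r.
    exact: prod_le_freq2.
  by apply: prodr_gt0 => i _; rewrite ltr_pwDl// sqr_ge0.
move: h; set P := \prod_i _ => h.
have P0 : 0 <= P by apply: prodr_ge0 => i _; rewrite invr_ge0 addr_ge0// sqr_ge0.
apply: (@le_trans _ _ (2 * `|a|)).
  by rewrite mulrC ler_wpM2r// wave_le2.
have -> : (w ^+ m * a) ^+ 2 = (w ^+ m) ^+ 2 * `|a| ^+ 2.
  by rewrite exprMn real_normK ?num_real.
set b := `|a|; have b0 : 0 <= b by exact: normr_ge0.
set u := (w ^+ m) ^+ 2 in h *; have u0 : 0 < u by rewrite !exprn_gt0.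
have u1 : u^-1 <= P by rewrite -[u^-1]mul1r ler_pdivrMr// mulrC.
apply: le_trans (lerD (lexx _) u1).
have -> : u * b ^+ 2 + u^-1 = 2 * b + u^-1 * (u * b - 1) ^+ 2.
  by field; rewrite gt_eqF.
by rewrite lerDl mulr_ge0 ?sqr_ge0// invr_ge0 ltW.
Qed.

(** The excess [e] of |f| over the common bound of the partial sums is pointwise at most |f - fpsum
    n f|, so its $L^2$ norm is below a null sequence. This avoids extracting an almost everywhere
    convergent subsequence. *)
Lemma sobolev_bounded m f : (d <= 2 * m)%N -> sobolev (2 * m) 2%:E f ->
  exists M : R, \forall x \ae mu, `|f x| <= M.
Proof.
move=> dm sf; have [M hM] := fpsum_bnd dm sf; exists M.
have lf := sobolev_L2 sf; have mf := L2_meas lf.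
pose e x := Num.max (`|f x| - M) 0.
have me : measurable_fun setT e.
  apply: measurable_maxr => //; apply: measurable_funB => //.
  exact: measurableT_comp.
have e0 x : 0 <= e x by rewrite /e le_max lexx orbT.
have ef n x : e x ^+ 2 <= (f x - fpsum n f x) ^+ 2.
  rewrite -[leRHS]real_normK ?num_real// lerXn2r ?nnegrE//.
  rewrite /e ge_max normr_ge0 andbT.
  have := hM n x; have := lerB_dist (f x) (fpsum n f x); lra.
have L2d n : L2 (fun x => f x - fpsum n f x) by apply: L2B => //; exact: L2_fpsum.
have le2 : L1 (fun x => e x ^+ 2).
  apply: (L1_le _ (L2_sqr (L2d 0%N))); first exact: measurable_funX.
  by move=> x; rewrite ger0_norm ?sqr_ge0.
have I0 : \int[mu]_x (e x ^+ 2) = 0.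
  apply/eqP; rewrite eq_le Rintegral_ge0 ?andbT; last by move=> x _; exact: sqr_ge0.
  apply: (cvgr_to_ge (fpsum_cvg lf)); apply: nearW => n.
  by apply: le_Int => //; [exact: L2_sqr|exact: aeW].
have : ae_eq mu setT (fun x => (e x ^+ 2)%:E) (cst 0%E).
  apply/ae_eq_integral_abs => //; first exact/measurable_EFinP/measurable_funX.
  under eq_integral do rewrite gee0_abs ?lee_fin ?sqr_ge0//.
  by rewrite EInt// I0.
apply: filterS => x /(_ Logic.I) [] /eqP; rewrite expf_eq0 /= => /eqP ex.
by rewrite -subr_le0 -ex /e le_max lexx.
Qed.

End sobolev_embedding.

(** * Weak convergence in L^p *)

Section Lp.
Context {R : realType} {d : nat}.
Local Notation V := 'rV[R]_d.
Local Notation mu := (@leb R d).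
Local Notation L1 f := (mu.-integrable setT (EFin \o f)).
Implicit Types (f g psi : V -> R) (p q : R).

Lemma measurable_normpowR f p : measurable_fun setT f ->
  measurable_fun setT (fun x => `|f x| `^ p).
Proof.
move=> mf; apply: (@measurableT_comp _ _ _ _ _ _ (@powR R ^~ p)) => //.
exact: measurableT_comp.
Qed.

Lemma LpP f p : 1 <= p -> f \in Lfun mu p%:E <->
  measurable_fun setT f /\ L1 (fun x => `|f x| `^ p).
Proof.
move=> p1; split=> [lf|[mf lf]].
  split; last exact: Lfun_integrable.
  by move: lf; rewrite inE => /andP[]; rewrite inE.
rewrite inE; apply/andP; split; rewrite inE//=.
rewrite /finite_norm unlock poweR_lty//.
move/integrable_lty : lf => /(_ measurableT); apply: le_lt_trans.
rewrite le_eqVlt; apply/orP; left; apply/eqP; apply: eq_integral => x _ /=.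
by [].
Qed.

Lemma inLpy_bnd f (M : R) : Defs.periodic f -> measurable_fun setT f ->
  (forall x, `|f x| <= M) -> inLp +oo%E f.
Proof.
move=> pf mf fM; split=> //; rewrite inE; apply/andP; split; rewrite inE//=.
rewrite /finite_norm unlock; case: ifPn => // _.
apply: (@le_lt_trans _ _ M%:E); last exact: ltry.
by apply: ess_sup_ler => x; rewrite lee_fin.
Qed.

Lemma truncated_L1 (f : V -> R) p (C : R) : 0 < p -> measurable_fun setT f ->
  (forall n : nat, \int[mu]_x (Num.min `|f x| n%:R `^ p) <= C) ->
  L1 (fun x => `|f x| `^ p).
Proof.
move=> p0 mf fC.
pose g n x : R := Num.min `|f x| n%:R `^ p.
have g0 n x : 0 <= g n x by exact: powR_ge0.
have min0 n x : 0 <= Num.min `|f x| n%:R :> R by rewrite le_min normr_ge0 ler0n.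
have mg n : measurable_fun setT (g n).
  apply: (@measurableT_comp _ _ _ _ _ _ (@powR R ^~ p)) => //.
  by apply: measurable_minr => //; exact: measurableT_comp.
have gn n x : `|g n x| <= n%:R `^ p.
  rewrite ger0_norm ?g0// ge0_ler_powR ?nnegrE ?ler0n ?(ltW p0)//.
  by rewrite ge_min lexx orbT.
have lg n : L1 (g n) by exact: L1_bnd (gn n).
have h := @cvg_monotone_convergence _ _ _ mu setT measurableT
  (fun n x => (g n x)%:E).
have {}h : (\int[mu]_x (g n x)%:E)%E @[n --> \oo] -->
    (\int[mu]_x limn (fun n => (g n x)%:E))%E.
  apply: h.
  - by move=> n; exact/measurable_EFinP.
  - by move=> n x _; rewrite lee_fin.
  - move=> x _ n n' nn'; rewrite lee_fin /g ge0_ler_powR ?nnegrE ?(ltW p0)//.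
    rewrite le_min ge_min lexx/= ge_min; apply/orP; right.
    by rewrite ler_nat.
apply/integrableP; split.
  by apply/measurable_EFinP; exact: measurable_normpowR mf.
have -> : (\int[mu]_x `|(EFin \o (fun x => (`|f x| `^ p)%R)) x| =
   \int[mu]_x limn (fun n => (g n x)%:E))%E.
  apply: eq_integral => x _ /=; apply/esym/cvg_lim => //.
  rewrite ger0_norm ?powR_ge0//; apply: cvg_near_cst.
  exists (Num.bound `|f x|) => // n /= nb; congr (_%:E).
  rewrite /g; congr (_ `^ _); apply/min_idPl.
  apply: (le_trans (ltW (unstable.ltr_bound _))).
  by rewrite ler_nat.
rewrite -(cvg_lim _ h)//; apply: (@le_lt_trans _ _ C%:E); last exact: ltry.
apply: lime_le; first by apply/cvg_ex; eexists; exact: h.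
by apply: nearW => n; rewrite EInt// lee_fin; exact: fC.
Qed.

Lemma Lp_Young p q f g (c : R) x : 0 < c -> 0 < p -> 0 < q -> p^-1 + q^-1 = 1 ->
  `|f x * g x| <= c `^ p / p * `|f x| `^ p + (c^-1) `^ q / q * `|g x| `^ q.
Proof.
move=> c0 p0 q0 pq; rewrite normrM.
have h := @conjugate_powR _ (c * `|f x|) (c^-1 * `|g x|) p q.
have ci : 0 <= c^-1 by rewrite invr_ge0 ltW.
have c0' := ltW c0.
have := h (mulr_ge0 c0' (normr_ge0 _)) (mulr_ge0 ci (normr_ge0 _)) p0 q0 pq.
rewrite mulrACA divff ?gt_eqF// mul1r !powRM//.
by rewrite [_ * _ / p]mulrAC [_ * _ / q]mulrAC.
Qed.

(** Test against the bounded [psi] = t^(p - 1), with t a truncation of m: Young's inequality bounds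
    the limit int m psi by C / p + (1 / q) int t^p, while int t^p <= int m psi. As 1 - 1 / q = 1 /
    p, absorption gives int t^p <= C at every truncation level. *)
Lemma weak_L1_Lp_limit p (m_ : nat -> V -> R) m (C : R) : 1 < p ->
  (\forall x \ae mu, 0 <= m x) ->
  weak_Lp 1%E m_ m -> (forall n, inLp p%:E (m_ n)) ->
  (forall n, \int[mu]_x (`|m_ n x| `^ p) <= C) -> inLp p%:E m.
Proof.
move=> p1 m0 [lm_ lm wm] lp_ mC; have p0 : 0 < p by lra.
have [pm /L1_meas mm] := (inLp1P _).1 lm.
split=> //; apply/LpP; [exact: ltW|split=> //].
apply: (@truncated_L1 m p C) => // n.
pose t x := Num.min `|m x| n%:R.
have t0 x : 0 <= t x by rewrite le_min normr_ge0 ler0n.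
have mt : measurable_fun setT t by apply: measurable_minr => //; exact: measurableT_comp.
have tn x : t x <= n%:R by rewrite ge_min lexx orbT.
pose psi x := t x `^ (p - 1).
have psin x : `|psi x| = t x `^ (p - 1) by rewrite ger0_norm ?powR_ge0.
have mpsi : measurable_fun setT psi.
  exact: (@measurableT_comp _ _ _ _ _ _ (@powR R ^~ (p-1))).
have psib x : `|psi x| <= n%:R `^ (p - 1).
  by rewrite psin ge0_ler_powR ?nnegrE ?ler0n// subr_ge0 ltW.
have ppsi : Defs.periodic psi by move=> x k; rewrite /psi /t pm.
have := wm psi; rewrite hoelder_conjugate1 => /(_ (inLpy_bnd ppsi mpsi psib)) cv.
pose q := p / (p - 1).
have q0 : 0 < q by rewrite divr_gt0// subr_gt0.
have pq : p^-1 + q^-1 = 1 by rewrite /q; field; rewrite !gt_eqF//; lra.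
have ltp : L1 (fun x => t x `^ p).
  apply: (@L1_bnd _ _ _ _ _ (n%:R `^ p)).
    exact: (@measurableT_comp _ _ _ _ _ _ (@powR R ^~ p)).
  by move=> x; rewrite ger0_norm ?powR_ge0// ge0_ler_powR ?nnegrE ?ler0n ?(ltW p0).
have psiq x : `|psi x| `^ q = t x `^ p.
  by rewrite psin -powRrM; congr (_ `^ _); rewrite /q; field; rewrite gt_eqF//; lra.
have lmpsi : L1 (fun x => m x * psi x).
  under eq_fun do rewrite mulrC.
  by have [_ l] := (inLp1P _).1 lm; exact: L1_bndM mpsi psib l.
have le1 : \int[mu]_x (m x * psi x) <= C / p + q^-1 * \int[mu]_x (t x `^ p).
  apply: (cvgr_to_le cv); apply: nearW => k.
  have [_ lk] := (inLp1P _).1 (lm_ k).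
  have [_ lpk] := (LpP _ (ltW p1)).1 (lp_ k).2.
  apply: (@le_trans _ _ (\int[mu]_x (p^-1 * `|m_ k x| `^ p + q^-1 * t x `^ p))).
    apply: le_Int.
    - by under eq_fun do rewrite mulrC; exact: L1_bndM mpsi psib lk.
    - by apply: L1D; exact: L1Z.
    - apply: aeW => x; have := @Lp_Young p q (m_ k) psi 1 x ltr01 p0 q0 pq.
      rewrite invr1 !powR1 !mul1r psiq => /(le_trans (ler_norm _)).
      by [].
  rewrite IntD; [|exact: L1Z|exact: L1Z]; rewrite !IntZ//.
  by rewrite lerD2r mulrC ler_wpM2r// invr_ge0 ltW.
have le2 : \int[mu]_x (t x `^ p) <= \int[mu]_x (m x * psi x).
  apply: le_Int => //; apply: filterS m0 => x mx.
  rewrite -mulr_powRB1// ler_wpM2r ?powR_ge0//.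
  by rewrite /t ger0_norm// ge_min lexx.
have qi : q^-1 = 1 - p^-1 by lra.
move: le1 le2; rewrite qi; set I := \int[mu]_x (t x `^ p) => le1 le2.
have : p^-1 * I <= p^-1 * C by lra.
by rewrite ler_pM2l// invr_gt0.
Qed.

(** Weak $L^1$ convergence allows only bounded tests. A test in $L^q$ is truncated, and its
    remainder pairs with all the [m_ n] uniformly little by Young's inequality and the common
    bound. *)
Lemma weak_L1_Lp p (m_ : nat -> V -> R) m (C : R) : 1 < p ->
  (\forall x \ae mu, 0 <= m x) ->
  weak_Lp 1%E m_ m -> (forall n, inLp p%:E (m_ n)) ->
  (forall n, \int[mu]_x (`|m_ n x| `^ p) <= C) -> weak_Lp p%:E m_ m.
Proof.
move=> p1 m0 w1 lp_ mC; have lpm := weak_L1_Lp_limit p1 m0 w1 lp_ mC.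
have [lm_ lm wm] := w1; split=> //.
have p0 : 0 < p by lra.
pose q := p / (p - 1).
have q0 : 0 < q by rewrite divr_gt0// subr_gt0.
have pq : p^-1 + q^-1 = 1 by rewrite /q; field; rewrite !gt_eqF//; lra.
have -> : hoelder_conjugate p%:E = q%:E.
  apply/esym/hoelder_conjugateP.
  - exact: ltNyr.
  - by rewrite eqe gt_eqF.
  - by rewrite !inver !gt_eqF// -EFinD pq.
have q1 : 1 <= q by rewrite /q ler_pdivlMr ?subr_gt0//; lra.
move=> psi [ppsi /(LpP _ q1)[mpsi lpsi]].
have C0 : 0 <= C.
  by apply: le_trans (mC 0%N); apply: Rintegral_ge0 => x _; exact: powR_ge0.
pose Ip := \int[mu]_x (`|m x| `^ p).
have Ip0 : 0 <= Ip by apply: Rintegral_ge0 => x _; exact: powR_ge0.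
pose psiM (M : nat) x := Num.max (- M%:R) (Num.min (psi x) M%:R).
have mpsiM M : measurable_fun setT (psiM M).
  by apply: measurable_maxr => //; exact: measurable_minr.
have psiMb M x : `|psiM M x| <= M%:R.
  rewrite ler_norml /psiM le_max lexx/= ge_max ge_min lexx orbT andbT.
  by rewrite -subr_ge0 opprK addr_ge0.
have psiMp M : Defs.periodic (psiM M) by move=> x k; rewrite /psiM ppsi.
have psiME M x : `|psi x| <= M%:R -> psiM M x = psi x.
  by rewrite ler_norml => /andP[h1 h2]; rewrite /psiM (min_idPl h2) (max_idPr h1).
have psiMle M x : `|psi x - psiM M x| <= `|psi x|.
  have [h|h] := leP `|psi x| M%:R; first by rewrite psiME// subrr normr0.
  have M0 : 0 <= M%:R :> R by [].
  rewrite /psiM; have [p0'|p0'] := leP 0 (psi x).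
    move: h; rewrite (ger0_norm p0') => h.
    rewrite (min_idPr (ltW h)) (max_idPr _); last by lra.
    by rewrite ger0_norm; lra.
  move: h; rewrite (ltr0_norm p0') => h.
  rewrite (min_idPl _) ?(max_idPl _); [|lra|lra].
  by rewrite ler0_norm; lra.
have dom M x : `|psi x - psiM M x| `^ q <= `|psi x| `^ q.
  by rewrite ge0_ler_powR ?nnegrE ?(ltW q0)//.
have mrest M : measurable_fun setT (fun x => `|psi x - psiM M x| `^ q).
  by apply: measurable_normpowR; exact: measurable_funB.
have lrest M : L1 (fun x => `|psi x - psiM M x| `^ q).
  by apply: (L1_le (mrest M) lpsi) => x; rewrite ger0_norm ?powR_ge0.
have rest : \int[mu]_x (`|psi x - psiM M x| `^ q) @[M --> \oo] --> (0 : R).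
  have [|||||_] := @DCT _ _ _ mu (fun M x => `|psi x - psiM M x| `^ q)
    (fun=> 0) (fun x => `|psi x| `^ q).
  - exact: mrest.
  - exact: measurable_cst.
  - apply: aeW => x; apply: cvg_near_cst; exists (Num.bound `|psi x|) => // M /= nb.
    rewrite psiME ?subrr ?normr0 ?powR0 ?gt_eqF//.
    by apply: (le_trans (ltW (unstable.ltr_bound _))); rewrite ler_nat.
  - exact: lpsi.
  - by apply: aeW => x M; rewrite ger0_norm ?powR_ge0.
  by rewrite Int_cst.
apply/cvgrPdist_le => e e0.
(* Bounds the p-th power integrals of all the [m_ n] and of the limit; [a] and [c] are then chosen
   to make the first Young term at most e / 8. *)
pose D := C + Ip + 1.
have D0 : 0 < D by rewrite /D; lra.
pose a := e * p / (8 * D).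
have a0 : 0 < a by rewrite divr_gt0 ?mulr_gt0.
pose c := a `^ p^-1.
have c0 : 0 < c by exact: powR_gt0.
have cp : c `^ p / p * D = e / 8.
  rewrite /c -powRrM mulVf ?gt_eqF// powRr1 ?(ltW a0)// /a; field.
  by rewrite !gt_eqF.
pose K := (c^-1) `^ q / q.
have K0 : 0 < K by rewrite divr_gt0// powR_gt0// invr_gt0.
have /cvgr0Pnorm_le/(_ _ (divr_gt0 e0 (mulr_gt0 (ltr0n _ 8) K0))) := rest.
move=> [M _ /(_ M (leqnn M))/= hM].
have {}hM : K * \int[mu]_x (`|psi x - psiM M x| `^ q) <= e / 8.
  move: hM; rewrite ger0_norm; last by apply: Rintegral_ge0 => x _; exact: powR_ge0.
  by rewrite invfM mulrA ler_pdivlMr// mulrC.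
have key f : inLp p%:E f -> \int[mu]_x (`|f x| `^ p) <= D ->
    L1 (fun x => f x * psi x) /\
    `|\int[mu]_x (f x * psi x) - \int[mu]_x (f x * psiM M x)| <= e / 4.
  move=> [_ /(LpP _ (ltW p1))[mf lfp]] fD.
  have lf : L1 (fun x => f x * psi x).
    apply: (@L1_le _ _ _ _ _ (fun x => 1 `^ p / p * `|f x| `^ p +
      1^-1 `^ q / q * `|psi x| `^ q)).
    - exact: measurable_funM.
    - by apply: L1D; exact: L1Z.
    - by move=> x; exact: Lp_Young.
  have lfM : L1 (fun x => f x * psiM M x).
    under eq_fun do rewrite mulrC.
    apply: (L1_bndM (mpsiM M) (psiMb M)).
    have lone : L1 (fun _ : V => 1 : R) by exact: L1_cst.
    apply: (@L1_le _ _ _ _ _ (fun x => 1 `^ p / p * `|f x| `^ p +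
      1^-1 `^ q / q * `|1| `^ q)) => //.
    - by apply: L1D; [exact: L1Z|exact: L1_cst].
    - by move=> x; have := @Lp_Young p q f (fun=> 1) 1 x ltr01 p0 q0 pq; rewrite mulr1.
  split=> //; rewrite -IntB//.
  have lfr : L1 (fun x => f x * psi x - f x * psiM M x) by exact: L1B.
  apply: (le_trans (le_normr_Rintegral measurableT lfr)).
  apply: (@le_trans _ _ (\int[mu]_x (c `^ p / p * `|f x| `^ p +
      K * `|psi x - psiM M x| `^ q))).
    apply: le_Int.
    - exact: integrable_norm.
    - by apply: L1D; exact: L1Z.
    - apply: aeW => x; rewrite -mulrBr.
      exact: (@Lp_Young p q f (fun x => psi x - psiM M x) c x c0 p0 q0 pq).
  rewrite IntD; [|exact: L1Z|exact: L1Z]; rewrite !IntZ//.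
  have : c `^ p / p * \int[mu]_x (`|f x| `^ p) <= e / 8.
    by rewrite -cp ler_wpM2l// divr_ge0 ?powR_ge0// ltW.
  lra.
have [|lmpsi hm] := key m lpm; first by rewrite /D -/Ip; lra.
have e4 : 0 < e / 4 by rewrite divr_gt0.
have := wm (psiM M); rewrite hoelder_conjugate1.
move=> /(_ (inLpy_bnd (psiMp M) (mpsiM M) (psiMb M)))/cvgrPdist_le/(_ _ e4).
apply: filterS => n hn.
have [|_ hmn] := key (m_ n) (lp_ n); first by have := mC n; rewrite /D; lra.
move: hm hn hmn; rewrite !ler_norml => /andP[? ?] /andP[? ?] /andP[? ?].
by apply/andP; split; lra.
Qed.

End Lp.

(** * Convex Hamiltonians *)

Section convex_slope.
Context {R : realType} {d : nat}.
Local Notation V := 'rV[R]_d.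

Lemma cvg_slope_seq (F : R -> R) (l : R) (u : nat -> R) :
  F t @[t --> 0^'] --> l -> (forall n, u n != 0) -> u n @[n --> \oo] --> (0 : R) ->
  F (u n) @[n --> \oo] --> l.
Proof.
move=> Fl u0 cu; apply: (cvg_comp u F _ Fl) => A A0.
have [N _ hN] := cu _ A0; exists N => // n Nn.
exact: hN n Nn (u0 n).
Qed.

Definition cvx (f : V -> R) := forall t x y, 0 <= t <= 1 ->
  f (t *: x + (1 - t) *: y) <= t * f x + (1 - t) * f y.

Lemma convex_functionP (f : V -> R) :
  convex_function [set: V] f -> cvx f.
Proof.
move=> cf t x y /andP[t0 t1].
have := cf (Itv01 t0 t1) x y; rewrite !inE => /(_ Logic.I Logic.I).
by [].
Qed.

(* Only directional derivatives are assumed; convexity makes them linear. *)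
Lemma cvx_grad (f : V -> R) (p w : V) : cvx f ->
  (forall v, exists l, t^-1 * (f (p + t *: v) - f p) @[t --> 0^'] --> (l : R)) ->
  f p + \sum_i w ord0 i * 'D_(ebase i) f p <= f (p + w).
Proof.
move=> cf /choice[D hD].
pose F v t := t^-1 * (f (p + t *: v) - f p).
have hu (c : R) : c != 0 -> (forall n, c * n.+1%:R^-1 != 0) /\
    c * n.+1%:R^-1 @[n --> \oo] --> (0 : R).
  move=> c0; split=> [n|]; first by rewrite mulf_neq0// invr_neq0// pnatr_eq0.
  rewrite -(mulr0 c); apply: cvgM; first exact: cvg_cst.
  exact: cvg_harmonic.
have hF v c : c != 0 -> F v (c * n.+1%:R^-1) @[n --> \oo] --> D v.
  by move=> c0; have [h1 h2] := hu c c0; exact: (cvg_slope_seq (hD v)).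
have n0 (n : nat) : (n.+1%:R^-1 : R) != 0 by rewrite invr_neq0// pnatr_eq0.
have np (n : nat) : 0 < (n.+1%:R^-1 : R) by rewrite invr_gt0.
have n1 (n : nat) : (n.+1%:R^-1 : R) <= 1 by rewrite invf_le1 ?ler1n.
have DZ (c : R) v : D (c *: v) = c * D v.
  have h1 := hF (c *: v) 1 (oner_neq0 _).
  have [->|c0] := eqVneq c 0.
    rewrite mul0r scale0r; apply: (cvg_unique _ (hF 0 1 (oner_neq0 _))) => //.
    apply: cvg_near_cst; apply: nearW => n.
    by rewrite /F scaler0 addr0 subrr mulr0.
  have h2 := hF v c c0.
  have h3 : c * F v (c * n.+1%:R^-1) @[n --> \oo] --> c * D v.
    by apply: cvgM; [exact: cvg_cst|exact: h2].
  apply: (cvg_unique _ h1) => //; apply: cvg_trans h3; apply: near_eq_cvg.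
  apply: nearW => n; rewrite /F /= scalerA mul1r [n.+1%:R^-1 * c]mulrC invfM.
  by rewrite !mulrA divff// mul1r.
(* The point p + t (v + v') is the midpoint of p + 2 t v and p + 2 t v'. Together with homogeneity
   under all real factors, negative ones included, subadditivity forces additivity. *)
have DD v v' : D (v + v') <= D v + D v'.
  have h1 := hF (v + v') 1 (oner_neq0 _).
  have two : (2 : R) != 0 by [].
  have h2 : F v (2 * n.+1%:R^-1) + F v' (2 * n.+1%:R^-1) @[n --> \oo] --> D v + D v'.
    by apply: cvgD; exact: hF.
  apply: (ler_cvg_to h1 h2); apply: nearW => n; rewrite /F mul1r /=.
  set t := n.+1%:R^-1; have t0 : 0 < t by exact: np.
  have := cf 2^-1 (p + (2 * t) *: v) (p + (2 * t) *: v').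
  have -> : 2^-1 *: (p + (2 * t) *: v) + (1 - 2^-1) *: (p + (2 * t) *: v') =
      p + t *: (v + v').
    rewrite !scalerDr !scalerA (_ : 1 - 2^-1 = 2^-1 :> R); last by field.
    rewrite mulrA mulVf// mul1r addrACA -scalerDl.
    by rewrite (_ : 2^-1 + 2^-1 = 1 :> R) ?scale1r//; field.
  move=> /(_ _) h; have {}h := h ltac:(lra).
  have -> : (2 * t)^-1 * (f (p + (2 * t) *: v) - f p) +
      (2 * t)^-1 * (f (p + (2 * t) *: v') - f p) =
    t^-1 * (2^-1 * f (p + (2 * t) *: v) + (1 - 2^-1) * f (p + (2 * t) *: v') - f p).
    by field; rewrite gt_eqF.
  by rewrite ler_pM2l ?invr_gt0// lerD2r.
have DN v : D (- v) = - D v by rewrite -scaleN1r DZ mulN1r.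
have DA v v' : D (v + v') = D v + D v'.
  apply/eqP; rewrite eq_le DD /= -lerBrDr -DN.
  by apply: le_trans (DD _ _); rewrite addrK.
have DE : D w = \sum_i w ord0 i * 'D_(ebase i) f p.
  rewrite {1}[w]row_sum_delta.
  have -> : D (\sum_j w ord0 j *: delta_mx 0 j) = \sum_j D (w ord0 j *: delta_mx 0 j).
    elim/big_ind2 : _ => //; last by move=> ? ? ? ? <- <-.
    by have := DZ 0 0; rewrite scale0r mul0r.
  apply: eq_bigr => i _; rewrite DZ; congr (_ * _).
  by apply/esym; exact: (partial_slope (hD (ebase i))).
(* By convexity, difference quotients along w with step at most 1 lie below f (p + w) - f p. *)
rewrite -DE -lerBrDl; apply: (cvgr_to_le (hF w 1 (oner_neq0 _))).
apply: nearW => n; rewrite /F mul1r; set t := n.+1%:R^-1.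
have t0 : 0 < t by exact: np.
have := cf t (p + w) p; rewrite ltW// n1 => /(_ isT).
have -> : t *: (p + w) + (1 - t) *: p = p + t *: w.
  by rewrite scalerDr addrAC -scalerDl [t + _]addrC subrK scale1r.
move=> h; rewrite mulrC ler_pdivrMr//; lra.
Qed.

End convex_slope.

(** * The Lagrangian at optimal momenta *)

Section lagrangian.
Context {R : realType} {d : nat}.
Local Notation V := 'rV[R]_d.
Context (E : set R) (H0 : V -> V -> R -> R -> R) (h : (V -> R) -> V -> R).

Context (H0_smooth : smooth_on [set z : V * V * R * R | E z.1.2]
  (fun z => H0 z.1.1.1 z.1.1.2 z.1.2 z.2)).
Context (H0_convex : forall x m th, E m ->
  convex_function [set: V] (fun p : V => H0 x p m th)).

(** The direction (0, v, 0, 0) leaves m fixed, so the whole line stays in the domain and the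
    derivative is two-sided even when m is a boundary point of [E]. *)
Lemma H0_slope x p m th v : E m -> exists l : R,
  t^-1 * (H0 x (p + t *: v) m th - H0 x p m th) @[t --> 0^'] --> l.
Proof.
move=> Em; have [F [F0 Fs]] := H0_smooth.
have [_ /(_ (0, v, 0, 0) (x, p, m, th) Em) hF] := Fs [::].
exists (F [:: (0, v, 0, 0)] (x, p, m, th)).
have e (t : R) : (x, p, m, th) + t *: ((0 : V, v, 0 : R, 0 : R)) =
    (x, p + t *: v, m, th) :> V * V * R * R.
  transitivity (x + t *: (0 : V), p + t *: v, m + t *: (0 : R), th + t *: (0 : R)) => //.
  by rewrite !scaler0 !addr0.
move=> A /hF [e0 e00 he]; exists e0 => // t te t0.
have := he t te t0; rewrite /= e !F0//=.
by apply; rewrite scaler0 addr0.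
Qed.

Lemma H0_tangent x p p' m th : E m ->
  dot p' (DpH0 H0 x p m th) - H0 x p' m th <=
  dot p (DpH0 H0 x p m th) - H0 x p m th.
Proof.
move=> Em; have := @cvx_grad _ _ (fun p => H0 x p m th) p (p' - p)
  (convex_functionP (H0_convex x th Em)) (fun v => H0_slope x p th v Em).
have -> : p + (p' - p) = p' by rewrite addrC subrK.
move=> hp.
have : dot p' (DpH0 H0 x p m th) - dot p (DpH0 H0 x p m th) =
  \sum_i (p' - p) ord0 i * 'D_(ebase i) (fun p0 : V => H0 x p0 m th) p.
  rewrite /dot -sumrB; apply: eq_bigr => i _.
  by rewrite !mxE mulrBl.
lra.
Qed.

(** Equality case of Fenchel's inequality: [H0_tangent] is the tangent inequality arranged so that
    [p] is seen to attain the supremum. *)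
Lemma L0_DpH0 x p m th : E m -> L0 H0 x (- DpH0 H0 x p m th) m th =
  (dot p (DpH0 H0 x p m th) - H0 x p m th)%:E.
Proof.
have dotN (v w : V) : - dot v (- w) = dot v w.
  by rewrite /dot -sumrN; apply: eq_bigr => i _; rewrite mxE mulrN opprK.
move=> Em; apply/le_anti/andP; split.
  apply: ub_ereal_sup => _ [p' _ <-]; rewrite lee_fin dotN.
  exact: H0_tangent.
by apply: ereal_sup_ubound; exists p => //; rewrite dotN.
Qed.

Lemma mL0_flux (m : V -> R) (P : V -> V) (x : V) : E (m x) -> 0 < m x ->
  mL0 H0 h m (fun y => - (m y *: DpH0 H0 y (P y) (m y) (h m y))) x =
  (m x * (dot (P x) (DpH0 H0 x (P x) (m x) (h m x)) - H0 x (P x) (m x) (h m x)))%:E.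
Proof.
move=> Em m0; rewrite /mL0 gt_eqF// scalerN scalerA mulVf ?gt_eqF// scale1r.
by rewrite L0_DpH0.
Qed.

Lemma mL0_fenchel (m : V -> R) (J : V -> V) (phi : V -> R) (x : V) :
  0 <= m x ->
  ((dot (J x) (grad phi x) - H0m H0 h phi m x)%:E <=
   mL0 H0 h m (fun y => (- J y)%R) x)%E.
Proof.
move=> m0; rewrite /mL0 /H0m; case: eqP => [_|/eqP mN0].
  (* Where m = 0 the conventions decide: both sides are 0 if J = 0, and the right one is infinite
     otherwise. *)
  rewrite subr0 oppr_eq0; case: eqP => [->|_]; last exact: leey.
  by rewrite /dot big1// => i _; rewrite mxE mul0r.
have mp : 0 < m x by rewrite lt_neqAle eq_sym mN0.
apply: (@le_trans _ _ ((m x)%:E *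
  ((- dot (grad phi x) ((m x)^-1 *: - J x) - H0 x (grad phi x) (m x) (h m x))%R)%:E)%E).
  rewrite -EFinM lee_fin le_eqVlt; apply/orP; left; apply/eqP.
  rewrite mulrBr [H0 _ _ _ _ * _]mulrC; congr (_ - _).
  rewrite /dot -sumrN mulr_sumr; apply: eq_bigr => i _; rewrite !mxE.
  by field.
by rewrite lee_pmul2l// ?lte_fin//; apply: ereal_sup_ubound; exists (grad phi x).
Qed.

End lagrangian.

(** * The regularized system *)

Section energy_identity.
Context {R : realType} {d : nat}.
Local Notation V := 'rV[R]_d.
Local Notation mu := (@leb R d).
Local Notation L1 f := (mu.-integrable setT (EFin \o f)).
Local Notation L2 f := (f \in Lfun mu 2%:E).
Implicit Types (m u f : V -> R).

Lemma cvg_Int_partials_fpsum s f u : L2 f -> is_wderiv s u (wD s u) ->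
  L2 (wD s u) ->
  \int[mu]_x (f x * partials s (fpsum n u) x) @[n --> \oo] -->
  \int[mu]_x (f x * wD s u x).
Proof.
move=> lf wu lw; under eq_cvg => n do rewrite (partials_fpsum n wu).
exact: Int_fpsum_cvg.
Qed.

(** Only the derivatives of [F] and [G] are moved onto [phi]; [I0] and [L] stand for the iterated
    and the plain Laplacian of [u], whose signs come from Fourier series. *)
Lemma Int_continuity_test (e1 e2 : R) m u I0 L phi (F : 'I_d -> V -> R)
    (G : 'I_d -> 'I_d -> V -> R) :
  L1 m -> L1 u -> L1 I0 -> L1 L ->
  (forall i, wderivable [:: i] (F i)) ->
  (forall i j, wderivable [:: j; i] (G i j)) ->
  (\forall x \ae mu,
     m x - \sum_i wD [:: i] (F i) x + \sum_i \sum_j wD [:: j; i] (G i j) x - 1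
     + e1 * (u x + I0 x) + e2 * (u x - L x) = 0) ->
  smooth phi ->
  \int[mu]_x (m x * phi x)
  + \sum_i \int[mu]_x (F i x * partials [:: i] phi x)
  + \sum_i \sum_j \int[mu]_x (G i j x * partials [:: j; i] phi x)
  - \int[mu]_x (1 * phi x)
  + e1 * (\int[mu]_x (u x * phi x) + \int[mu]_x (I0 x * phi x))
  + e2 * (\int[mu]_x (u x * phi x) - \int[mu]_x (L x * phi x)) = 0.
Proof.
move=> lm lu lI lL wF wG eqW sp.
have Lp f : L1 f -> L1 (fun x => f x * phi x) by move=> lf; exact: L1_smoothM.
have hF i : \int[mu]_x (F i x * partials [:: i] phi x) =
    - \int[mu]_x (wD [:: i] (F i) x * phi x).
  by have [_ _ ->//] := wderivP (wF i); rewrite expr1 mulN1r.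
have hG i j : \int[mu]_x (G i j x * partials [:: j; i] phi x) =
    \int[mu]_x (wD [:: j; i] (G i j) x * phi x).
  by have [_ _ ->//] := wderivP (wG i j); rewrite expr2 mulrNN !mul1r.
have lwF i : L1 (wD [:: i] (F i)) by have [_ /inLp1P[]] := wderivP (wF i).
have lwG i j : L1 (wD [:: j; i] (G i j)) by have [_ /inLp1P[]] := wderivP (wG i j).
have l1 := Lp _ (lm).
have l2 i := Lp _ (lwF i).
have l3 i j := Lp _ (lwG i j).
have l4 := Lp _ (L1_cst mu 1).
have l5 := Lp _ (lu).
have l6 := Lp _ (lI).
have l7 := Lp _ (lL).
have l2s := L1_sum (index_enum _) xpredT l2.
have l3s i := L1_sum (index_enum _) xpredT (l3 i).
have l3ss := L1_sum (index_enum _) xpredT l3s.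
have arith (X1 X2 X2' X3 X3' X4 X5 X6 : R) : X2 = - X2' -> X3 = X3' ->
    X1 - X2' + X3' - X4 + X5 + X6 = 0 -> X1 + X2 + X3 - X4 + X5 + X6 = 0.
  by move=> -> ->.
apply: (arith _ _ (\int[mu]_x \sum_i (wD [:: i] (F i) x * phi x)) _
  (\int[mu]_x \sum_i \sum_j (wD [:: j; i] (G i j) x * phi x))).
- by rewrite Int_sum// -sumrN; apply: eq_bigr => i _; exact: hF.
- rewrite Int_sum//; apply: eq_bigr => i _; rewrite Int_sum//.
  by apply: eq_bigr => j _; exact: hG.
have l12 := L1B l1 l2s; have l123 := L1D l12 l3ss; have l1234 := L1B l123 l4.
have l56 := L1D l5 l6; have l57 := L1B l5 l7.
have l56' := L1Z e1 l56; have l57' := L1Z e2 l57.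
have l16 := L1D l1234 l56'; have lall := L1D l16 l57'.
rewrite -(IntB l1 l2s) -(IntD l12 l3ss) -(IntB l123 l4) -(IntD l5 l6).
rewrite -(IntB l5 l7) -(IntZ e1 l56) -(IntZ e2 l57) -(IntD l1234 l56').
rewrite -(IntD l16 l57').
rewrite -[RHS](Int_cst mu 0); apply: ae_eq_Int => //.
  exact: L1_meas lall.
apply: filterS eqW => x /(congr1 (fun t => t * phi x)); rewrite mul0r => e0.
apply: etrans e0.
have -> : \sum_i \sum_j (wD [:: j; i] (G i j) x * phi x) =
    (\sum_i \sum_j wD [:: j; i] (G i j) x) * phi x.
  by rewrite mulr_suml; apply: eq_bigr => i _; rewrite mulr_suml.
rewrite -mulr_suml; ring.
Qed.

(** The derivatives of the fluxes are known only in $L^1$, so they are not paired with [u]: smooth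
    partial sums are inserted, and each term becomes an $L^2$ pairing that converges. *)
Lemma Int_continuity_eq (N : nat) (e1 e2 : R) m u (F : 'I_d -> V -> R)
    (G : 'I_d -> 'I_d -> V -> R) : (0 < N)%N ->
  L2 m -> sobolev (4 * N) 2%:E u ->
  (forall i, L2 (F i)) -> (forall i j, L2 (G i j)) ->
  (forall i, wderivable [:: i] (F i)) ->
  (forall i j, wderivable [:: j; i] (G i j)) ->
  (\forall x \ae mu,
     m x - \sum_i wD [:: i] (F i) x + \sum_i \sum_j wD [:: j; i] (G i j) x - 1
     + e1 * (u x + iter (2 * N) wlap u x) + e2 * (u x - wlap u x) = 0) ->
  \int[mu]_x (m x * u x) + \sum_i \int[mu]_x (F i x * wD [:: i] u x)
  + \sum_i \sum_j \int[mu]_x (G i j x * wD [:: j; i] u x) - \int[mu]_x u x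
  + e1 * (\int[mu]_x (u x * u x) + \int[mu]_x (iter (2 * N) wlap u x * u x))
  + e2 * (\int[mu]_x (u x * u x) - \int[mu]_x (wlap u x * u x)) = 0.
Proof.
move=> N0 lm su lF lG wF wG eqW.
have lu := sobolev_L2 su.
have lI : L2 (iter (2 * N) wlap u).
  apply: (@sobolev_L2 _ _ 0); apply: sobolev_iter_wlap.
  by rewrite addn0 mulnA.
have lL : L2 (wlap u).
  apply: (@sobolev_L2 _ _ 0); apply: sobolev_wlap.
  by apply: sobolevW su; lia.
have lwu s : (size s <= 4 * N)%N -> L2 (wD s u) by exact: sobolev_wD_L2 su.
have wu s : (size s <= 4 * N)%N -> is_wderiv s u (wD s u).
  by move=> sN; apply/wderivP; exact: sobolev_wderivable su _.
have key n :
  \int[mu]_x (m x * fpsum n u x)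
  + \sum_i \int[mu]_x (F i x * partials [:: i] (fpsum n u) x)
  + \sum_i \sum_j \int[mu]_x (G i j x * partials [:: j; i] (fpsum n u) x)
  - \int[mu]_x (1 * fpsum n u x)
  + e1 * (\int[mu]_x (u x * fpsum n u x) +
          \int[mu]_x (iter (2 * N) wlap u x * fpsum n u x))
  + e2 * (\int[mu]_x (u x * fpsum n u x) -
          \int[mu]_x (wlap u x * fpsum n u x)) = 0.
  by apply: Int_continuity_test => //; try exact: L2_L1; exact: smooth_comb.
have lim : (fun n : nat => 0 : R) @ \oo -->
  \int[mu]_x (m x * u x) + \sum_i \int[mu]_x (F i x * wD [:: i] u x)
  + \sum_i \sum_j \int[mu]_x (G i j x * wD [:: j; i] u x) - \int[mu]_x (1 * u x)
  + e1 * (\int[mu]_x (u x * u x) + \int[mu]_x (iter (2 * N) wlap u x * u x))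
  + e2 * (\int[mu]_x (u x * u x) - \int[mu]_x (wlap u x * u x)).
  under eq_cvg => n do rewrite -(key n).
  apply: cvgD; last first.
    apply: cvgM; first exact: cvg_cst.
    by apply: cvgB; exact: Int_fpsum_cvg.
  apply: cvgD; last first.
    apply: cvgM; first exact: cvg_cst.
    by apply: cvgD; exact: Int_fpsum_cvg.
  apply: cvgB; last by apply: Int_fpsum_cvg => //; exact: L2_cst.
  apply: cvgD; last first.
    apply: cvg_sumr => i; apply: cvg_sumr => j.
    by apply: cvg_Int_partials_fpsum => //; [apply: wu|apply: lwu]; rewrite /=; lia.
  apply: cvgD; first exact: Int_fpsum_cvg.
  apply: cvg_sumr => i.
  by apply: cvg_Int_partials_fpsum => //; [apply: wu|apply: lwu]; rewrite /=; lia.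
have := cvg_unique _ lim (cvg_cst _).
by under [X in _ - X]eq_Rintegral do rewrite mul1r; move=> ->.
Qed.

Lemma Int_continuity_le (N : nat) (e1 e2 : R) m u (F : 'I_d -> V -> R)
    (G : 'I_d -> 'I_d -> V -> R) : (0 < N)%N -> 0 < e1 -> 0 < e2 ->
  L2 m -> sobolev (4 * N) 2%:E u ->
  (forall i, L2 (F i)) -> (forall i j, L2 (G i j)) ->
  (forall i, wderivable [:: i] (F i)) ->
  (forall i j, wderivable [:: j; i] (G i j)) ->
  (\forall x \ae mu,
     m x - \sum_i wD [:: i] (F i) x + \sum_i \sum_j wD [:: j; i] (G i j) x - 1
     + e1 * (u x + iter (2 * N) wlap u x) + e2 * (u x - wlap u x) = 0) ->
  \int[mu]_x (m x * u x) + \sum_i \int[mu]_x (F i x * wD [:: i] u x)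
  + \sum_i \sum_j \int[mu]_x (G i j x * wD [:: j; i] u x) <= \int[mu]_x u x.
Proof.
move=> N0 e10 e20 lm su lF lG wF wG eqW.
have := Int_continuity_eq N0 lm su lF lG wF wG eqW.
have h1 : 0 <= \int[mu]_x (u x * u x).
  by apply: Rintegral_ge0 => // x _; rewrite -expr2 sqr_ge0.
have h2 : 0 <= \int[mu]_x (iter (2 * N) wlap u x * u x).
  by apply: Int_iter_wlap_ge0; rewrite !mulnA.
have h3 : \int[mu]_x (wlap u x * u x) <= 0.
  by apply: Int_wlap_le0; apply: sobolevW su; lia.
have h4 : 0 <= e1 * (\int[mu]_x (u x * u x) + \int[mu]_x (iter (2 * N) wlap u x * u x)).
  by rewrite mulr_ge0 ?addr_ge0// ltW.
have h5 : 0 <= e2 * (\int[mu]_x (u x * u x) - \int[mu]_x (wlap u x * u x)).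
  by rewrite mulr_ge0 ?subr_ge0 ?(le_trans h3)// ltW.
lra.
Qed.

End energy_identity.

(** * Composite terms of the system: derivatives, measurability, bounds *)

Section composition.
Context {R : realType} {d : nat}.
Local Notation V := 'rV[R]_d.
Local Notation mu := (@leb R d).
Local Notation L1 f := (mu.-integrable setT (EFin \o f)).
Local Notation L2 f := (f \in Lfun mu 2%:E).
Context (E : set R) (H : V -> V -> 'M[R]_d -> R -> R -> R).
Context (H0 : V -> V -> R -> R -> R) (a : V -> 'M[R]_d).

Lemma DpH_DpH0 i x p M m th :
  (forall x p M m th, E m ->
    H x p M m th = H0 x p m th - \sum_i \sum_j a x i j * M i j) ->
  E m -> DpH H i x p M m th = DpH0 H0 x p m th ord0 i.
Proof.
move=> hH Em; rewrite /DpH /DpH0 mxE /derive.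
apply: (congr1 (fun f => lim (f @ 0^'))); apply/funext => t /=; rewrite !hH//; congr (_ *: _).
by rewrite opprD addrACA subrr addr0.
Qed.

(** [H] is affine in M, so the difference quotient equals [- a x i j] for every nonzero t. *)
Lemma DMH_coef i j x p M m th :
  (forall x p M m th, E m ->
    H x p M m th = H0 x p m th - \sum_i \sum_j a x i j * M i j) ->
  E m -> DMH H i j x p M m th = - a x i j.
Proof.
move=> hH Em; rewrite /DMH /derive; apply: cvg_lim => //.
apply: cvg_near_cst; near=> t.
have t0 : t != 0 by near: t; exact: nbhs_dnbhs_neq.
rewrite /= !hH// opprD addrACA subrr add0r opprK.
have -> : \sum_i0 \sum_j0 a x i0 j0 * (t *: delta_mx i j + M) i0 j0 =
    t * a x i j + \sum_i \sum_j a x i j * M i j.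
  rewrite (bigD1 i)//= (bigD1 j)//= [in RHS](bigD1 i)//= [in RHS](bigD1 j)//=.
  rewrite !mxE !eqxx/= mulr1 mulrDr -!addrA [a x i j * t]mulrC; congr (_ + (_ + _)).
  congr (_ + _).
    by apply: eq_bigr => k kj; rewrite !mxE (negbTE kj) andbF mulr0 add0r.
  apply: eq_bigr => k ki; apply: eq_bigr => l _.
  by rewrite !mxE (negbTE ki) mulr0 add0r.
by rewrite opprD subrK scalerN /GRing.scale/= mulKf.
Unshelve. all: by end_near. Qed.

Lemma measurable_H0_comp (P : V -> V) (m th : V -> R) :
  (forall s, 0 < s -> E s) ->
  smooth_on [set z : V * V * R * R | E z.1.2]
    (fun z => H0 z.1.1.1 z.1.1.2 z.1.2 z.2) ->
  (forall i, measurable_fun setT (fun x => P x ord0 i)) ->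
  measurable_fun setT m -> (forall x, 0 < m x) -> measurable_fun setT th ->
  measurable_fun setT (fun x => H0 x (P x) (m x) (th x)).
Proof.
move=> E0 [F [F0 Fs]] mP mm m0 mth; have [cF _] := Fs [::].
have -> : (fun x => H0 x (P x) (m x) (th x)) =
    fun x => F [::] (x, P x, m x, th x).
  by apply/funext => x; rewrite F0//=; exact: E0 (m0 x).
apply: (measurable_stepapprox cF (Z := fun x => (x, P x, m x, th x))).
  by move=> x /=; exact: E0 (m0 x).
apply: (@stepapprox_sub _ _ _ (((setT `*` setT) `*` E) `*` setT)).
  by move=> z [[]].
apply: stepapprox_pair; last exact: stepapprox_real.
apply: stepapprox_pair; last first.
  by apply: stepapprox_gt => // x s xs; apply: E0; exact: lt_trans xs.
apply: stepapprox_pair; apply: stepapprox_row => i; apply: stepapprox_real => //.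
exact: measurable_rV_coord.
Qed.

Lemma measurable_coupling_comp (g : V -> R -> R -> R) (m th : V -> R) :
  (forall s, 0 < s -> E s) ->
  {within [set z : V * R * R | E z.1.2],
    continuous (fun z => g z.1.1 z.1.2 z.2)} ->
  measurable_fun setT m -> (forall x, 0 < m x) -> measurable_fun setT th ->
  measurable_fun setT (fun x => g x (m x) (th x)).
Proof.
move=> E0 cg mm m0 mth.
apply: (measurable_stepapprox cg (Z := fun x => (x, m x, th x))).
  by move=> x /=; exact: E0 (m0 x).
apply: (@stepapprox_sub _ _ _ ((setT `*` E) `*` setT)).
  by move=> z [[]].
apply: stepapprox_pair; last exact: stepapprox_real.
apply: stepapprox_pair; last first.
  by apply: stepapprox_gt => // x s xs; apply: E0; exact: lt_trans xs.
apply: stepapprox_row => i; apply: stepapprox_real.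
exact: measurable_rV_coord.
Qed.

Lemma measurable_smooth_on_comp (D : set R) (b : R -> R) (m : V -> R) :
  (forall s, 0 < s -> D s) -> smooth_on D b -> measurable_fun setT m ->
  (forall x, 0 < m x) -> measurable_fun setT (fun x => b (m x)).
Proof.
move=> D0 [F [F0 Fs]] mm m0; have [cF _] := Fs [::].
have -> : (fun x => b (m x)) = fun x => F [::] (m x).
  by apply/funext => x; rewrite F0//; exact: D0.
apply: (measurable_stepapprox cF (Z := m)); first by move=> x; exact: D0.
by apply: stepapprox_gt => // x s xs; apply: D0; exact: lt_trans xs.
Qed.

Lemma L2_ae_bnd (f : V -> R) (M : R) : measurable_fun setT f ->
  (\forall x \ae mu, `|f x| <= M) -> L2 f.
Proof.
move=> mf fM.
have mg : measurable_fun setT (fun x => Num.max (- `|M|) (Num.min (f x) `|M|)).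
  apply: measurable_maxr; first exact: measurable_cst.
  by apply: measurable_minr => //; exact: measurable_cst.
apply: (@ae_eq_L2 _ _ _ mu (fun x => Num.max (- `|M|) (Num.min (f x) `|M|))) => //.
  apply: filterS fM => x fx; have : `|f x| <= `|M| by rewrite (le_trans fx)// ler_norm.
  by rewrite ler_norml => /andP[h1 h2]; rewrite (min_idPl h2) (max_idPr h1).
apply: (@L2_bnd _ _ _ mu _ `|M|) => // x.
have M0 := normr_ge0 M.
rewrite ler_norml le_max lexx/= ge_max ge_min lexx orbT andbT; lra.
Qed.

Lemma le_enorm (v : V) i : `|v ord0 i| <= enorm v.
Proof.
rewrite /enorm -(sqrtr_sqr (v ord0 i)) ler_sqrt.
  rewrite /dot (bigD1 i)//= -expr2 lerDl; apply: sumr_ge0 => j _.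
  by rewrite -expr2 sqr_ge0.
by apply: sumr_ge0 => j _; rewrite -expr2 sqr_ge0.
Qed.

Lemma enorm_le (v : V) (M : R) : (forall i, `|v ord0 i| <= M) ->
  enorm v <= Num.sqrt (d%:R * M ^+ 2).
Proof.
move=> vM; rewrite /enorm ler_wsqrtr//.
rewrite -{2}[d]card_ord -sum1_card natr_sum mulr_suml.
apply: ler_sum => i _; rewrite mul1r -expr2 -real_normK ?num_real//.
by rewrite lerXn2r ?nnegrE// (le_trans _ (vM i)).
Qed.

End composition.

(** The hypothesis amounts to d + 10 < 4 N. The second and third bounds feed [sobolev_bounded] for m
    and for Du; the fourth leaves enough orders of regularity after one derivative. *)
Lemma large_exponent (R : realType) (d N : nat) :
  d%:R / 2 + 1 < 2 * N%:R - 4 :> R ->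
  [/\ (0 < N)%N, (d <= 2 * (2 * N))%N, (d <= 2 * (2 * N).-1)%N,
      (1 + 2 * (2 * N).-1 <= 4 * N)%N & (2 <= 4 * N)%N].
Proof.
move=> hN; have : (d + 10 < 4 * N)%N.
  by rewrite -(ltr_nat R) natrD natrM; move: hN; lra.
by move=> ?; split; lia.
Qed.

(** * Energy estimate for a single regularized solution *)

Section regularized_solution.
Context {R : realType} {d : nat}.
Local Notation V := 'rV[R]_d.
Local Notation mu := (@leb R d).
Local Notation L1 f := (mu.-integrable setT (EFin \o f)).
Local Notation L2 f := (f \in Lfun mu 2%:E).
Context (E : set R) (H : V -> V -> 'M[R]_d -> R -> R -> R).
Context (h : (V -> R) -> V -> R) (H0 : V -> V -> R -> R -> R) (a : V -> 'M[R]_d).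
Context (gamma C5 q0 : R) (beta : R -> R -> R) (N : nat).
Context (E0 : forall s, 0 < s -> E s) (h_op : operator_Mac_C h).
Context (H0_smooth : smooth_on [set z : V * V * R * R | E z.1.2]
  (fun z => H0 z.1.1.1 z.1.1.2 z.1.2 z.2)).
Context (a_smooth : forall i j, smooth (fun x => a x i j)).
Context (HE : forall x p M m th, E m ->
  H x p M m th = H0 x p m th - \sum_i \sum_j a x i j * M i j).
Context (gamma1 : 1 < gamma) (C5_gt0 : 0 < C5).
Context (DpH0_le : forall x p m th, E m ->
  enorm (DpH0 H0 x p m th) <= C5 * (1 + enorm p `^ (gamma - 1))).
Context (hbeta : penalization (d := d) q0 beta).
Context (hN : d%:R / 2 + 1 < 2 * N%:R - 4 :> R).
Context (e1 e2 : R) (e1_01 : 0 < e1 < 1) (e2_01 : 0 < e2 < 1).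
Context (m u : V -> R) (dom : reg_domain N m u)
  (sol : reg_solution H h beta N e1 e2 m u).

Let N_gt0 : (0 < N)%N. Proof. by have [] := large_exponent hN. Qed.
Let N1 : (1 <= 4 * N)%N. Proof. by rewrite muln_gt0. Qed.
Let N2 : (2 <= 4 * N)%N. Proof. by have [] := large_exponent hN. Qed.
Let N4 : (2 * (2 * N))%N = (4 * N)%N. Proof. by rewrite mulnA. Qed.

Let m_gt0 x : 0 < m x.
Proof. by have [_ _ [c c0 cm]] := dom; exact: lt_le_trans (cm x). Qed.

Let mE x : E (m x). Proof. exact: E0. Qed.

Let L2m : L2 m. Proof. by have [/sobolev_L2] := dom. Qed.
Let L2u : L2 u. Proof. by have [_ /sobolev_L2] := dom. Qed.

Lemma reg_Mac : MacE E m.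
Proof.
split; last exact: aeW.
split; last by apply: aeW => x; exact: ltW.
by apply: inLp2_L1; have [[]] := dom.
Qed.

Let mth : measurable_fun setT (h m).
Proof.
have [_ ch] := h_op.1 _ reg_Mac.1.
exact: measurable_continuous_rV.
Qed.

Let L2wu s : (size s <= 4 * N)%N -> L2 (wD s u).
Proof. by have [_ su _] := dom; exact: sobolev_wD_L2. Qed.

Let F i x := m x * along (DpH H i) (wgrad u) (whess u) m (h m) x.
Let G i j x := m x * along (DMH H i j) (wgrad u) (whess u) m (h m) x.
Let K := along H (wgrad u) (whess u) m (h m).

Let FE i x : F i x = m x * DpH0 H0 x (wgrad u x) (m x) (h m x) ord0 i.
Proof. by rewrite /F /along (DpH_DpH0 _ _ _ _ _ HE). Qed.

Let GE i j x : G i j x = - a x i j * m x.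
Proof. by rewrite /G /along (DMH_coef _ _ _ _ _ _ HE)// mulrC. Qed.

Let KE x : K x = H0 x (wgrad u x) (m x) (h m x)
  - \sum_i \sum_j a x i j * wD [:: j; i] u x.
Proof.
rewrite /K /along HE//; congr (_ - _); apply: eq_bigr => i _.
by apply: eq_bigr => j _; rewrite mxE.
Qed.

(** [m] and [Du] are bounded by Sobolev embedding, and the growth of [DpH0] then bounds the flux.
    Its measurability is read off the existence of its weak derivative. *)
Lemma reg_flux_L2 i : L2 (F i).
Proof.
have [wF _ _ _] := sol.
have [/inLp1P[_ /L1_meas mF] _ _] := wderivP (wF i).
have [sm su _] := dom.
have [M0 hM0] : exists M : R, \forall x \ae mu, `|m x| <= M.
  by apply: (@sobolev_bounded _ _ (2 * N)); [have [] := large_exponent hN|rewrite N4].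
have /choice[Mu hMu] k : exists M : R, \forall x \ae mu, `|wD [:: k] u x| <= M.
  have [_ _ d1 d2 _] := large_exponent hN.
  by apply: (@sobolev_bounded _ _ (2 * N).-1) => //; apply: sobolev_wD; apply: sobolevW su.
pose B := \sum_k `|Mu k|.
have hB : \forall x \ae mu, forall k, `|wD [:: k] u x| <= B.
  apply: filter_forall => k; apply: filterS (hMu k) => x /le_trans; apply.
  by rewrite (le_trans (ler_norm _))// /B (bigD1 k)//= lerDl sumr_ge0.
apply: (@L2_ae_bnd _ _ _ (M0 * (C5 * (1 + Num.sqrt (d%:R * B ^+ 2) `^ (gamma - 1))))) => //.
apply: filterS2 hM0 hB => x hm hu; rewrite FE normrM.
apply: ler_pM => //; apply: le_trans (le_enorm _ _) _.
apply: le_trans (DpH0_le _ _ _ (mE x)) _.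
rewrite ler_pM2l// lerD2l; apply: ge0_ler_powR; rewrite ?nnegrE ?sqrtr_ge0//.
  by rewrite subr_ge0 ltW.
by apply: enorm_le => k; rewrite mxE.
Qed.

Lemma reg_diffusion_L2 i j : L2 (G i j).
Proof.
have [M hM] := smooth_bnd (a_smooth i j).
have -> : G i j = fun x => - a x i j * m x by apply/funext => x; exact: GE.
apply: (@L2_bndM _ _ _ _ _ _ M) => // [|x]; last by rewrite normrN.
by apply: measurableT_comp => //; exact: measurable_smooth.
Qed.

(** As m >= c > 0 and [beta e1] is nondecreasing and nonpositive, its values lie between [beta e1 c]
    and 0. *)
Lemma reg_penalty_bnd :
  measurable_fun setT (fun x => beta e1 (m x)) /\
  exists M : R, forall x, `|beta e1 (m x)| <= M.
Proof.
have [_ /(_ _ e1_01)[sb nb b0 _ _]] := hbeta; split.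
  by apply: (@measurable_smooth_on_comp _ _ [set s | 0 < s] (beta e1) m) => //; exact: L2_meas L2m.
have [_ _ [c c0 cm]] := dom; exists (- beta e1 c) => x.
by rewrite ler0_norm ?b0// lerN2 nb.
Qed.

Let L2beta : L2 (fun x => beta e1 (m x)).
Proof. by have [mB [M hM]] := reg_penalty_bnd; exact: L2_bnd hM. Qed.

Let L2I f : sobolev (4 * N) 2%:E f -> L2 (iter (2 * N) wlap f).
Proof.
move=> sf; apply: (@sobolev_L2 _ _ 0); apply: sobolev_iter_wlap.
by rewrite addn0 N4.
Qed.

Let L2lap f : sobolev (4 * N) 2%:E f -> L2 (wlap f).
Proof.
move=> sf; apply: (@sobolev_L2 _ _ 0); apply: sobolev_wlap.
exact: sobolevW sf.
Qed.

Let Keq : \forall x \ae mu, - u x + e1 * (m x + iter (2 * N) wlap m x)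
  + e2 * (m x - wlap m x) + beta e1 (m x) = K x.
Proof.
by have [_ _ eq1 _] := sol; apply: filterS eq1 => x /=; rewrite -/(K x); lra.
Qed.

(** Solved for the Hamiltonian, the first equation expresses [K] by terms in $L^2$; the structure of
    [H] supplies the measurability. *)
Lemma reg_hamiltonian_L2 : L2 K.
Proof.
have [sm su _] := dom.
have mK : measurable_fun setT K.
  have -> : K = fun x => H0 x (wgrad u x) (m x) (h m x)
      - \sum_i \sum_j a x i j * wD [:: j; i] u x.
    by apply/funext => x; exact: KE.
  apply: measurable_funB.
    apply: (@measurable_H0_comp _ _ E H0 (wgrad u) m (h m) E0) => //; last exact: L2_meas L2m.
    move=> i; under eq_fun do rewrite mxE.
    by apply: L2_meas; exact: L2wu.
  apply: measurable_sum => i; apply: measurable_sum => j.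
  apply: measurable_funM; first exact: measurable_smooth.
  by apply: L2_meas; exact: L2wu.
apply: (ae_eq_L2 mK Keq).
apply: L2D => //; apply: L2D; last by apply: L2Z; apply: L2B => //; exact: L2lap.
apply: L2D; first exact: L2N.
by apply: L2Z; apply: L2D => //; exact: L2I.
Qed.

Let Phi x := m x * (dot (wgrad u x) (DpH0 H0 x (wgrad u x) (m x) (h m x))
  - H0 x (wgrad u x) (m x) (h m x)).

(** The diffusion enters H and D_MH : M through the same linear term and cancels, so [Phi] is m (- H
    + D_pH . Du + D_MH : D^2u), the quantity in the pointwise growth condition. *)
Let PhiE x : Phi x = - (m x * K x) + \sum_i F i x * wD [:: i] u x
  + \sum_i \sum_j G i j x * wD [:: j; i] u x.
Proof.
rewrite /Phi KE mulrBr mulrBr /dot.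
have -> : \sum_i F i x * wD [:: i] u x = m x * \sum_i wgrad u x ord0 i *
    DpH0 H0 x (wgrad u x) (m x) (h m x) ord0 i.
  rewrite mulr_sumr; apply: eq_bigr => i _; rewrite FE [wgrad u x ord0 i]mxE; ring.
have -> : \sum_i \sum_j G i j x * wD [:: j; i] u x =
    - (m x * \sum_i \sum_j a x i j * wD [:: j; i] u x).
  rewrite mulr_sumr -sumrN; apply: eq_bigr => i _.
  by rewrite mulr_sumr -sumrN; apply: eq_bigr => j _; rewrite GE; ring.
ring.
Qed.

Let L1mK : L1 (fun x => m x * K x).
Proof. by apply: L2M_L1 => //; exact: reg_hamiltonian_L2. Qed.

Let L1Fu i : L1 (fun x => F i x * wD [:: i] u x).
Proof. by apply: L2M_L1; [exact: reg_flux_L2|exact: L2wu]. Qed.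

Let L1Gu i j : L1 (fun x => G i j x * wD [:: j; i] u x).
Proof. by apply: L2M_L1; [exact: reg_diffusion_L2|exact: L2wu]. Qed.

Let L1Gus i : L1 (fun x => \sum_j G i j x * wD [:: j; i] u x).
Proof. exact: L1_sum. Qed.

Let L1Gu2 : L1 (fun x => \sum_i \sum_j G i j x * wD [:: j; i] u x).
Proof. exact: L1_sum. Qed.

Let L1Fu1 : L1 (fun x => \sum_i F i x * wD [:: i] u x).
Proof. exact: L1_sum. Qed.

Lemma reg_energy_L1 : L1 Phi.
Proof.
have -> : Phi = fun x => - (m x * K x) + \sum_i F i x * wD [:: i] u x
  + \sum_i \sum_j G i j x * wD [:: j; i] u x by apply/funext => x; exact: PhiE.
by apply: L1D => //; apply: L1D => //; exact: L1N.
Qed.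

(** The two terms int m u, one from testing an equation with [u] and one from testing the other with
    [m], cancel. *)
Lemma reg_energy_le :
  \int[mu]_x Phi x <= \int[mu]_x u x - \int[mu]_x (m x * beta e1 (m x)).
Proof.
have [sm su _] := dom; have /andP[e10 _] := e1_01; have /andP[e20 _] := e2_01.
have [wF wG _ eq2] := sol.
have h1 : \int[mu]_x Phi x = - (\int[mu]_x (m x * K x))
   + \sum_i \int[mu]_x (F i x * wD [:: i] u x)
   + \sum_i \sum_j \int[mu]_x (G i j x * wD [:: j; i] u x).
  under eq_Rintegral do rewrite PhiE.
  rewrite IntD//; last by apply: L1D => //; exact: L1N.
  rewrite IntD//; last exact: L1N.
  rewrite IntN// !Int_sum//; congr (_ + _); apply: eq_bigr => i _.
  by rewrite Int_sum.
have h2 : \int[mu]_x (m x * u x) + \sum_i \int[mu]_x (F i x * wD [:: i] u x)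
    + \sum_i \sum_j \int[mu]_x (G i j x * wD [:: j; i] u x) <= \int[mu]_x u x.
  apply: (@Int_continuity_le _ _ N e1 e2) => //.
  - exact: reg_flux_L2.
  - exact: reg_diffusion_L2.
have lI := L2I sm; have lL := L2lap sm.
have l1 := L2M_L1 L2m L2u; have l2 := L2M_L1 L2m L2m.
have l3 := L2M_L1 lI L2m; have l4 := L2M_L1 lL L2m.
have l5 := L2M_L1 L2m L2beta.
have l23 := L1D l2 l3; have l24 := L1B l2 l4.
have l23' := L1Z e1 l23; have l24' := L1Z e2 l24.
have l1' := L1N l1.
have l13 := L1D l1' l23'; have l14 := L1D l13 l24'; have l15 := L1D l14 l5.
have h3 : \int[mu]_x (m x * K x) = - (\int[mu]_x (m x * u x))
   + e1 * (\int[mu]_x (m x * m x) + \int[mu]_x (iter (2 * N) wlap m x * m x))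
   + e2 * (\int[mu]_x (m x * m x) - \int[mu]_x (wlap m x * m x))
   + \int[mu]_x (m x * beta e1 (m x)).
  rewrite -(IntN l1) -(IntD l2 l3) -(IntB l2 l4) -(IntZ e1 l23) -(IntZ e2 l24).
  rewrite -(IntD l1' l23') -(IntD l13 l24') -(IntD l14 l5).
  apply/esym/ae_eq_Int; [exact: L1_meas l15|exact: L1_meas L1mK|].
  by apply: filterS Keq => x <-; ring.
have p1 : 0 <= \int[mu]_x (m x * m x).
  by apply: Rintegral_ge0 => // x _; rewrite -expr2 sqr_ge0.
have p2 : 0 <= \int[mu]_x (iter (2 * N) wlap m x * m x).
  by apply: Int_iter_wlap_ge0; rewrite N4.
have p3 : \int[mu]_x (wlap m x * m x) <= 0.
  by apply: Int_wlap_le0; exact: sobolevW sm.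
have p4 : 0 <= e1 * (\int[mu]_x (m x * m x) + \int[mu]_x (iter (2 * N) wlap m x * m x)).
  by rewrite mulr_ge0 ?addr_ge0// ltW.
have p5 : 0 <= e2 * (\int[mu]_x (m x * m x) - \int[mu]_x (wlap m x * m x)).
  by rewrite mulr_ge0 ?subr_ge0 ?(le_trans p3)// ltW.
lra.
Qed.

Lemma reg_hamiltonian_Int : \int[mu]_x K x =
  - (\int[mu]_x u x) + (e1 + e2) * \int[mu]_x m x + \int[mu]_x beta e1 (m x).
Proof.
have [sm su _] := dom.
have lI := L2I sm; have lL := L2lap sm.
have i0 : \int[mu]_x iter (2 * N) wlap m x = 0.
  by apply: Int_iter_wlap0; rewrite ?N4// muln_gt0.
have i1 : \int[mu]_x wlap m x = 0.
  by apply: (@Int_iter_wlap0 _ _ 1) => //; exact: sobolevW sm.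
have l1 := L1N (L2_L1 L2u); have l2 := L2_L1 L2m; have l3 := L2_L1 lI.
have l4 := L2_L1 lL; have l5 := L2_L1 L2beta.
have l23 := L1D l2 l3; have l24 := L1B l2 l4.
have l23' := L1Z e1 l23; have l24' := L1Z e2 l24.
have l13 := L1D l1 l23'; have l14 := L1D l13 l24'; have l15 := L1D l14 l5.
have -> : - (\int[mu]_x u x) + (e1 + e2) * \int[mu]_x m x + \int[mu]_x beta e1 (m x)
  = - (\int[mu]_x u x) + e1 * (\int[mu]_x m x + \int[mu]_x iter (2 * N) wlap m x)
   + e2 * (\int[mu]_x m x - \int[mu]_x wlap m x) + \int[mu]_x beta e1 (m x).
  by rewrite i0 i1; ring.
rewrite -(IntN (L2_L1 L2u)) -(IntD l2 l3) -(IntB l2 l4) -(IntZ e1 l23) -(IntZ e2 l24).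
rewrite -(IntD l1 l23') -(IntD l13 l24') -(IntD l14 l5).
apply/esym/ae_eq_Int; [exact: L1_meas l15|exact: L2_meas reg_hamiltonian_L2|].
exact: Keq.
Qed.

(** Adding the equation tested with 1 cancels int u: the right side involves only the parameters and
    the mass of [m], and the penalty appears in the nonnegative form (m - 1) beta. *)
Lemma reg_energy_sum_le :
  \int[mu]_x Phi x + \int[mu]_x K x
  + \int[mu]_x ((m x - 1) * beta e1 (m x)) <= (e1 + e2) * \int[mu]_x m x.
Proof.
have l5 := L2M_L1 L2m L2beta.
have := reg_energy_le; have := reg_hamiltonian_Int.
under [X in _ + X <= _]eq_Rintegral do rewrite mulrBl mul1r.
rewrite (IntB l5 (L2_L1 L2beta)); lra.
Qed.

End regularized_solution.

Section integrability.
Context d (T : measurableType d) (R : realType) (mu : probability T R).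
Local Notation L1 f := (mu.-integrable setT (EFin \o f)).

Lemma L1_le_ae (f g : T -> R) : measurable_fun setT f -> L1 g ->
  (\forall x \ae mu, `|f x| <= g x) -> L1 f.
Proof.
move=> mf lg fg; have mg := L1_meas lg.
pose f' x := Num.max (- `|g x|) (Num.min (f x) `|g x|).
have mg' : measurable_fun setT (fun x => `|g x|) by exact: measurableT_comp.
have mf' : measurable_fun setT f'.
  apply: measurable_maxr; first by apply: measurableT_comp.
  exact: measurable_minr.
apply: (@ae_eq_L1 _ _ _ mu f') => //.
  apply: filterS fg => x fx; have : `|f x| <= `|g x| by rewrite (le_trans fx)// ler_norm.
  by rewrite ler_norml => /andP[h1 h2]; rewrite /f' (min_idPl h2) (max_idPr h1).
apply: (L1_le mf' (integrable_norm lg)) => x.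
have := normr_ge0 (g x); rewrite /= /f' ler_norml le_max lexx/=.
by rewrite ge_max ge_min lexx orbT andbT => ?; lra.
Qed.

Lemma L1_ge0_lty (f : T -> R) : measurable_fun setT f ->
  (\forall x \ae mu, 0 <= f x) -> (\int[mu]_x (f x)%:E < +oo)%E -> L1 f.
Proof.
move=> mf f0 fy; apply/integrableP; split; first exact/measurable_EFinP.
rewrite (_ : \int[mu]_x _ = \int[mu]_x (f x)%:E)%E//.
apply: ae_eq_integral => //.
- by apply: measurableT_comp => //; exact/measurable_EFinP.
- exact/measurable_EFinP.
- by apply: filterS f0 => x fx _ /=; rewrite ger0_norm.
Qed.

End integrability.

(** The arithmetic core of the estimates, used with X = int m, Z = int m g_1, Y = int (m - 1) beta,
    and P, K, G1, G2 the integrals of [Phi], of the Hamiltonian, of g_1 and of g_2. The coefficient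
    C2 / (2 C3) lets half of C2 Z absorb the contribution of C3 G1. *)
Lemma coercive_bound (R : realFieldType) (C1 C2 C3 c Cd r M e X Z Y G1 G2 P K : R) :
  0 < C1 -> 0 < C2 -> 0 < C3 -> 0 < c -> e <= 2 -> 0 <= X <= M ->
  C2 * Z - C1 * X <= P -> - C3 * (G1 + G2) - C1 <= K -> P + K + Y <= e * X ->
  G1 <= C2 / (2 * C3) * Z + Cd -> G2 <= c * (1 + X) -> - r <= Z -> 0 <= Y ->
  let Q := (2 + C1 + C3 * c) * M + C3 * Cd + C3 * c + C1 in
  Z <= 2 / C2 * Q /\ Y <= Q + C2 / 2 * r.
Proof.
move=> C10 C20 C30 c0 e2 /andP[X0 XM] hP hK hY hG1 hG2 rZ Y0 Q.
have eX : e * X <= 2 * X by exact: ler_wpM2r.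
have hc : C3 * (c * (1 + X)) <= C3 * c + C3 * c * M.
  rewrite mulrDr mulr1 mulrDr lerD2l mulrA; apply: ler_wpM2l => //.
  by apply: mulr_ge0; exact: ltW.
have hc3 : C3 * G2 <= C3 * (c * (1 + X)) by rewrite ler_pM2l.
have hd : C3 * G1 <= C2 / 2 * Z + C3 * Cd.
  have -> : C2 / 2 * Z + C3 * Cd = C3 * (C2 / (2 * C3) * Z + Cd).
    by field; rewrite gt_eqF.
  by rewrite ler_pM2l.
have hX : (2 + C1) * X <= (2 + C1) * M by rewrite ler_pM2l// addr_gt0.
have main : C2 / 2 * Z + Y <= Q by rewrite /Q; lra.
have hr : C2 / 2 * - r <= C2 / 2 * Z by rewrite ler_pM2l// divr_gt0.
split; last lra.
by rewrite mulrAC ler_pdivlMr//; lra.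
Qed.

(** * Bounds uniform in the regularization parameters *)

Section uniform_estimates.
Context {R : realType} {d : nat}.
Local Notation V := 'rV[R]_d.
Local Notation mu := (@leb R d).
Local Notation L1 f := (mu.-integrable setT (EFin \o f)).
Local Notation L2 f := (f \in Lfun mu 2%:E).
Context (E : set R) (H : V -> V -> 'M[R]_d -> R -> R -> R).
Context (h : (V -> R) -> V -> R) (g g1 g2 : V -> R -> R -> R).
Context (H0 : V -> V -> R -> R -> R) (a : V -> 'M[R]_d).
Context (gamma alpha q0 : R) (beta : R -> R -> R) (N : nat).
Context (E0 : forall s, 0 < s -> E s) (h_op : operator_Mac_C h).
Context (g_cont : continuous_coupling E g) (g_str : g_structure E h g g1 g2).
Context (H_gr : H_growth E H h g gamma 0).
Context (H_deg : degenerate_structure E H H0 a g1 gamma 0 alpha).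
Context (hbeta : penalization (d := d) q0 beta).
Context (hN : d%:R / 2 + 1 < 2 * N%:R - 4 :> R).

Lemma uniform_estimates (M : R) : exists C : R, forall (e1 e2 : R) (m u : V -> R),
  0 < e1 < 1 -> 0 < e2 < 1 -> reg_domain N m u ->
  reg_solution H h beta N e1 e2 m u -> sobolev 1 gamma%:E u ->
  \int[mu]_x m x <= M ->
  [/\ inLp (alpha + 1)%:E m, \int[mu]_x (`|m x| `^ (alpha + 1)) <= C &
    - (\int[mu]_x (m x * beta e1 (m x))) <= e1 / (1 - e1) * C].
Proof.
have [[gE [_ [mg1 g2_ge0]]] [c c0 g2_le] g1_le [r r0 mg1_ge]] := g_str.
have [gamma1 _ [C1 [C2 [C3 [C4 [[C10 C20 C30 _] growth growthI]]]]]] := H_gr.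
have [[_ H0_smooth] a_smooth HE _ [alpha0 [C5 C50 hC5]]] := H_deg.
pose delta := C2 / (2 * C3).
have delta0 : 0 < delta by rewrite divr_gt0// mulr_gt0.
have [Cd Cd0 hCd] := g1_le _ delta0.
pose Q := (2 + C1 + C3 * c) * `|M| + C3 * Cd + C3 * c + C1.
(* The first entry bounds the power of m, through m^(alpha + 1) <= C5 (m g_1 + C5 m); the second
   bounds the penalty. *)
exists (Num.max (C5 * (2 / C2 * Q + C5 * `|M|)) (Q + C2 / 2 * r)).
move=> e1 e2 m u e1_01 e2_01 dom sol su mM.
have DpH0_le x p m0 th : E m0 ->
    enorm (DpH0 H0 x p m0 th) <= C5 * (1 + enorm p `^ (gamma - 1)).
  by move=> /(hC5 x p m0 th)[].
have mac := reg_Mac E0 dom.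
have m0 x : 0 < m x by have [_ _ [k k0 km]] := dom; exact: lt_le_trans (km x).
have mE x : E (m x) by exact: E0.
have L2m : L2 m by have [/sobolev_L2] := dom.
have L1m := L2_L1 L2m.
have mm := L1_meas L1m.
have mth : measurable_fun setT (h m).
  by have [_ ch] := h_op.1 _ mac.1; exact: measurable_continuous_rV.
pose Phi x := m x * (dot (wgrad u x) (DpH0 H0 x (wgrad u x) (m x) (h m x))
  - H0 x (wgrad u x) (m x) (h m x)).
pose K := along H (wgrad u) (whess u) m (h m).
have L1Phi : L1 Phi := reg_energy_L1 E0 h_op H0_smooth a_smooth HE gamma1 C50
  DpH0_le hbeta hN e1_01 dom sol.
have L1K : L1 K := L2_L1 (reg_hamiltonian_L2 E0 h_op H0_smooth a_smooth HE
  hbeta hN e1_01 dom sol).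
have sum_le := reg_energy_sum_le E0 h_op H0_smooth a_smooth HE gamma1 C50
  DpH0_le hbeta hN e1_01 e2_01 dom sol.
rewrite -/Phi -/K in sum_le.
(* The growth condition is taken at M = 0, since the combination - H + D_pH . p + D_MH : M does not
   depend on M; the nonnegative power of |p| is dropped. *)
have Phi_ge x : C2 * (m x * comp_g g h m x) - C1 * m x <= Phi x.
  have := growth x (wgrad u x) 0 (m x) (h m x) (mE x).
  rewrite oppr0 powRr0 mulr1 HE//.
  have sum0 (b : 'I_d -> 'I_d -> R) : \sum_i \sum_j b i j * (0 : 'M[R]_d) i j = 0.
    by rewrite big1// => i _; rewrite big1// => j _; rewrite mxE mulr0.
  rewrite !sum0.
  have -> : \sum_i DpH H i x (wgrad u x) 0 (m x) (h m x) * wgrad u x ord0 i =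
      dot (wgrad u x) (DpH0 H0 x (wgrad u x) (m x) (h m x)).
    by apply: eq_bigr => i _; rewrite (DpH_DpH0 _ _ _ _ _ HE)// mulrC.
  rewrite subr0 addr0 => gr.
  have p0 : 0 <= C1^-1 * enorm (wgrad u x) `^ gamma.
    by rewrite mulr_ge0 ?powR_ge0// invr_ge0 ltW.
  have -> : C2 * (m x * comp_g g h m x) - C1 * m x = m x * (C2 * comp_g g h m x - C1).
    by ring.
  by rewrite /Phi ler_pM2l//; move: gr p0; rewrite /comp_g; lra.
have g1_ge x : m x * comp_g g1 h m x >= - (C5 * m x).
  have [_ le1] := hC5 x 0 (m x) (h m x) (mE x).
  have p0 : 0 <= C5^-1 * m x `^ alpha by rewrite mulr_ge0 ?powR_ge0// invr_ge0 ltW.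
  rewrite -mulNr mulrC -subr_ge0 -mulrBr; apply: mulr_ge0; first exact: ltW.
  by move: le1 p0; rewrite /comp_g; lra.
have gxE x : comp_g g h m x = comp_g g1 h m x + comp_g g2 h m x by exact: gE.
have mg : measurable_fun setT (comp_g g h m).
  exact: (measurable_coupling_comp E0 g_cont.2).
have mg1' : measurable_fun setT (comp_g g1 h m) by exact: mg1 mac.1 mE.
have mg2' : measurable_fun setT (comp_g g2 h m).
  have -> : comp_g g2 h m = fun x => comp_g g h m x - comp_g g1 h m x.
    by apply/funext => x; rewrite gxE addrC addKr.
  exact: measurable_funB.
have mmg1 : measurable_fun setT (fun x => m x * comp_g g1 h m x).
  exact: measurable_funM.
have g2p := g2_ge0 _ mac.
have g1_up : \forall x \ae mu,
    C2 * (m x * comp_g g1 h m x) - C1 * m x <= Phi x.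
  apply: filterS g2p => x gp; apply: le_trans (Phi_ge x).
  rewrite lerD2r ler_pM2l// ler_pM2l// gxE; lra.
have Lmg1 : L1 (fun x => m x * comp_g g1 h m x).
  apply: (@L1_le_ae _ _ _ mu _
    (fun x => C2^-1 * (`|Phi x| + C1 * m x) + C5 * m x)) => //.
    apply: L1D; last exact: L1Z.
    by apply: L1Z; apply: L1D; [exact: integrable_norm|exact: L1Z].
  apply: filterS g1_up => x gx.
  have h1 : m x * comp_g g1 h m x <= C2^-1 * (`|Phi x| + C1 * m x).
    rewrite -ler_pdivrMl ?invr_gt0// invrK.
    by have := ler_norm (Phi x); lra.
  have h2 := g1_ge x.
  have h3 : 0 <= C5 * m x by rewrite mulr_ge0// ltW.
  have h4 : 0 <= C2^-1 * (`|Phi x| + C1 * m x).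
    apply: mulr_ge0; first by rewrite invr_ge0 ltW.
    by apply: addr_ge0 => //; apply: mulr_ge0; exact: ltW.
  by rewrite ler_norml opprD (le_trans _ h2) ?gerDr ?oppr_le0// (le_trans h1)// lerDl.
(* Division by m costs at most the factor 1 / k, where k > 0 bounds m from below. *)
have Lg1 : L1 (comp_g g1 h m).
  have [_ _ [k k0 km]] := dom.
  apply: (@L1_le _ _ _ mu _ (fun x => k^-1 * `|m x * comp_g g1 h m x|)) => //.
    by apply: L1Z; exact: integrable_norm.
  move=> x; rewrite normrM (gtr0_norm (m0 x)) mulrA ler_peMl//.
  by rewrite mulrC ler_pdivlMr// mul1r.
have IM : (\int[mu]_x (m x)%:E = (\int[mu]_x m x)%:E)%E := EInt L1m.
have M0 : 0 <= \int[mu]_x m x by apply: Rintegral_ge0 => x _; exact: ltW.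
have MM : \int[mu]_x m x <= `|M| by rewrite (le_trans mM)// ler_norm.
have := g2_le _ mac; rewrite IM -EFinD -EFinM => ig2.
have Lg2 : L1 (comp_g g2 h m).
  by apply: L1_ge0_lty => //; exact: le_lt_trans ig2 (ltry _).
rewrite (EInt Lg2) lee_fin in ig2.
have := hCd _ mac; rewrite ge_max => /andP[+ _].
rewrite (EInt Lg1) (EInt Lmg1) -EFinM -EFinD lee_fin => ig1.
have := mg1_ge _ mac; rewrite (EInt Lmg1) lee_fin => img1.
have Lg : L1 (comp_g g h m).
  have -> : comp_g g h m = fun x => comp_g g1 h m x + comp_g g2 h m x.
    by apply/funext => x; exact: gxE.
  exact: L1D.
have Ig : \int[mu]_x comp_g g h m x =
    \int[mu]_x comp_g g1 h m x + \int[mu]_x comp_g g2 h m x.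
  by rewrite -IntD//; apply: eq_Rintegral => x _; exact: gxE.
have IK : - C3 * \int[mu]_x comp_g g h m x - C1 <= \int[mu]_x K x.
  have wu i j : wderivable [:: j; i] u.
    have [_ su' _] := dom; apply: (sobolev_wderivable su').
    by have [] := large_exponent hN.
  have [/= + _] := growthI _ _ mac su wu.
  rewrite (EInt Lg) -/K (EInt L1K) -EFinM => le1.
  rewrite -lee_fin; apply: le_trans le1.
  rewrite EFinB leeD2r// leeDl// mule_ge0//.
    by rewrite lee_fin invr_ge0 ltW.
  by apply: integral_ge0 => x _; rewrite lee_fin mulr_ge0// powR_ge0.
have IPhi : C2 * \int[mu]_x (m x * comp_g g1 h m x) - C1 * \int[mu]_x m x
    <= \int[mu]_x Phi x.
  rewrite -(IntZ C2 Lmg1) -(IntZ C1 L1m) -IntB; [|exact: L1Z|exact: L1Z].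
  by apply: le_Int => //; apply: L1B; exact: L1Z.
have /andP[e10 e11] := e1_01; have /andP[e20 e21] := e2_01.
have [mB [B0 hB0]] := reg_penalty_bnd hbeta e1_01 dom.
have LB : L2 (fun x => beta e1 (m x)) := L2_bnd mu mB hB0.
have LmB := L2M_L1 L2m LB.
have Lm1B := L2M_L1 (L2B L2m (L2_cst mu 1)) LB.
have [_ /(_ _ e1_01)[_ _ b_le0 b_eq0 _]] := hbeta.
have m1B_ge0 x : 0 <= (m x - 1) * beta e1 (m x).
  have [em|me] := leP e1 (m x); first by rewrite b_eq0// mulr0.
  by rewrite mulr_le0 ?b_le0// subr_le0 ltW// (lt_trans me).
have I1 : 0 <= \int[mu]_x ((m x - 1) * beta e1 (m x)).
  by apply: Rintegral_ge0 => x _; exact: m1B_ge0.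
(* Where m < e1, the ratio m / (1 - m) is at most e1 / (1 - e1); this factor is the rate at which
   the penalty disappears. *)
have I2 : - (\int[mu]_x (m x * beta e1 (m x))) <=
    e1 / (1 - e1) * \int[mu]_x ((m x - 1) * beta e1 (m x)).
  rewrite -(IntN LmB) -(IntZ _ Lm1B); apply: le_Int; [exact: L1N|exact: L1Z|].
  apply: aeW => x; have [em|me] := leP e1 (m x); first by rewrite b_eq0// !mulr0 oppr0.
  have b0 := b_le0 _ (m0 x).
  rewrite -subr_ge0.
  have -> : e1 / (1 - e1) * ((m x - 1) * beta e1 (m x)) - - (m x * beta e1 (m x)) =
    (e1 - m x) / (1 - e1) * - beta e1 (m x).
    by field; rewrite gt_eqF// subr_gt0.
  by apply: mulr_ge0; [apply: divr_ge0; rewrite subr_ge0 ltW|rewrite oppr_ge0].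
set Z := \int[mu]_x (m x * comp_g g1 h m x) in ig1 img1 IPhi *.
set Y := \int[mu]_x ((m x - 1) * beta e1 (m x)) in sum_le I1 I2 *.
set X := \int[mu]_x m x in M0 MM ig2 sum_le IPhi *.
have e12 : e1 + e2 <= 2 by lra.
have XM : 0 <= X <= `|M| by rewrite M0.
rewrite Ig in IK.
have [Zle Yle] := coercive_bound C10 C20 C30 c0 e12 XM IPhi IK sum_le ig1 ig2 img1 I1.
rewrite -/Q in Zle Yle.
have powm x : `|m x| `^ (alpha + 1) <= C5 * (m x * comp_g g1 h m x + C5 * m x).
  rewrite gtr0_norm// powRD; last by rewrite [m x == 0]gt_eqF// implybT.
  rewrite (powRr1 (ltW (m0 x))); have [_ le1] := hC5 x 0 (m x) (h m x) (mE x).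
  have -> : C5 * (m x * comp_g g1 h m x + C5 * m x) =
    C5 * (comp_g g1 h m x + C5) * m x by ring.
  rewrite ler_pM2r// -ler_pdivrMl//; move: le1; rewrite /comp_g; lra.
have Lpow : L1 (fun x => C5 * (m x * comp_g g1 h m x + C5 * m x)).
  by apply: L1Z; apply: L1D => //; exact: L1Z.
have Lpm : L1 (fun x => `|m x| `^ (alpha + 1)).
  apply: (L1_le _ Lpow); first exact: measurable_normpowR.
  by move=> x; rewrite ger0_norm ?powR_ge0.
split.
- split; first by have [[]] := mac.1.
  by apply/LpP => //; rewrite lerDr ltW.
- rewrite le_max; apply/orP; left.
  apply: (@le_trans _ _ (\int[mu]_x (C5 * (m x * comp_g g1 h m x + C5 * m x)))).
    by apply: le_Int => //; exact: aeW.
  rewrite IntZ; last by apply: L1D => //; exact: L1Z.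
  rewrite IntD//; last exact: L1Z.
  by rewrite IntZ// ler_pM2l// lerD// ler_pM2l.
- apply: le_trans I2 _; apply: ler_wpM2l.
    by apply: divr_ge0; rewrite ?subr_ge0 ltW.
  by rewrite le_max Yle orbT.
Qed.

End uniform_estimates.

(** * Passage to the limit *)

Section extended_integral.
Context d (T : measurableType d) (R : realType) (mu : probability T R).
Local Notation L1 f := (mu.-integrable setT (EFin \o f)).

(* Holds without measurability, by the definition of the integral as a supremum. *)
Lemma le_integralT (f g : T -> \bar R) : (forall x, (f x <= g x)%E) ->
  (\int[mu]_x f x <= \int[mu]_x g x)%E.
Proof.
move=> fg; rewrite /integral !patch_setT; apply: leeB; apply: le_ereal_sup.
  move=> _ [k /= kf <-]; exists k => //= x; apply: le_trans (kf x) _.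
  rewrite funepos.unlock; exact: le_max2.
move=> _ [k /= kf <-]; exists k => //= x; apply: le_trans (kf x) _.
by rewrite funeneg.unlock; apply: le_max2 => //; rewrite leeN2.
Qed.

(** Raising [f'] to +oo on the exceptional null set makes the comparison pointwise, so that
    [le_integralT] applies to an [f] of unknown measurability. *)
Lemma ae_le_integralT (f f' : T -> \bar R) :
  measurable_fun setT f' -> (\forall x \ae mu, (f x <= f' x)%E) ->
  (\int[mu]_x f x <= \int[mu]_x f' x)%E.
Proof.
move=> mf' [A [mA A0 fA]].
pose f'' x := if x \in A then +oo%E else f' x.
have mf'' : measurable_fun setT f''.
  apply: measurable_fun_ifT => //; apply: (measurable_fun_bool true).
  by rewrite setTI (_ : _ @^-1` _ = A)//; apply/seteqP; split=> x /=; [exact: set_mem|exact: mem_set].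
have -> : (\int[mu]_x f' x = \int[mu]_x f'' x)%E.
  apply: ae_eq_integral => //; exists A; split=> // x /= /not_implyP[_ h].
  by apply: contrapT => xA; apply: h; rewrite /f''; case: ifPn => //; rewrite inE.
apply: le_integralT => x; rewrite /f''; case: ifPn => [_|xA]; first exact: leey.
by apply: contrapT => h; move/negP : xA; apply; rewrite inE; exact: fA.
Qed.

(** The mirror image, with -oo on the null set; it serves for m L_0, a supremum over uncountably
    many momenta. *)
Lemma ae_ge_integralT (f f' : T -> \bar R) :
  measurable_fun setT f' -> (\forall x \ae mu, (f' x <= f x)%E) ->
  (\int[mu]_x f' x <= \int[mu]_x f x)%E.
Proof.
move=> mf' [A [mA A0 fA]].
pose f'' x := if x \in A then -oo%E else f' x.
have mf'' : measurable_fun setT f''.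
  apply: measurable_fun_ifT => //; apply: (measurable_fun_bool true).
  by rewrite setTI (_ : _ @^-1` _ = A)//; apply/seteqP; split=> x /=; [exact: set_mem|exact: mem_set].
have -> : (\int[mu]_x f' x = \int[mu]_x f'' x)%E.
  apply: ae_eq_integral => //; exists A; split=> // x /= /not_implyP[_ h].
  by apply: contrapT => xA; apply: h; rewrite /f''; case: ifPn => //; rewrite inE.
apply: le_integralT => x; rewrite /f''; case: ifPn => [_|xA]; first exact: leNye.
by apply: contrapT => h; move/negP : xA; apply; rewrite inE; exact: fA.
Qed.

(** If the negative part of f - u has infinite integral, the extended integral is -oo by convention.
    Otherwise the negative part of f is integrable because u is, and the hypothesis then controls
    its positive part. *)
Lemma integral_sub_le0 (f u : T -> R) : measurable_fun setT f -> L1 u ->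
  (\int[mu]_x (f x)%:E <= (\int[mu]_x u x)%:E)%E ->
  (\int[mu]_x (f x - u x)%:E <= 0)%E.
Proof.
move=> mf lu fu.
have mfu : measurable_fun setT (fun x => f x - u x).
  exact: measurable_funB mf (L1_meas lu).
pose w x := (f x - u x)%:E.
have mw : measurable_fun setT w by exact/measurable_EFinP.
have [wy|wNy] := ltP (\int[mu]_x w^\- x)%E +oo%E; last first.
  rewrite -/w integralE (_ : (\int[mu]_x w^\- x = +oo)%E); last first.
    by apply/eqP; rewrite eq_le leey wNy.
  by rewrite addeNy leNy0.
have Lfm : L1 (fun x => Num.max (- f x) 0).
  have lwm : L1 (fun x => Num.max (- (f x - u x)) 0).
    apply: L1_ge0_lty.
    - by apply: measurable_maxr => //; exact: measurableT_comp.
    - by apply: aeW => x; rewrite le_max lexx orbT.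
    - apply: le_lt_trans wy; rewrite le_eqVlt; apply/orP; left; apply/eqP.
      by apply: eq_integral => x _; rewrite funeneg.unlock /w EFin_max.
  apply: (@L1_le_ae _ _ _ mu _ (fun x => Num.max (- (f x - u x)) 0 + `|u x|)).
  - by apply: measurable_maxr => //; exact: measurableT_comp.
  - by apply: L1D => //; exact: integrable_norm.
  - apply: aeW => x; rewrite ger0_norm ?le_max ?lexx ?orbT//.
    rewrite ge_max; apply/andP; split.
      have := ler_norm (- u x); rewrite normrN => h.
      have : - (f x - u x) <= Num.max (- (f x - u x)) 0 by rewrite le_max lexx.
      lra.
    by rewrite addr_ge0// le_max lexx orbT.
have Lf : L1 f.
  have lfp : L1 (fun x => Num.max (f x) 0).
    apply: L1_ge0_lty.
    - exact: measurable_maxr.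
    - by apply: aeW => x; rewrite le_max lexx orbT.
    - move: fu; rewrite integralE.
      have -> : (\int[mu]_x (EFin \o f)^\- x = (\int[mu]_x Num.max (- f x) 0)%:E)%E.
        by rewrite -EInt//; apply: eq_integral => x _; rewrite funeneg.unlock/= EFin_max.
      rewrite leeBlDr// => h; apply: le_lt_trans (ltry _); apply: le_trans h.
      rewrite le_eqVlt; apply/orP; left; apply/eqP.
      by apply: eq_integral => x _; rewrite funepos.unlock/= EFin_max.
  have -> : f = fun x => Num.max (f x) 0 - Num.max (- f x) 0.
    by apply/funext => x; rewrite /Num.max; case: ltP => ?; case: ltP => ?; lra.
  exact: L1B.
move: fu; rewrite (EInt Lf) lee_fin => fu.
by rewrite (EInt (L1B Lf lu)) lee_fin IntB// subr_le0.
Qed.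

End extended_integral.

Lemma limn_einf_le_cvg (R : realType) (u v : nat -> \bar R) (l : \bar R) :
  (forall n, (u n <= v n)%E) -> v @ \oo --> l -> (limn_einf u <= l)%E.
Proof.
move=> uv vl; rewrite -(cvg_limn_einf_sup vl).1 !limn_einf_lim.
apply: lee_lim; [exact: is_cvg_einfs|exact: is_cvg_einfs|].
apply: nearW => n; apply: le_ereal_inf_tmp => _ [k nk <-].
by apply: le_trans (uv k); apply: ereal_inf_lbound; exists k.
Qed.

Lemma increasing_cvg_pinfty (sigma : nat -> nat) :
  {homo sigma : i j / (i < j)%N} -> sigma @ \oo --> \oo.
Proof.
move=> ms; have le_sigma n : (n <= sigma n)%N.
  by elim: n => // n /leq_ltn_trans; apply; exact: ms.
move=> A [n _ nA]; exists n => // k /= nk; apply: nA => /=.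
exact: leq_trans (le_sigma k).
Qed.

(** * Operations on weak limits *)

Section weak_limits.
Context {R : realType} {d : nat}.
Local Notation V := 'rV[R]_d.
Local Notation mu := (@leb R d).
Local Notation L1 f := (mu.-integrable setT (EFin \o f)).

Lemma weak_Lp_subseq p (f_ : nat -> V -> R) f (sigma : nat -> nat) :
  {homo sigma : i j / (i < j)%N} -> weak_Lp p f_ f ->
  weak_Lp p (fun k => f_ (sigma k)) f.
Proof.
move=> ms [lf_ lf wf]; split=> // psi hpsi.
exact: (cvg_comp sigma _ (increasing_cvg_pinfty ms) (wf psi hpsi)).
Qed.

(** Makes 1 an admissible test, so that weak convergence passes to integrals; p = 1 asks for a
    bounded test and is treated apart. *)
Lemma inLp_conjugate1 (p : R) : 1 <= p ->
  inLp (hoelder_conjugate p%:E) (fun _ : V => 1 : R).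
Proof.
rewrite le_eqVlt => /predU1P[<-|p1].
  by rewrite hoelder_conjugate1; apply: (@inLpy_bnd _ _ _ 1) => // x; rewrite normr1.
have p0 : 0 < p by lra.
pose q := p / (p - 1).
have -> : hoelder_conjugate p%:E = q%:E.
  apply/esym/hoelder_conjugateP.
  - exact: ltNyr.
  - by rewrite eqe gt_eqF.
  - rewrite !inver !gt_eqF// ?divr_gt0 ?subr_gt0// -EFinD; congr (_%:E).
    by rewrite /q; field; rewrite !gt_eqF//; lra.
have q1 : 1 <= q by rewrite /q ler_pdivlMr ?subr_gt0//; lra.
split=> //; apply/(LpP _ q1); split=> //.
exact: L1_cst.
Qed.

Lemma weak_Lp_Int (p : R) (f_ : nat -> V -> R) f : 1 <= p -> weak_Lp p%:E f_ f ->
  \int[mu]_x f_ k x @[k --> \oo] --> \int[mu]_x f x.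
Proof.
move=> p1 [_ _ /(_ _ (inLp_conjugate1 p1)) wf].
have one (g : V -> R) : \int[mu]_x (g x * 1) = \int[mu]_x g x.
  by apply: eq_Rintegral => x _; rewrite mulr1.
by move: wf; rewrite one; under eq_cvg do rewrite one.
Qed.

(* No integrability is needed: both sides are 0 when the integral is infinite. *)
Lemma Rintegral_opp (f : V -> R) : \int[mu]_x (- f x) = - \int[mu]_x f x.
Proof.
rewrite /Rintegral integralE [in RHS]integralE.
have -> : (fun x => (- f x)%:E) = (\- (EFin \o f))%E by [].
rewrite funeposN funenegN.
set I := (\int[mu]_x _^\- x)%E; set I' := (\int[mu]_x _^\+ x)%E.
by case: I => [r| |]; case: I' => [r'| |] //=; rewrite ?oppr0// opprB.
Qed.

Lemma inLp_vecN (p : R) (J : V -> V) : 1 <= p -> inLp_vec p%:E J ->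
  inLp_vec p%:E (fun x => - J x).
Proof.
move=> p1 hJ i; have [pJ /(LpP _ p1)[mJ lJ]] := hJ i.
split; first by move=> x k; rewrite !mxE pJ.
apply/(LpP _ p1); split.
  by under eq_fun do rewrite mxE; exact: measurableT_comp.
by under eq_fun do rewrite mxE normrN.
Qed.

Lemma dotNl (v w : V) : dot (- v) w = - dot v w.
Proof. by rewrite /dot -sumrN; apply: eq_bigr => i _; rewrite mxE mulNr. Qed.

Lemma weak_Lp_vecN (p : R) (J_ : nat -> V -> V) J : 1 <= p ->
  weak_Lp_vec p%:E J_ J ->
  weak_Lp_vec p%:E (fun k x => - J_ k x) (fun x => - J x).
Proof.
move=> p1 [lJ_ lJ wJ]; split=> [k||psi hpsi]; [exact: inLp_vecN|exact: inLp_vecN|].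
have NN (A : V -> V) : \int[mu]_x dot (- A x) (psi x) = - \int[mu]_x dot (A x) (psi x).
  by under eq_Rintegral do rewrite dotNl; exact: Rintegral_opp.
rewrite NN; under eq_cvg do rewrite NN.
by apply: cvgN; exact: wJ.
Qed.

(** Where m is not positive, [m'] is 1, so that [H0] is evaluated inside its domain of smoothness;
    almost everywhere m = 0 there, and the factor m removes the value. *)
Lemma measurable_potential (E : set R) (H0 : V -> V -> R -> R -> R)
    (h : (V -> R) -> V -> R) (J : V -> V) (m phi : V -> R) :
  (forall s, 0 < s -> E s) ->
  smooth_on [set z : V * V * R * R | E z.1.2]
    (fun z => H0 z.1.1.1 z.1.1.2 z.1.2 z.2) ->
  (forall i, measurable_fun setT (fun x => J x ord0 i)) ->
  measurable_fun setT m -> (\forall x \ae mu, 0 <= m x) ->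
  measurable_fun setT (h m) -> smooth phi ->
  exists2 f : V -> R, measurable_fun setT f &
    \forall x \ae mu, dot (J x) (grad phi x) - H0m H0 h phi m x = f x.
Proof.
move=> E0 sH mJ mm m0 mh sphi.
have mphi i : measurable_fun setT (fun x => grad phi x ord0 i).
  under eq_fun do rewrite mxE.
  exact: measurable_smooth (smooth_partial i sphi).
pose m' x := if 0 < m x then m x else 1.
have mm' : measurable_fun setT m'.
  apply: measurable_fun_ifT => //.
  exact: measurable_fun_ltr.
exists (fun x => dot (J x) (grad phi x) - H0 x (grad phi x) (m' x) (h m x) * m x).
  apply: measurable_funB.
    by apply: measurable_sum => i; exact: measurable_funM.
  apply: measurable_funM => //.
  apply: (@measurable_H0_comp _ _ E H0 (grad phi) m' (h m) E0) => // x.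
  by rewrite /m'; case: ifPn.
apply: filterS m0 => x mx; congr (_ - _); rewrite /H0m /m' lt_neqAle mx andbT.
by rewrite [0 == _]eq_sym; case: eqP => [->|_] //=; rewrite mulr0.
Qed.

End weak_limits.

Theorem proposition5p5 (R : realType) (d : nat) (hd : (0 < d)%N)
  (E : set R) (hE : E = [set s | 0 < s] \/ E = [set s | 0 <= s])
  (H : 'rV[R]_d -> 'rV[R]_d -> 'M[R]_d -> R -> R -> R)
  (h : ('rV[R]_d -> R) -> 'rV[R]_d -> R)
  (g g1 g2 : 'rV[R]_d -> R -> R -> R)
  (H0 : 'rV[R]_d -> 'rV[R]_d -> R -> R -> R)
  (a : 'rV[R]_d -> 'M[R]_d)
  (gamma tau alpha q : R)
  (h_op : operator_Mac_C h)
  (g_cont : continuous_coupling E g)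
  (h_reg : h_regularity h)
  (g_str : g_structure E h g g1 g2)
  (g_comp : g_compactness E h g1)
  (H_gr : H_growth E H h g gamma tau)
  (H_sm : H_smoothness E H)
  (H_mono : monotonicity E H h)
  (H_deg : degenerate_structure E H H0 a g1 gamma tau alpha)
  (hq : q = ((alpha + 1) * gamma) / ((alpha + 1) * gamma - alpha))
  (L_lsc : lagrangian_lsc E H0 h alpha q)
  (N : nat) (hN : d%:R / 2 + 1 < 2 * N%:R - 4 :> R)
  (q0 : R) (beta : R -> R -> R) (hbeta : penalization (d := d) q0 beta)
  (meps ueps : R -> R -> 'rV[R]_d -> R)
  (eps_dom : forall e1 e2 : R, 0 < e1 < 1 -> 0 < e2 < 1 ->
     reg_domain N (meps e1 e2) (ueps e1 e2))
  (eps_sol : forall e1 e2 : R, 0 < e1 < 1 -> 0 < e2 < 1 ->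
     reg_solution H h beta N e1 e2 (meps e1 e2) (ueps e1 e2))
  (m u : 'rV[R]_d -> R)
  (m_L1 : inLp 1%E m) (u_W1 : sobolev 1 gamma%:E u)
  (m_ge0 : \forall x \ae leb d, 0 <= m x)
  (m_mass : \int[leb d]_x m x = 1)
  (mu_sol : weak_solution E H h (regular_distribution m)
                                (regular_distribution u))
  (e1_ e2_ : nat -> R)
  (e_01 : forall k, 0 < e1_ k < 1 /\ 0 < e2_ k < 1)
  (e1_0 : e1_ @ \oo --> (0 : R)) (e2_0 : e2_ @ \oo --> (0 : R))
  (m_lim : weak_Lp 1%E (fun k => meps (e1_ k) (e2_ k)) m)
  (u_lim : weak_W1p gamma%:E (fun k => ueps (e1_ k) (e2_ k)) u)
  (sigma : nat -> nat) (sigma_incr : {homo sigma : i j / (i < j)%N})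
  (J : 'rV[R]_d -> 'rV[R]_d)
  (J_lim : weak_Lp_vec q%:E
     (fun k x =>
        let mk := meps (e1_ (sigma k)) (e2_ (sigma k)) in
        let uk := ueps (e1_ (sigma k)) (e2_ (sigma k)) in
        mk x *: DpH0 H0 x (wgrad uk x) (mk x) (h mk x)) J) :
  forall phi : 'rV[R]_d -> R, smooth phi ->
    (\int[leb d]_x (dot (J x) (grad phi x) - H0m H0 h phi m x - u x)%:E <= 0)%E.
Proof.
move=> phi sphi.
have E0 s : 0 < s -> E s by case: hE => -> //= /ltW.
have tau0 : tau = 0 by case: H_deg.
rewrite tau0 in H_gr H_deg.
have [gamma1 _ _] := H_gr.
have [[_ H0_smooth] _ _ _ [alpha0 [C5 C50 hC5]]] := H_deg.
have [H0_convex lsc] := L_lsc.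
have gamma1' := ltW gamma1.
have alpha1 : 1 < alpha + 1 by rewrite ltrDr.
(* The denominator of q is positive because gamma > 1, and below the numerator because alpha > 0. *)
have q1 : 1 <= q.
  have den : 0 < (alpha + 1) * gamma - alpha.
    rewrite subr_gt0 (@lt_trans _ _ (alpha + 1)) ?ltrDl// ltr_pMr//.
    by rewrite addr_gt0.
  by rewrite hq ler_pdivlMr// mul1r gerBl ltW.
pose e1k k := e1_ (sigma k); pose e2k k := e2_ (sigma k).
pose mk k := meps (e1k k) (e2k k); pose uk k := ueps (e1k k) (e2k k).
have e1_01 k : 0 < e1k k < 1 by have [] := e_01 (sigma k).
have e2_01 k : 0 < e2k k < 1 by have [] := e_01 (sigma k).
have dom k : reg_domain N (mk k) (uk k) by exact: eps_dom.
have sol k : reg_solution H h beta N (e1k k) (e2k k) (mk k) (uk k) by exact: eps_sol.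
have m_lim' : weak_Lp 1%E mk m := weak_Lp_subseq sigma_incr m_lim.
have [u_W1k _ u_lim0 _] := u_lim.
have u_lim' : weak_Lp gamma%:E uk u := weak_Lp_subseq sigma_incr u_lim0.
have Iu := weak_Lp_Int gamma1' u_lim'.
have Im := weak_Lp_Int (lexx _) m_lim'.
have [M hM] : exists M : R, forall k, \int[leb d]_x mk k x <= M.
  have /cvg_seq_bounded/bounded_fun_has_ubound[M hM] : cvgn (fun k => \int[leb d]_x mk k x).
    by apply/cvg_ex; eexists; exact: Im.
  by exists M => k; apply: hM; exists k.
have [C hC] := uniform_estimates E0 h_op g_cont g_str H_gr H_deg hbeta hN M.
have {}hC k := hC _ _ _ _ (e1_01 k) (e2_01 k) (dom k) (sol k) (u_W1k _) (hM k).
have mk_gt0 k x : 0 < mk k x.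
  by have [_ _ [c c0 cm]] := dom k; exact: lt_le_trans (cm x).
have m_lim2 : weak_Lp (alpha + 1)%:E mk m.
  apply: (@weak_L1_Lp _ _ _ _ _ C) => // k; by have [] := hC k.
pose Jk k x := mk k x *: DpH0 H0 x (wgrad (uk k) x) (mk k x) (h (mk k) x).
(* [L0] pairs the momentum with - v, so the velocity optimal for p is - D_pH_0 and the functional is
   evaluated at - J. *)
have J_lim2 : weak_Lp_vec q%:E (fun k x => - Jk k x) (fun x => - J x).
  exact: weak_Lp_vecN q1 J_lim.
have mac : Mac m by [].
have mk_ge0 k : \forall x \ae leb d, 0 <= mk k x by apply: aeW => x; exact: ltW.
have := lsc _ _ _ _ mk_ge0 m_ge0 m_lim2 J_lim2.
have DpH0_le x p m0 th : E m0 ->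
    enorm (DpH0 H0 x p m0 th) <= C5 * (1 + enorm p `^ (gamma - 1)).
  by move=> /(hC5 x p m0 th)[].
have [_ a_smooth HE _ _] := H_deg.
(* The bound of [reg_energy_le] with the penalty replaced by its vanishing estimate, so that only
   the integral of [u] is left in the limit. *)
pose b k := \int[leb d]_x uk k x + e1k k / (1 - e1k k) * C.
have e1k0 : e1k k @[k --> \oo] --> (0 : R).
  exact: (cvg_comp sigma _ (increasing_cvg_pinfty sigma_incr) e1_0).
have b_lim : b k @[k --> \oo] --> \int[leb d]_x u x.
  rewrite -[X in _ --> X]addr0; apply: cvgD; first exact: Iu.
  rewrite -[X in _ --> X](mul0r C); apply: cvgM; last exact: cvg_cst.
  rewrite -[X in _ --> X](mul0r (1 - 0)^-1); apply: cvgM => //.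
  apply: cvgV; first by rewrite subr0 oner_neq0.
  by apply: cvgB => //; exact: cvg_cst.
have Jk_le k : (\int[leb d]_x mL0 H0 h (mk k) (fun x => (- Jk k x)%R) x <= (b k)%:E)%E.
  rewrite (_ : (\int[leb d]_x _)%E = (\int[leb d]_x (mk k x *
      (dot (wgrad (uk k) x) (DpH0 H0 x (wgrad (uk k) x) (mk k x) (h (mk k) x))
       - H0 x (wgrad (uk k) x) (mk k x) (h (mk k) x)))%:E)%E); last first.
    by apply: eq_integral => x _; rewrite (@mL0_flux _ _ E H0 h H0_smooth H0_convex)//; exact: E0.
  rewrite EInt; last first.
    exact: (reg_energy_L1 E0 h_op H0_smooth a_smooth HE gamma1 C50 DpH0_le hbeta hN
      (e1_01 k) (dom k) (sol k)).
  rewrite lee_fin; apply: (le_trans (reg_energy_le E0 h_op H0_smooth a_smooth HE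
    gamma1 C50 DpH0_le hbeta hN (e1_01 k) (e2_01 k) (dom k) (sol k))).
  by rewrite lerD2l; have [] := hC k.
have bE : (b k)%:E @[k --> \oo] --> (\int[leb d]_x u x)%:E by apply: cvg_EFin => //; exact: nearW.
move=> /le_trans/(_ (limn_einf_le_cvg Jk_le bE)) lim_le.
have L1u : (leb d).-integrable setT (EFin \o u).
  have [[_ /(LpP _ gamma1')[mu' lu']] _] := u_W1.
  apply: (@L1_le _ _ _ (leb d) _ (fun x => 1 + `|u x| `^ gamma)) => //.
    by apply: L1D => //; exact: L1_cst.
  move=> x; have [u1|u1] := leP `|u x| 1; first by rewrite ler_wpDr// powR_ge0.
  by rewrite ler_wpDl// -[leLHS]powRr1// ler_powR// ltW.
have mJ i : measurable_fun setT (fun x => J x ord0 i).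
  by have [_ lJ _] := J_lim; have [_ /(LpP _ q1)[]] := lJ i.
have mm : measurable_fun setT m by have [_ /inLp1P[_ /L1_meas]] := conj I m_L1.
have mh : measurable_fun setT (h m).
  by have [_ ch] := h_op.1 _ mac; exact: measurable_continuous_rV.
have [f mf fE] := measurable_potential E0 H0_smooth mJ mm m_ge0 mh sphi.
have mfu : measurable_fun setT (fun x => f x - u x).
  exact: measurable_funB mf (L1_meas L1u).
apply: (@le_trans _ _ (\int[leb d]_x (f x - u x)%:E)%E).
  apply: ae_le_integralT; first exact/measurable_EFinP.
  by apply: filterS fE => x ->.
apply: integral_sub_le0 => //; apply: le_trans lim_le.
apply: ae_ge_integralT; first exact/measurable_EFinP.
apply: filterS2 fE m_ge0 => x <- mx.
exact: mL0_fenchel.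
Qed.
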